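(* Let $n\ge1$ and suppose $\varphi\in\mathcal F^2(\mathbb C^n)$ is such that $S_\varphi$ is bounded on $\mathcal F^2(\mathbb C^n)$, where $$S_\varphi F(z)=\int_{\mathbb C^n}F(w)\,e^{z\cdot\bar w}\,\varphi(z-\bar w)\,d\lambda(w),\qquad z\in\mathbb C^n,$$ and let $m\in L^\infty(\mathbb R^n)$ be such that $$\varphi(z)=\left(\frac{2}{\pi}\right)^{n/2}\int_{\mathbb R^n}m(x)\,e^{-2\left(x-\frac i2 z\right)^2}\,dx,\qquad z\in\mathbb C^n.$$ Then $S_\varphi^*=S_{\tilde\varphi}$, where $$\tilde\varphi(z)=\left(\frac{2}{\pi}\right)^{n/2}\int_{\mathbb R^n}\overline{m(x)}\,e^{-2\left(x-\frac i2 z\right)^2}\,dx,\qquad z\in\mathbb C^n.$$ Furthermore, $S_\varphi$ is normal.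
   Context: $d\lambda(z)=\pi^{-n}e^{-|z|^2}\,dz$ is the Gaussian measure on $\mathbb C^n$. The Fock space $\mathcal F^2(\mathbb C^n)$ is the Hilbert space of all entire functions $F$ on $\mathbb C^n$ with $\|F\|^2_{\mathcal F^2(\mathbb C^n)}=\int_{\mathbb C^n}|F(z)|^2\,d\lambda(z)<\infty$, with the inner product inherited from $L^2(\mathbb C^n,d\lambda)$. Notation: $z\cdot\bar w=\sum_{j=1}^n z_j\bar w_j$, and for $a\in\mathbb C^n$, $a^2=\sum_{j=1}^n a_j^2$ (bilinear, no conjugation). ''$S_\varphi$ is bounded on $\mathcal F^2(\mathbb C^n)$'' means that the integral formula defines a bounded linear operator from $\mathcal F^2(\mathbb C^n)$ to itself. It is a known fact that $S_\varphi$ is bounded on $\mathcal F^2(\mathbb C^n)$ if and only if such an $m\in L^\infty(\mathbb R^n)$ exists. *)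

(* Defs.v *)
From HB Require Import structures.
From mathcomp Require Import all_boot all_order all_algebra.
From mathcomp Require Import complex.
From mathcomp Require Import all_classical all_reals all_analysis.
From mathcomp Require Import measurable_realfun.

Set Implicit Arguments.
Unset Strict Implicit.
Unset Printing Implicit Defensive.

Import Order.TTheory GRing.Theory Num.Theory.
Import numFieldNormedType.Exports.
Import ComplexField.Normc.

Local Open Scope classical_set_scope.
Local Open Scope ring_scope.

(* Real n-space is a type of tuples, which carries the product of the Borel
   sigma-algebras; complex n-space is a type of row vectors, which carries a
   normed space structure over R[i]. *)
Notation Rn R n := (n.-tuple (measurableTypeR R)).
Notation Cn R n := 'rV[R[i]]_n.

Section sigma_finite_product.
Context d1 d2 (T1 : measurableType d1) (T2 : measurableType d2) (R : realType).
Variable m1 : {sigma_finite_measure set T1 -> \bar R}.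
Variable m2 : {sigma_finite_measure set T2 -> \bar R}.

(* A copy of [m1 \x m2]: the canonical sigma-finite structure registered for
   the latter only applies when [m1] and [m2] are subprobabilities. *)
Definition sfprod := (m1 \x m2)%E.

HB.instance Definition _ := Measure.on sfprod.

Let sfprod_sigma_finite : sigma_finite [set: T1 * T2] sfprod.
Proof.
have /sigma_finiteP[F [TF ndF Foo]] := sigma_finiteT m1.
have /sigma_finiteP[G [TG ndG Goo]] := sigma_finiteT m2.
exists (fun n => F n `*` G n).
- rewrite -setXTT TF TG predeqE => -[x y]; split.
    move=> [/= [n _ Fnx] [k _ Gky]]; exists (maxn n k) => //; split.
    + by move: x Fnx; exact/subsetPset/ndF/leq_maxl.
    + by move: y Gky; exact/subsetPset/ndG/leq_maxr.
  by move=> [n _ []/= ? ?]; split; exists n.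
- move=> k; have [? ?] := Foo k; have [? ?] := Goo k.
  split; first exact: measurableX.
  by rewrite /sfprod product_measure1E// lte_mul_pinfty// ge0_fin_numE.
Qed.

HB.instance Definition _ := Measure_isSigmaFinite.Build _ _ _ sfprod
  sfprod_sigma_finite.

End sigma_finite_product.

Section lebesgue_step.
Context (R : realType) (n : nat).
Variable mu : {sigma_finite_measure set (Rn R n) -> \bar R}.

Definition Rn_cons (p : measurableTypeR R * Rn R n) : Rn R n.+1 :=
  [the Rn R n.+1 of p.1 :: p.2].

Lemma measurable_Rn_cons : measurable_fun [set: _] Rn_cons.
Proof. exact: measurable_cons. Qed.

Definition lebesgue_step : set (Rn R n.+1) -> \bar R :=
  pushforward (sfprod lebesgue_measure mu) Rn_cons.

Let lebesgue_step0 : lebesgue_step set0 = 0%E.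
Proof. by rewrite /lebesgue_step /pushforward preimage_set0 measure0. Qed.

Let lebesgue_step_ge0 A : (0 <= lebesgue_step A)%E.
Proof. by rewrite /lebesgue_step /pushforward measure_ge0. Qed.

Let lebesgue_step_sigma_additive : semi_sigma_additive lebesgue_step.
Proof.
move=> F mF tF mUF; rewrite /lebesgue_step /pushforward preimage_bigcup.
have mpre A : measurable A -> measurable (Rn_cons @^-1` A).
  by move=> mA; rewrite -[X in measurable X]setTI; exact: measurable_Rn_cons.
apply: measure_semi_sigma_additive.
- by move=> k; exact: mpre.
- apply/trivIsetP => /= i j _ _ ij; rewrite -preimage_setI.
  by move/trivIsetP : tF => /(_ _ _ _ _ ij) ->//; rewrite preimage_set0.
- by rewrite -preimage_bigcup; exact: mpre.
Qed.

HB.instance Definition _ := isMeasure.Build _ _ _ lebesgue_step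
  lebesgue_step0 lebesgue_step_ge0 lebesgue_step_sigma_additive.

Let lebesgue_step_sigma_finite : sigma_finite [set: Rn R n.+1] lebesgue_step.
Proof.
have [F UF mF] := sigma_finiteT (sfprod lebesgue_measure mu).
pose Rn_uncons (x : Rn R n.+1) : measurableTypeR R * Rn R n :=
  (tnth x ord0, [tuple of behead x]).
have unconsK p : Rn_uncons (Rn_cons p) = p.
  case: p => a t; rewrite /Rn_uncons /Rn_cons; congr pair.
  exact: val_inj.
have muncons : measurable_fun [set: _] Rn_uncons.
  apply/measurable_fun_pairP; split.
    exact: measurable_tnth.
  exact: measurable_behead.
exists (fun k => Rn_uncons @^-1` F k).
  by rewrite -preimage_bigcup -UF preimage_setT.
move=> k; have [mFk Fkoo] := mF k; split.
  by rewrite -[X in measurable X]setTI; exact: muncons.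
rewrite /lebesgue_step /pushforward -comp_preimage.
suff -> : Rn_uncons \o Rn_cons = id by [].
exact/funext.
Qed.

HB.instance Definition _ := Measure_isSigmaFinite.Build _ _ _ lebesgue_step
  lebesgue_step_sigma_finite.

End lebesgue_step.

Fixpoint lebesgueRn (R : realType) (n : nat) :
    {sigma_finite_measure set (Rn R n) -> \bar R} :=
  match n with
  | 0 => \d_([tuple] : Rn R 0)
  | k.+1 => lebesgue_step (lebesgueRn R k)
  end.

Section complex_integral.
Context d (T : measurableType d) (R : realType).
Variable mu : {measure set T -> \bar R}.
Implicit Type f : T -> R[i].

Definition cmeasurable f :=
  measurable_fun [set: T] (fun x => complex.Re (f x)) /\
  measurable_fun [set: T] (fun x => complex.Im (f x)).

Definition cintegrable f :=
  mu.-integrable [set: T] (fun x => (complex.Re (f x))%:E) /\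
  mu.-integrable [set: T] (fun x => (complex.Im (f x))%:E).

Definition cintegral f : R[i] :=
  Complex (\int[mu]_x complex.Re (f x)) (\int[mu]_x complex.Im (f x)).

Definition mem_Linfty f :=
  cmeasurable f /\ finite_norm mu +oo%E (fun x => normc (f x)).

End complex_integral.

Section gaussian_measure.
Context (R : realType) (n : nat).

(* The point x + iy, for (x, y) in R^n x R^n; functions on C^n are integrated
   through this identification. *)
Definition toCn (p : Rn R n * Rn R n) : Cn R n :=
  \row_j (tnth p.1 j +i* tnth p.2 j)%C.

Definition lebesgueCn := sfprod (lebesgueRn R n) (lebesgueRn R n).

Definition Cn_sqnorm (z : Cn R n) : R := \sum_j normc (z ord0 j) ^+ 2.

Definition gaussian_pdf (z : Cn R n) : R := pi ^- n * expR (- Cn_sqnorm z).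

Definition gaussian (A : set (Rn R n * Rn R n)) : \bar R :=
  (\int[lebesgueCn]_(p in A) (gaussian_pdf (toCn p))%:E)%E.

Let gaussian_pdf_ge0 z : 0 <= gaussian_pdf z.
Proof. by rewrite mulr_ge0 ?expR_ge0// invr_ge0 exprn_ge0 ?pi_ge0. Qed.

Lemma Cn_sqnormE p :
  Cn_sqnorm (toCn p) = \sum_j (tnth p.1 j ^+ 2 + tnth p.2 j ^+ 2).
Proof.
apply: eq_bigr => j _; rewrite mxE /normc sqr_sqrtr//.
by rewrite addr_ge0 ?sqr_ge0.
Qed.

Lemma measurable_gaussian_pdf :
  measurable_fun [set: _] (fun p => gaussian_pdf (toCn p)).
Proof.
apply: measurable_funM => //; apply: measurableT_comp => //.
apply: measurableT_comp => //.
under eq_fun do rewrite Cn_sqnormE.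
apply: measurable_sum => j; apply: measurable_funD; apply: measurable_funX.
  exact: (measurableT_comp (measurable_tnth j) measurable_fst).
exact: (measurableT_comp (measurable_tnth j) measurable_snd).
Qed.

Let gaussian0 : gaussian set0 = 0%E.
Proof. by rewrite /gaussian integral_set0. Qed.

Let gaussian_ge0 A : (0 <= gaussian A)%E.
Proof. by apply: integral_ge0 => p _; rewrite lee_fin. Qed.

Let gaussian_sigma_additive : semi_sigma_additive gaussian.
Proof.
apply: (@semi_sigma_additive_nng_induced _ _ _ lebesgueCn
  (fun p => (gaussian_pdf (toCn p))%:E)) => [|p]; last by rewrite lee_fin.
by apply/measurable_EFinP; exact: measurable_gaussian_pdf.
Qed.

HB.instance Definition _ := isMeasure.Build _ _ _ gaussian
  gaussian0 gaussian_ge0 gaussian_sigma_additive.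

End gaussian_measure.

Definition cexp (R : realType) (z : R[i]) : R[i] :=
  let: (a +i* b)%C := z in Complex (expR a * cos b) (expR a * sin b).

Section fock.
Context (R : realType) (n : nat).
Local Notation C := R[i].
Implicit Types (F G : Cn R n -> C) (T S : (Cn R n -> C) -> Cn R n -> C).

Definition gaussian_integral F : C :=
  cintegral (@gaussian R n) (fun p => F (toCn p)).

Definition gaussian_integrable F :=
  cintegrable (@gaussian R n) (fun p => F (toCn p)).

(* The target R[i]^o makes this complex differentiability. *)
Definition entire F := forall z, differentiable (F : Cn R n -> C^o) z.

Definition fock_sqnorm F : \bar R :=
  (\int[@gaussian R n]_p (normc (F (toCn p)) ^+ 2)%:E)%E.

Definition fock F := entire F /\ (fock_sqnorm F < +oo)%E.

Definition fock_norm F : R := Num.sqrt (fine (fock_sqnorm F)).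

Definition fock_inner F G : C := gaussian_integral (fun z => F z * (G z)^*%C).

Definition fock_bounded T :=
  [/\ forall F, fock F -> fock (T F),
      forall (a : C) F G, fock F -> fock G ->
        T (fun z => a * F z + G z) = (fun z => a * T F z + T G z)
    & exists M : R, forall F, fock F -> fock_norm (T F) <= M * fock_norm F].

(* [S] and [T] only matter through their restrictions to the Fock space. *)
Definition fock_adjoint S T :=
  fock_bounded T /\
  forall F G, fock F -> fock G -> fock_inner (S F) G = fock_inner F (T G).

Definition fock_normal S :=
  fock_bounded S /\
  exists2 T, fock_adjoint S T & forall F, fock F -> S (T F) = T (S F).

Definition Cn_conj (w : Cn R n) : Cn R n := map_mx conjc w.

(* The bilinear product; z . \bar w is [Cn_dot z (Cn_conj w)]. *)
Definition Cn_dot (z w : Cn R n) : C := \sum_j z ord0 j * w ord0 j.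

Definition S_integrand (phi F : Cn R n -> C) (z w : Cn R n) : C :=
  F w * cexp (Cn_dot z (Cn_conj w)) * phi (z - Cn_conj w).

Definition S_op (phi F : Cn R n -> C) (z : Cn R n) : C :=
  gaussian_integral (S_integrand phi F z).

(* The integral is total, with junk values for non-integrable functions, so
   its convergence is part of the boundedness of [S_op phi]. *)
Definition S_bounded (phi : Cn R n -> C) :=
  (forall F z, fock F -> gaussian_integrable (S_integrand phi F z)) /\
  fock_bounded (S_op phi).

Definition ofRn (x : Rn R n) : Cn R n := \row_j ((tnth x j)%:C)%C.

Definition symbol_integrand (m : Rn R n -> C) (z : Cn R n) (x : Rn R n) : C :=
  let u := ofRn x - ('i%C / 2) *: z in m x * cexp (- 2 * Cn_dot u u).

Definition symbol (m : Rn R n -> C) (z : Cn R n) : C :=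
  (((2 / pi) `^ (n%:R / 2))%:C)%C *
  cintegral (lebesgueRn R n) (symbol_integrand m z).

End fock.

(* Main.v *)
(* Write [k_a w = exp(w . conj a)] and [K(z, w) = exp(z . conj w) phi(z - conj w)]
   for the kernel of S_phi.  The mean value property of entire functions under
   the Gaussian measure, translated, says that [<F, k_a> = F a]; in particular
   S_phi k_a = K(., a).  The symbol enters only through
   phi'(z) = conj(phi(- conj z)), which makes conj(K(w, z)) the kernel of
   S_phi', so that S_phi' F(z) = <F, S_phi k_z>, an entire function of z.

   Fubini does not apply to K paired with two Fock functions, but it does when
   one of them is the projection P G of a bounded function G, and it gives
   <S_phi' F, G> = <F, S_phi (P G)>.  Letting G run through truncations of
   S_phi' F bounds S_phi'; letting G run through truncations of a Fock function
   gives S_phi^* = S_phi'.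

   For real s and t, the substitution w |-> s + t - conj w shows that
   <S_phi k_s, S_phi k_t> = <S_phi' k_s, S_phi' k_t>.  Both sides are analytic
   in conj s and in t, so they agree for all complex s and t; as the k_a
   determine everything, S_phi commutes with S_phi'. *)

Require Import Defs.
From HB Require Import structures.
From mathcomp Require Import all_boot all_order all_algebra.
From mathcomp Require Import complex.
From mathcomp Require Import all_classical all_reals all_analysis.
From mathcomp Require Import measurable_realfun.
From mathcomp Require Import ring lra.

Set Implicit Arguments.
Unset Strict Implicit.
Unset Printing Implicit Defensive.

Import Order.TTheory GRing.Theory Num.Theory.
Import numFieldNormedType.Exports.
Import ComplexField.Normc.

Local Open Scope classical_set_scope.
Local Open Scope ring_scope.

(** * Invariance of Lebesgue measure on R^n and C^n *)

(** Growth decides which integrals may be exchanged. Fock functions are controlled only by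
    exp(|w|^2/2), and up to lower-order terms so is the kernel in each variable: the product may
    reach exp(|w|^2), which the Gaussian density fails to beat. For bounded G, since |k_w| has
    integral exp(|w|^2/4), the projection of G grows at most like exp(|w|^2/4), and the total
    exponent 1/2 + 1/4 stays below 1.

    Entire means complex differentiable at each point, with no continuity of the derivative given,
    so the mean value property rests on Goursat's theorem. It is applied to f o exp, which is
    holomorphic on the whole plane, so that no pole has to be avoided; averaging over the rotations
    z |-> e^(it) z carries circle means to the Gaussian measure.

    The points s and t are first taken real because the exponents on both sides are matched using
    conj s = s and conj t = t. The extension to complex points uses the power series of z |-> L k_z
    for a bounded antilinear functional L. *)

Lemma lebesgue_measure_shift {R : realType} (c : R) (A : set (measurableTypeR R)) : measurable A ->
  pushforward (@lebesgue_measure R) ((fun x => x + c)%R : measurableTypeR R -> measurableTypeR R) A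
  = lebesgue_measure A.
Proof.
have mc : measurable_fun [set: measurableTypeR R]
    ((fun x => x + c)%R : measurableTypeR R -> measurableTypeR R).
  exact: measurable_funD.
move=> mA; apply/esym.
pose nu : {measure set (measurableTypeR R) -> \bar R} :=
  measure_function_pushforward__canonical__measure_function_Measure
   (@lebesgue_measure R) mc.
rewrite -[RHS]/(nu A).
apply: lebesgue_measure_unique => //= _ [[a b]] _ <-.
rewrite /nu/= /pushforward.
rewrite [X in _ = lebesgue_measure X](_ : _ = `]a - c, b - c]%classic)%R.
  rewrite /= !lebesgue_measure_itv/= !lte_fin ltrD2r.
  by case: ifPn => // _; rewrite -!EFinB; congr EFin; lra.
apply/seteqP; split => x /=; rewrite !in_itv/= => /andP[? ?]; apply/andP; split; lra.
Qed.

Section Rn_invariance.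
Context {R : realType}.
Local Open Scope ereal_scope.

Lemma ge0_integral_shiftR (c : R) (f : measurableTypeR R -> \bar R) :
  measurable_fun setT f -> (forall x, 0 <= f x) ->
  \int[lebesgue_measure]_x f (x + c)%R = \int[lebesgue_measure]_x f x.
Proof.
move=> mf f0.
have mc : measurable_fun [set: measurableTypeR R]
    ((fun x => x + c)%R : measurableTypeR R -> measurableTypeR R).
  exact: measurable_funD.
transitivity (\int[pushforward (@lebesgue_measure R)
    ((fun x => x + c)%R : measurableTypeR R -> measurableTypeR R)]_x f x).
  by rewrite ge0_integral_pushforward//.
by apply: eq_measure_integral => //= A mA _; exact: lebesgue_measure_shift.
Qed.

Lemma ge0_integral_oppR (f : measurableTypeR R -> \bar R) :
  measurable_fun setT f -> (forall x, 0 <= f x) ->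
  \int[lebesgue_measure]_x f (- x)%R = \int[lebesgue_measure]_x f x.
Proof.
move=> mf f0.
transitivity (\int[pushforward (@lebesgue_measure R)
    (-%R : measurableTypeR R -> measurableTypeR R)]_x f x).
  by rewrite ge0_integral_pushforward//.
by apply: eq_measure_integral => //= A mA _; exact: lebesgue_measureN.
Qed.

Lemma ge0_integral_lebesgueRnS n (f : Rn R n.+1 -> \bar R) :
  measurable_fun setT f -> (forall x, 0 <= f x) ->
  \int[lebesgueRn R n.+1]_x f x =
  \int[lebesgue_measure]_a \int[lebesgueRn R n]_t f (Rn_cons (a, t)).
Proof.
move=> mf f0.
transitivity (\int[pushforward (sfprod lebesgue_measure (lebesgueRn R n)) (@Rn_cons R n)]_x f x).
  by [].
rewrite ge0_integral_pushforward//; last exact: measurable_Rn_cons.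
rewrite /= /sfprod fubini_tonelli1//; apply: measurableT_comp => //.
exact: measurable_Rn_cons.
Qed.

(** Both orders are recorded, since [shear1] moves [x] at fixed [y] and [shear2] moves [y] at fixed
    [x]. *)
Lemma ge0_integral_lebesgueCn n (f : Rn R n * Rn R n -> \bar R) :
  measurable_fun setT f -> (forall x, 0 <= f x) ->
  \int[@lebesgueCn R n]_p f p =
    \int[lebesgueRn R n]_x \int[lebesgueRn R n]_y f (x, y) /\
  \int[@lebesgueCn R n]_p f p =
    \int[lebesgueRn R n]_y \int[lebesgueRn R n]_x f (x, y).
Proof.
move=> mf f0; split.
  exact: (fubini_tonelli1 f mf f0).
exact: (fubini_tonelli2 f mf f0).
Qed.

Definition tup_add n (x c : Rn R n) : Rn R n := [tuple (tnth x j + tnth c j)%R | j < n].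
Definition tup_opp n (x : Rn R n) : Rn R n := [tuple (- tnth x j)%R | j < n].
Definition tup_scale n (a : R) (x : Rn R n) : Rn R n := [tuple (a * tnth x j)%R | j < n].

End Rn_invariance.

Section Rn_invariance2.
Context {R : realType}.
Local Open Scope ereal_scope.

Lemma tup_addE n (x c : Rn R n) j : tnth (tup_add x c) j = (tnth x j + tnth c j)%R.
Proof. by rewrite tnth_mktuple. Qed.

Lemma tup_oppE n (x : Rn R n) j : tnth (tup_opp x) j = (- tnth x j)%R.
Proof. by rewrite tnth_mktuple. Qed.

Lemma tup_scaleE n a (x : Rn R n) j : tnth (tup_scale a x) j = (a * tnth x j)%R.
Proof. by rewrite tnth_mktuple. Qed.

Lemma measurable_tup_add n (c : Rn R n) : measurable_fun setT (fun x => tup_add x c).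
Proof.
apply/measurable_fun_tnthP => j; rewrite [X in measurable_fun _ X](_ : _ = fun x => (tnth x j + tnth c j)%R); last first.
  by apply/funext => x /=; rewrite tup_addE.
by apply: measurable_funD => //; exact: measurable_tnth.
Qed.

Lemma measurable_tup_opp n : measurable_fun setT (@tup_opp R n).
Proof.
apply/measurable_fun_tnthP => j; rewrite [X in measurable_fun _ X](_ : _ = fun x => (- tnth x j)%R); last first.
  by apply/funext => x /=; rewrite tup_oppE.
by apply: measurable_funN; exact: measurable_tnth.
Qed.

Lemma tnth_Rn_consS n (a : R) (t : Rn R n) (i : 'I_n) :
  tnth (Rn_cons (a, t)) (lift ord0 i) = tnth t i.
Proof. exact: tnthS. Qed.

Lemma tnth_Rn_cons0 n (a : R) (t : Rn R n) : tnth (Rn_cons (a, t)) ord0 = a.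
Proof. exact: tnth0. Qed.

Lemma tup_add_cons n a c0 (t c : Rn R n) :
  tup_add (Rn_cons (a, t)) (Rn_cons (c0, c)) =
  Rn_cons ((a + c0)%R, tup_add t c).
Proof.
apply: eq_from_tnth => j; rewrite tup_addE.
case: (unliftP ord0 j) => [i|] ->.
  by rewrite !(tnth_Rn_consS _ _ i) tup_addE.
by rewrite !tnth_Rn_cons0.
Qed.

Lemma tup_opp_cons n a (t : Rn R n) :
  tup_opp (Rn_cons (a, t)) = Rn_cons ((- a)%R, tup_opp t).
Proof.
apply: eq_from_tnth => j; rewrite tup_oppE.
case: (unliftP ord0 j) => [i|] ->.
  by rewrite !(tnth_Rn_consS _ _ i) tup_oppE.
by rewrite !tnth_Rn_cons0.
Qed.

(** Induction along the construction of [lebesgueRn]: Tonelli separates the first coordinate, where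
    invariance on the line applies. *)
Lemma ge0_integral_shiftRn n (c : Rn R n) (f : Rn R n -> \bar R) :
  measurable_fun setT f -> (forall x, 0 <= f x) ->
  \int[lebesgueRn R n]_x f (tup_add x c) = \int[lebesgueRn R n]_x f x.
Proof.
elim: n c f => [|n IH] c f mf f0.
  by apply: eq_integral => x _; congr f; apply: eq_from_tnth => -[].
have [c0 [c' ->]] : exists c0 c', c = Rn_cons (c0, c').
  by exists (thead c), [tuple of behead c]; exact: tuple_eta.
have mfc : measurable_fun setT (fun x => f (tup_add x (Rn_cons (c0, c')))).
  by apply: measurableT_comp => //; exact: measurable_tup_add.
rewrite ge0_integral_lebesgueRnS// [RHS]ge0_integral_lebesgueRnS//.
have mcons : measurable_fun setT (fun p => f (@Rn_cons R n p)).
  by apply: measurableT_comp => //; exact: measurable_Rn_cons.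
rewrite -(ge0_integral_shiftR c0
  (f := fun a => \int[lebesgueRn R n]_t f (Rn_cons (a, t)))).
- apply: eq_integral => a _.
  under eq_integral do rewrite tup_add_cons.
  apply: (IH _ (fun t => f (Rn_cons (_, t)))) => //.
  by apply: measurableT_comp mcons _ => /=; exact: measurable_pair1.
- exact: (measurable_fun_fubini_tonelli_F (fun p => f (@Rn_cons R n p))).
- by move=> a; apply: integral_ge0.
Qed.

Lemma ge0_integral_oppRn n (f : Rn R n -> \bar R) :
  measurable_fun setT f -> (forall x, 0 <= f x) ->
  \int[lebesgueRn R n]_x f (tup_opp x) = \int[lebesgueRn R n]_x f x.
Proof.
elim: n f => [|n IH] f mf f0.
  by apply: eq_integral => x _; congr f; apply: eq_from_tnth => -[].
have mfc : measurable_fun setT (fun x => f (tup_opp x)).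
  by apply: measurableT_comp => //; exact: measurable_tup_opp.
rewrite ge0_integral_lebesgueRnS// [RHS]ge0_integral_lebesgueRnS//.
have mcons : measurable_fun setT (fun p => f (@Rn_cons R n p)).
  by apply: measurableT_comp => //; exact: measurable_Rn_cons.
rewrite -(ge0_integral_oppR
  (f := fun a => \int[lebesgueRn R n]_t f (Rn_cons (a, t)))).
- apply: eq_integral => a _.
  under eq_integral do rewrite tup_opp_cons.
  apply: (IH (fun t => f (Rn_cons (_, t)))) => //.
  by apply: measurableT_comp mcons _ => /=; exact: measurable_pair1.
- exact: (measurable_fun_fubini_tonelli_F (fun p => f (@Rn_cons R n p))).
- by move=> a; apply: integral_ge0.
Qed.

End Rn_invariance2.

Section Cn_invariance.
Context {R : realType} {n : nat}.
Local Open Scope ereal_scope.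
Local Notation RRn := (Rn R n * Rn R n)%type.
Implicit Types (f : RRn -> \bar R) (p : RRn).

(* Shears and one reflection generate the rotations, translations and
   conjugate reflections of C^n that are needed. *)
Definition shear1 (a : R) (c : Rn R n) p : RRn :=
  (tup_add p.1 (tup_add (tup_scale a p.2) c), p.2).

Definition shear2 (a : R) (c : Rn R n) p : RRn :=
  (p.1, tup_add p.2 (tup_add (tup_scale a p.1) c)).

Definition reflect1 p : RRn := (tup_opp p.1, p.2).

Lemma measurable_tup_addscale d (T : measurableType d) (u v : T -> Rn R n)
    (a : R) (c : Rn R n) : measurable_fun setT u -> measurable_fun setT v ->
  measurable_fun setT (fun t => tup_add (u t) (tup_add (tup_scale a (v t)) c)).
Proof.
move=> mu mv; apply/measurable_fun_tnthP => j.
rewrite [X in measurable_fun _ X](_ : _ =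
    fun t => (tnth (u t) j + (a * tnth (v t) j + tnth c j))%R); last first.
  by apply/funext => t /=; rewrite !tup_addE tup_scaleE.
have m1 : measurable_fun setT (fun t => tnth (u t) j).
  exact: (measurableT_comp (measurable_tnth j) mu).
have m2 : measurable_fun setT (fun t => tnth (v t) j).
  exact: (measurableT_comp (measurable_tnth j) mv).
apply: measurable_funD => //; apply: measurable_funD => //.
exact: measurable_funM.
Qed.

Lemma measurable_shear1 a c : measurable_fun setT (shear1 a c).
Proof.
apply/measurable_fun_pairP; split; last exact: measurable_snd.
exact: measurable_tup_addscale.
Qed.

Lemma measurable_shear2 a c : measurable_fun setT (shear2 a c).
Proof.
apply/measurable_fun_pairP; split; first exact: measurable_fst.
exact: measurable_tup_addscale.
Qed.

Lemma measurable_reflect1 : measurable_fun setT reflect1.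
Proof.
apply/measurable_fun_pairP; split; last exact: measurable_snd.
exact: (measurableT_comp (@measurable_tup_opp R n) measurable_fst).
Qed.

(** At fixed [y] a shear is the translation of [x] by [a y + c], so Tonelli reduces it to
    translation invariance. *)
Lemma ge0_integral_shear1 a c f :
  measurable_fun setT f -> (forall p, 0 <= f p) ->
  \int[@lebesgueCn R n]_p f (shear1 a c p) = \int[@lebesgueCn R n]_p f p.
Proof.
move=> mf f0.
rewrite (ge0_integral_lebesgueCn mf f0).2.
rewrite (ge0_integral_lebesgueCn (measurableT_comp mf (measurable_shear1 a c)) _).2; last by move=> p /=.
apply: eq_integral => y _; rewrite /shear1/=.
rewrite (ge0_integral_shiftRn _ (f := fun x => f (x, y)))//.
by apply: measurableT_comp mf _; exact: pair2_measurable.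
Qed.

Lemma ge0_integral_shear2 a c f :
  measurable_fun setT f -> (forall p, 0 <= f p) ->
  \int[@lebesgueCn R n]_p f (shear2 a c p) = \int[@lebesgueCn R n]_p f p.
Proof.
move=> mf f0.
rewrite (ge0_integral_lebesgueCn mf f0).1.
rewrite (ge0_integral_lebesgueCn (measurableT_comp mf (measurable_shear2 a c)) _).1; last by move=> p /=.
apply: eq_integral => x _; rewrite /shear2/=.
rewrite (ge0_integral_shiftRn _ (f := fun y => f (x, y)))//.
by apply: measurableT_comp mf _; exact: pair1_measurable.
Qed.

Lemma ge0_integral_reflect1 f :
  measurable_fun setT f -> (forall p, 0 <= f p) ->
  \int[@lebesgueCn R n]_p f (reflect1 p) = \int[@lebesgueCn R n]_p f p.
Proof.
move=> mf f0.
rewrite (ge0_integral_lebesgueCn mf f0).2.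
rewrite (ge0_integral_lebesgueCn (measurableT_comp mf measurable_reflect1) _).2; last by move=> p /=.
apply: eq_integral => y _.
apply: (ge0_integral_oppRn (f := fun x => f (x, y))) => //.
by apply: measurableT_comp mf _; exact: pair2_measurable.
Qed.

End Cn_invariance.

(** * Finite Gaussian integrals on R^n *)

Section gaussian_finite.
Context {R : realType}.
Local Open Scope ereal_scope.

Lemma integral_expR_sqr_lty (a : R) : (0 < a)%R ->
  \int[lebesgue_measure]_x (expR (- (a * x ^+ 2)))%:E < +oo.
Proof.
(* The standard deviation for which [normal_fun 0 s x] is exp(- a x^2): [s ^+ 2] is 1 / (2a). *)
move=> a0; pose s := (Num.sqrt (a *+ 2)^-1)%R.
have s2 : (s ^+ 2 = (a *+ 2)^-1)%R by rewrite sqr_sqrtr// invr_ge0 mulrn_wge0// ltW.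
have s0 : (s != 0)%R by rewrite sqrtr_eq0 -ltNge invr_gt0 mulrn_wgt0.
have := integral_normal_pdf 0%R s.
rewrite normal_pdfE// => /eqP.
under eq_integral do rewrite EFinM.
rewrite ge0_integralZl//=; last 3 first.
- by apply/measurable_EFinP; exact: measurable_normal_fun.
- by move=> x _; rewrite lee_fin normal_fun_ge0.
- by rewrite lee_fin normal_peak_ge0.
have -> : \int[lebesgue_measure]_x (normal_fun 0 s x)%:E =
  \int[lebesgue_measure]_x (expR (- (a * x ^+ 2)))%:E.
  apply: eq_integral => x _; rewrite /normal_fun subr0 s2; congr (expR _)%:E.
  by rewrite mulrC mulrN; congr (- (_ * _))%R; rewrite -mulr_natr invfM; field; rewrite gt_eqF.
(* A positive multiple of the integral is the total mass 1 of a normal law, so the integral cannot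
   be infinite. *)
case: (\int[lebesgue_measure]_x _) => //.
- by move=> r _; rewrite ltry.
- by rewrite mulry gtr0_sg ?normal_peak_gt0// mul1e.
Qed.

Definition Rn_sqnorm n (x : Rn R n) : R := \sum_j tnth x j ^+ 2.

Lemma measurable_Rn_sqnorm n : measurable_fun setT (@Rn_sqnorm n).
Proof.
apply: measurable_sum => j; apply: measurable_funX.
exact: measurable_tnth.
Qed.

Lemma Rn_sqnorm_cons n a (t : Rn R n) : (Rn_sqnorm (Rn_cons (a, t)) = a ^+ 2 + Rn_sqnorm t)%R.
Proof.
rewrite /Rn_sqnorm big_ord_recl tnth_Rn_cons0; congr (_ + _)%R.
by apply: eq_bigr => j _; rewrite (tnth_Rn_consS _ _ j).
Qed.

Lemma integral_expR_Rn_sqnorm_lty n (a : R) : (0 < a)%R ->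
  \int[lebesgueRn R n]_x (expR (- (a * Rn_sqnorm x)))%:E < +oo.
Proof.
move=> a0; have me k : measurable_fun setT (fun x => (expR (- (a * @Rn_sqnorm k x)))%:E).
  apply/measurable_EFinP; apply: measurableT_comp => //.
  apply: measurable_funN; apply: measurable_funM => //.
  exact: measurable_Rn_sqnorm.
elim: n => [|n IH].
  have -> : \int[lebesgueRn R 0]_x (expR (- (a * Rn_sqnorm x)))%:E =
      \int[\d_([tuple] : Rn R 0)]_x (expR (- (a * Rn_sqnorm x)))%:E by [].
  by rewrite integral_dirac ?diracT ?mul1e ?ltry//; exact: me.
rewrite ge0_integral_lebesgueRnS; [|exact: me|by move=> x; rewrite lee_fin expR_ge0].
rewrite (eq_integral (fun b : measurableTypeR R => (expR (- (a * b ^+ 2)))%:E *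
    \int[lebesgueRn R n]_x (expR (- (a * Rn_sqnorm x)))%:E)); last first.
  move=> b _; rewrite -ge0_integralZl//; last exact: me.
  apply: eq_integral => t _.
  by rewrite Rn_sqnorm_cons mulrDr opprD expRD EFinM.
rewrite ge0_integralZr//; last 2 first.
- apply/measurable_EFinP; apply: measurableT_comp => //.
  by apply: measurable_funN; apply: measurable_funM => //; apply: measurable_funX.
- by apply: integral_ge0 => x _; rewrite lee_fin expR_ge0.
apply: lte_mul_pinfty => //.
- by apply: integral_ge0 => x _; rewrite lee_fin expR_ge0.
- rewrite ge0_fin_numE; first exact: integral_expR_sqr_lty.
  by apply: integral_ge0 => x _; rewrite lee_fin expR_ge0.
Qed.

End gaussian_finite.

(** * Complex norm and exponential *)

Section complex_norm.
Context {R : realType}.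
Local Notation C := R[i].
Implicit Types (z w : C).
Local Notation Re := complex.Re.
Local Notation Im := complex.Im.

Lemma cReD z w : Re (z + w) = Re z + Re w. Proof. by case: z w => [? ?] []. Qed.
Lemma cImD z w : Im (z + w) = Im z + Im w. Proof. by case: z w => [? ?] []. Qed.
Lemma cReN z : Re (- z) = - Re z. Proof. by case: z. Qed.
Lemma cImN z : Im (- z) = - Im z. Proof. by case: z. Qed.
Lemma cReM z w : Re (z * w) = Re z * Re w - Im z * Im w.
Proof. by case: z w => [? ?] []. Qed.
Lemma cImM z w : Im (z * w) = Re z * Im w + Im z * Re w.
Proof. by case: z w => [? ?] []. Qed.
Lemma cReJ z : Re (z^*)%C = Re z. Proof. by case: z. Qed.
Lemma cImJ z : Im (z^*)%C = - Im z. Proof. by case: z. Qed.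
Lemma cRe_sum I (r : seq I) (P : pred I) (F : I -> C) :
  Re (\sum_(i <- r | P i) F i) = \sum_(i <- r | P i) Re (F i).
Proof. by elim/big_rec2: _ => // i x y _ <-; rewrite cReD. Qed.
Lemma cIm_sum I (r : seq I) (P : pred I) (F : I -> C) :
  Im (\sum_(i <- r | P i) F i) = \sum_(i <- r | P i) Im (F i).
Proof. by elim/big_rec2: _ => // i x y _ <-; rewrite cImD. Qed.

Lemma complex_ext z w : Re z = Re w -> Im z = Im w -> z = w.
Proof. by case: z w => [? ?] [? ?] /= -> ->. Qed.

Lemma normc_ReIm z : normc z = Num.sqrt (Re z ^+ 2 + Im z ^+ 2).
Proof. by case: z. Qed.

Lemma normc_ge0 z : 0 <= normc z. Proof. by rewrite normc_ReIm sqrtr_ge0. Qed.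

Lemma sqr_normcE z : normc z ^+ 2 = Re z ^+ 2 + Im z ^+ 2.
Proof. by rewrite normc_ReIm sqr_sqrtr// addr_ge0 ?sqr_ge0. Qed.

Lemma normc_conj z : normc (z^*)%C = normc z.
Proof. by rewrite !normc_ReIm cReJ cImJ sqrrN. Qed.

Lemma normc_real (x : R) : normc (x%:C)%C = `|x|.
Proof. by rewrite normc_ReIm /= expr0n addr0 sqrtr_sqr. Qed.

Lemma Re_le_normc z : `|Re z| <= normc z.
Proof. by rewrite normc_ReIm -sqrtr_sqr ler_wsqrtr// lerDl sqr_ge0. Qed.

Lemma Im_le_normc z : `|Im z| <= normc z.
Proof. by rewrite normc_ReIm -sqrtr_sqr ler_wsqrtr// lerDr sqr_ge0. Qed.

Lemma normc_le_ReIm z : normc z <= `|Re z| + `|Im z|.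
Proof.
rewrite -[leRHS]ger0_norm ?addr_ge0// -sqrtr_sqr normc_ReIm ler_wsqrtr//.
rewrite sqrrD !real_normK ?num_real// -[leRHS]addrA [leRHS]addrC [_ *+ 2 + _]addrC.
by rewrite [leRHS]addrAC [_ + Re z ^+ 2]addrC lerDl mulrn_wge0 ?mulr_ge0.
Qed.

Lemma normcX z k : normc (z ^+ k) = normc z ^+ k.
Proof. by elim: k => [|k IH]; rewrite ?expr0 ?normc1// !exprS normcM IH. Qed.

Lemma normcB_sym z w : normc (z - w) = normc (w - z).
Proof. by rewrite -normcN opprB. Qed.

Lemma normcB_le z w : normc (z - w) <= normc z + normc w.
Proof. by rewrite -(normcN w) le_normcD. Qed.

Lemma normc_sum I (r : seq I) (P : pred I) (F : I -> C) :
  normc (\sum_(i <- r | P i) F i) <= \sum_(i <- r | P i) normc (F i).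
Proof.
elim/big_rec2: _ => [|i x y _ h]; first by rewrite normc0.
by rewrite (le_trans (le_normcD _ _))// lerD2l.
Qed.

Lemma mulcJ z : z * (z^*)%C = ((normc z ^+ 2)%:C)%C.
Proof. by apply: complex_ext; rewrite ?cReM ?cImM cReJ cImJ ?sqr_normcE /=; ring. Qed.

Lemma normr_normc z : `|z| = ((normc z)%:C)%C. Proof. by []. Qed.

End complex_norm.

Section cexp_theory.
Context {R : realType}.
Local Notation C := R[i].
Implicit Types (z w : C).
Local Notation Re := complex.Re.
Local Notation Im := complex.Im.

Lemma cexpE z : cexp z = Complex (expR (Re z) * cos (Im z)) (expR (Re z) * sin (Im z)).
Proof. by case: z. Qed.

Lemma cexp0 : cexp (0 : C) = 1.
Proof. by rewrite cexpE expR0 cos0 sin0 mulr0 mulr1. Qed.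

Lemma cexpD z w : cexp (z + w) = cexp z * cexp w.
Proof.
rewrite !cexpE cReD cImD expRD cosD sinD.
by apply: complex_ext; rewrite ?cReM ?cImM /=; ring.
Qed.

Lemma cexp_real (x : R) : cexp (x%:C)%C = ((expR x)%:C)%C.
Proof. by rewrite cexpE /= cos0 sin0 mulr0 mulr1. Qed.

Lemma normc_cexp z : normc (cexp z) = expR (Re z).
Proof.
rewrite cexpE normc_ReIm /= !exprMn -mulrDr cos2Dsin2 mulr1 sqrtr_sqr.
by rewrite ger0_norm// expR_ge0.
Qed.

Lemma cexpJ z : cexp (z^*)%C = ((cexp z)^*)%C.
Proof. by rewrite !cexpE cReJ cImJ cosN sinN; apply: complex_ext; rewrite ?cReJ ?cImJ//= mulrN. Qed.

End cexp_theory.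

(** * Taylor remainder of the complex exponential *)

Section cexp_taylor.
Context {R : realType}.
Local Notation C := R[i].
Local Notation Re := complex.Re.
Local Notation Im := complex.Im.

(** The mean value theorem for [g - f]. It propagates a bound on a derivative to the function, which
    drives the induction on the Taylor order. *)
Lemma is_derive_le (f g df dg : R -> R) (a b : R) :
  (forall x : R, is_derive x 1 f (df x)) ->
  (forall x : R, is_derive x 1 g (dg x)) ->
  f a <= g a -> (forall x, a <= x <= b -> df x <= dg x) ->
  a <= b -> f b <= g b.
Proof.
move=> fdf gdg fga dfg ab.
have h (x : R) : is_derive x 1 (fun x => g x - f x) (dg x - df x).
  exact: is_deriveB.
have cont : {within `[a, b], continuous (fun x => g x - f x)}.
  apply: derivable_within_continuous => x _.
  by case: (h x).
have [c] := MVT_segment ab (fun x _ => h x) cont.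
rewrite in_itv/= => /dfg; rewrite -subr_ge0 => h0 h1.
have : 0 <= (g b - f b) - (g a - f a) by rewrite h1 mulr_ge0// subr_ge0.
lra.
Qed.

Lemma is_derive_monom (K : R) n (s : R) :
  is_derive s 1 (fun t : R => K * t ^+ n.+1) (K * (n.+1%:R * s ^+ n)).
Proof.
rewrite (_ : (fun t : R => K * t ^+ n.+1) = K *: (id ^+ n.+1 : R -> R)); last first.
  by apply/funext => t /=; rewrite fctE /=.
by apply: is_derive_eq; rewrite /GRing.scale/= mulr1 mulr_natl.
Qed.

Definition cexp_sum (N : nat) (u : C) : C := \sum_(j < N) u ^+ j / (j`!%:R).

(** Only real functions of a real variable are differentiated: along the segment [s u], the real
    parts of all multiples by [c] carry the whole complex information. *)
Lemma is_derive_Re_cexp (c u : C) (s : R) :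
  is_derive s 1 (fun s : R => Re (c * cexp ((s%:C)%C * u)))
    (Re (c * u * cexp ((s%:C)%C * u))).
Proof.
have -> : (fun s : R => Re (c * cexp ((s%:C)%C * u))) =
  (fun s => Re c * (expR (s * Re u) * cos (s * Im u))
            - Im c * (expR (s * Re u) * sin (s * Im u))).
  apply/funext => t; rewrite cexpE cReM /= cReM cImM /=.
  by rewrite !mul0r subr0 addr0.
apply: is_derive_eq.
rewrite cexpE !(cReM, cImM) /= !mul0r !(subr0, addr0) /GRing.scale/=; ring.
Qed.

Lemma is_derive_Re_cexp_sum (c u : C) (N : nat) (s : R) :
  is_derive s 1 (fun s : R => Re (c * cexp_sum N.+1 ((s%:C)%C * u)))
    (Re (c * u * cexp_sum N ((s%:C)%C * u))).
Proof.
have E k (t : R) : Re (c * cexp_sum k.+1 ((t%:C)%C * u)) =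
    Re (c * cexp_sum k ((t%:C)%C * u)) + Re (c * (u ^+ k / k`!%:R)) * t ^+ k.
  rewrite /cexp_sum big_ord_recr/= mulrDr cReD; congr (_ + _).
  rewrite exprMn -!mulrA mulrCA -rmorphXn/= [Re (_ * (c * _))]cReM/= mul0r subr0.
  by rewrite mulrC mulrA.
elim: N => [|N IH].
  rewrite [X in is_derive _ _ _ X](_ : _ = 0); last first.
    by rewrite /cexp_sum big_ord0 mulr0.
  rewrite [X in is_derive _ _ X _](_ : _ = cst (Re c)); first exact: is_derive_cst.
  apply/funext => t.
  by rewrite /cexp_sum big_ord1 expr0 divr1 mulr1.
rewrite [X in is_derive _ _ X _](_ : _ = fun t : R =>
    Re (c * cexp_sum N.+1 ((t%:C)%C * u)) + Re (c * (u ^+ N.+1 / N.+1`!%:R)) * t ^+ N.+1); last first.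
  by apply/funext => t; rewrite E.
have h2 := is_derive_monom (Re (c * (u ^+ N.+1 / N.+1`!%:R))) N s.
apply: (is_derive_eq (is_deriveD IH h2)).
rewrite /cexp_sum big_ord_recr/= -/(cexp_sum _ _) mulrDr cReD; congr (_ + _).
have -> : c * u * (((s%:C)%C * u) ^+ N / N`!%:R) =
  ((N.+1%:R * s ^+ N)%:C)%C * (c * (u ^+ N.+1 / N.+1`!%:R)).
  rewrite rmorphM/= rmorph_nat rmorphXn/= factS natrM exprMn [u ^+ N.+1]exprS.
  have : N.+1%:R != 0 :> C by rewrite pnatr_eq0.
  have : N`!%:R != 0 :> C by rewrite pnatr_eq0 -lt0n fact_gt0.
  move: (N`!%:R) (N.+1%:R) => a b a0 b0.
  by field; rewrite a0 b0.
by rewrite [in RHS]cReM/= mul0r subr0 mulrC.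
Qed.

(** Along the segment from 0 to [u], the derivative of the error of order [k + 1] is [u] times the
    error of order [k], and the error of positive order vanishes at 0. Bounding derivatives by
    induction therefore produces the factor |u|^k / k!. *)
Lemma normc_cexp_taylor (N : nat) (u : C) :
  normc (cexp u - cexp_sum N u) <= normc u ^+ N / N`!%:R * expR (normc u).
Proof.
pose E N (s : R) := cexp ((s%:C)%C * u) - cexp_sum N ((s%:C)%C * u).
have dE c k (s : R) : is_derive s 1 (fun s => Re (c * E k.+1 s)) (Re (c * u * E k s)).
  rewrite /E [X in is_derive _ _ X _](_ : _ = fun s : R => Re (c * cexp ((s%:C)%C * u)) -
    Re (c * cexp_sum k.+1 ((s%:C)%C * u))); last first.
    by apply/funext => t; rewrite mulrBr cReD cReN.
  rewrite mulrBr cReD cReN; apply: is_deriveB.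
  exact: is_derive_Re_cexp.
  exact: is_derive_Re_cexp_sum.
suff H k c (s : R) : 0 <= s <= 1 ->
    Re (c * E k s) <= normc c * (normc u ^+ k / k`!%:R * expR (normc u)) * s ^+ k.
  (* With [c] the conjugate of the error at [s = 1], the real part is the squared modulus of the
     error, and one factor is divided out. *)
  have /= := H N ((E N 1)^*)%C 1; rewrite ler01 lexx => /(_ isT).
  rewrite expr1n mulr1 mulrC mulcJ/= normc_conj expr2.
  have -> : E N 1 = cexp u - cexp_sum N u by rewrite /E mul1r.
  have [->|] := eqVneq (normc (cexp u - cexp_sum N u)) 0.
    by rewrite !mulr_ge0 ?expR_ge0// ?exprn_ge0 ?normc_ge0 ?invr_ge0 ?ler0n.
  move=> n0; rewrite ler_pM2l// lt_neqAle eq_sym n0; exact: normc_ge0.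
elim: k c s => [|k IH] c s /andP[s0 s1].
  rewrite /E /cexp_sum big_ord0 subr0 !expr0 divr1 mul1r mulr1.
  rewrite (le_trans (ler_norm _))// (le_trans (Re_le_normc _))//.
  rewrite normcM ler_wpM2l ?normc_ge0// normc_cexp ler_expR cReM/= mul0r subr0.
  rewrite (le_trans (ler_norm _))// normrM ger0_norm//.
  by rewrite (le_trans _ (Re_le_normc u))// ler_piMl.
pose K := normc c * normc u * (normc u ^+ k / k`!%:R * expR (normc u)).
have -> : normc c * (normc u ^+ k.+1 / (k.+1)`!%:R * expR (normc u)) * s ^+ k.+1 =
  K / k.+1%:R * s ^+ k.+1.
  rewrite /K factS natrM [normc u ^+ _]exprS.
  have : k.+1%:R != 0 :> R by rewrite pnatr_eq0.
  have : k`!%:R != 0 :> R by rewrite pnatr_eq0 -lt0n fact_gt0.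
  move: (k`!%:R) (k.+1%:R) (s ^+ k.+1) => a b p a0 b0.
  by field; rewrite a0 b0.
have dg (x : R) : is_derive x 1 (fun s => K / k.+1%:R * s ^+ k.+1) (K * x ^+ k).
  apply: (is_derive_eq (is_derive_monom _ _ _)).
  have : k.+1%:R != 0 :> R by rewrite pnatr_eq0.
  by move: (k.+1%:R) => b b0; field.
apply: (is_derive_le (fun x => dE c k x) dg _ _ s0).
  suff -> : E k.+1 0 = 0 by rewrite mulr0 expr0n/= mulr0.
  rewrite /E mul0r cexp0 /cexp_sum big_ord_recl expr0 divr1 big1 ?addr0 ?subrr//.
  by move=> i _; rewrite expr0n/= mul0r.
move=> x /andP[x0 xs]; apply: le_trans (IH _ _ _) _.
  by rewrite x0 (le_trans xs).
by rewrite normcM.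
Qed.

End cexp_taylor.

(** * Entire functions *)

(** The differential of a map on row vectors is given by its values on the basis vectors, hence by a
    row [L]. Conversely a linear form on this space is continuous, which [diff_unique] asks for. *)
Lemma differentiable_rVP (K : numFieldType) n (F : 'rV[K]_n -> K^o) (z : 'rV[K]_n) :
  differentiable F z <->
  exists L : 'rV[K]_n, forall e : K, 0 < e -> exists2 d : K, 0 < d &
    forall h : 'rV[K]_n, mx_norm h < d ->
    `|F (z + h) - F z - \sum_j L ord0 j * h ord0 j| <= e * mx_norm h.
Proof.
split.
- move=> dF; have := diff_locally dF => /eqaddoP lF.
  exists (\row_j 'd F z (delta_mx ord0 j)) => e e0.
  have /nbhs_ballP[d /= d0 Hd] := lF _ e0.
  exists d => // h hd.
  have bh : ball (0 : 'rV[K]_n) d h.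
    by rewrite -ball_normE /ball_ /= sub0r normrN.
  have := Hd _ bh; rewrite !fctE/= => H.
  have -> : \sum_j (\row_j 'd F z (delta_mx ord0 j)) ord0 j * h ord0 j = 'd F z h.
    rewrite [in RHS](row_sum_delta h) linear_sum; apply: eq_bigr => j _.
    by rewrite mxE linearZ/= mulrC.
  by rewrite -addrA -opprD [z + h]addrC.
- case=> L HL.
  pose lf (h : 'rV[K]_n) : K^o := \sum_j L ord0 j * h ord0 j.
  have linL : linear lf.
    move=> a x y; rewrite /lf scaler_sumr -big_split/=; apply: eq_bigr => j _.
    by rewrite !mxE mulrDr mulrCA.
  pose f : {linear 'rV[K]_n -> K^o} := HB.pack lf
    (GRing.isLinear.Build K 'rV[K]_n K^o *:%R _ linL).
  have fc : continuous f.
    apply/linear_bounded_continuous/linear_boundedP.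
    near=> r; move=> x; rewrite /=/lf.
    apply: (@le_trans _ _ (\sum_j `|L ord0 j| * `|x|)).
      rewrite (le_trans (ler_norm_sum _ _ _))//; apply: ler_sum => j _.
      rewrite normrM ler_wpM2l//.
      rewrite -[leRHS]/(mx_norm x) mx_normE -[leLHS]nngE num_le.
      exact: (le_bigmax _ (fun i : 'I_1 * 'I_n => `|x i.1 i.2|%:nng) (ord0, j)).
    rewrite -mulr_suml ler_wpM2r//; near: r; apply: nbhs_pinfty_ge.
    by rewrite ger0_real// sumr_ge0.
  have E : F \o shift z = cst (F z) + f +o_ (0 : 'rV[K]_n) id.
    apply/eqaddoP => e e0.
    have [d d0 Hd] := HL e e0.
    apply/nbhs_ballP; exists d => //= h.
    rewrite -ball_normE /ball_ /= sub0r normrN => hd.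
    by rewrite !fctE/= opprD addrA [h + z]addrC; exact: Hd.
  have dE := diff_unique fc E.
  by apply/diff_locallyP; rewrite dE; split.
Unshelve. all: by end_near. Qed.

Section complex_differentiability.
Context {R : realType} {n : nat}.
Local Notation C := R[i].
Local Notation Re := complex.Re.
Local Notation Im := complex.Im.
Implicit Types (z h : Cn R n).

(** [mx_norm] takes its values in [R[i]]; this equivalent norm is real-valued, and as a sum over
    coordinates it bounds [Cn_dot] directly. *)
Definition l1norm h : R := \sum_j normc (h ord0 j).

Lemma l1norm_ge0 h : 0 <= l1norm h.
Proof. by apply: sumr_ge0 => j _; exact: normc_ge0. Qed.

Lemma normc_le_l1norm h j : normc (h ord0 j) <= l1norm h.
Proof.
rewrite /l1norm (bigD1 j)//= lerDl; apply: sumr_ge0 => i _; exact: normc_ge0.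
Qed.

Lemma mx_norm_le_l1norm h : mx_norm h <= ((l1norm h)%:C)%C.
Proof.
rewrite mx_normE.
have : 0 <= ((l1norm h)%:C)%C by rewrite ler0c l1norm_ge0.
move=> l0; rewrite -[leRHS]/((NngNum l0)%:num) num_le.
apply/bigmax_leP; split; first by rewrite -num_le/=.
move=> [i j] _; rewrite -num_le/= ord1 normr_normc lecR.
exact: normc_le_l1norm.
Qed.

Lemma coord_le_mx_norm h j : ((normc (h ord0 j))%:C)%C <= mx_norm h.
Proof.
rewrite -normr_normc mx_normE -[leLHS]nngE num_le.
exact: (le_bigmax _ (fun i : 'I_1 * 'I_n => `|h i.1 i.2|%:nng) (ord0, j)).
Qed.

Lemma l1norm_le_mx_norm h : ((l1norm h)%:C)%C <= n%:R * mx_norm h.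
Proof.
rewrite /l1norm rmorph_sum/=.
apply: (@le_trans _ _ (\sum_(j < n) mx_norm h)).
  by apply: ler_sum => j _; exact: coord_le_mx_norm.
by rewrite big_const_ord iter_addr_0 mulr_natl.
Qed.

Lemma Cn_dotDr z h k : Cn_dot z (h + k) = Cn_dot z h + Cn_dot z k.
Proof. by rewrite /Cn_dot -big_split; apply: eq_bigr => j _; rewrite mxE mulrDr. Qed.

Lemma Cn_dotZr z (a : C) h : Cn_dot z (a *: h) = a * Cn_dot z h.
Proof. by rewrite /Cn_dot mulr_sumr; apply: eq_bigr => j _; rewrite mxE mulrCA. Qed.

Lemma Cn_dotC z h : Cn_dot z h = Cn_dot h z.
Proof. by apply: eq_bigr => j _; rewrite mulrC. Qed.

Lemma Cn_dotDl z h k : Cn_dot (h + k) z = Cn_dot h z + Cn_dot k z.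
Proof. by rewrite !(Cn_dotC _ z) Cn_dotDr. Qed.

Lemma Cn_dotZl z (a : C) h : Cn_dot (a *: h) z = a * Cn_dot h z.
Proof. by rewrite !(Cn_dotC _ z) Cn_dotZr. Qed.

Lemma Cn_dotNl z h : Cn_dot (- h) z = - Cn_dot h z.
Proof. by rewrite -scaleN1r Cn_dotZl mulN1r. Qed.

Lemma Cn_dotNr z h : Cn_dot z (- h) = - Cn_dot z h.
Proof. by rewrite !(Cn_dotC z) Cn_dotNl. Qed.

Lemma normc_Cn_dot z h : normc (Cn_dot z h) <= l1norm z * l1norm h.
Proof.
rewrite (le_trans (normc_sum _ _ _))// /l1norm mulr_suml.
apply: ler_sum => j _; rewrite normcM ler_wpM2l ?normc_ge0//.
exact: normc_le_l1norm.
Qed.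

Lemma entireP (F : Cn R n -> C) :
  entire F <-> forall z, exists L : Cn R n, forall e : R, 0 < e ->
    exists2 d : R, 0 < d & forall h, l1norm h <= d ->
      normc (F (z + h) - F z - Cn_dot L h) <= e * l1norm h.
Proof.
split=> H z; have := H z.
  move=> /differentiable_rVP[L HL]; exists L => e e0.
  have e0' : 0 < (e%:C)%C :> C by rewrite ltcR.
  have [d d0 Hd] := HL _ e0'.
  have dE : d = ((Re d)%:C)%C by rewrite RRe_real// gtr0_real.
  have Rd0 : 0 < Re d by move: d0; rewrite dE ltcR.
  (* Halving [d] turns the non-strict condition on [l1norm h] into the strict one on [mx_norm h]. *)
  exists (Re d / 2); first by rewrite divr_gt0.
  move=> h hd; rewrite -lecR rmorphM/= -normr_normc.
  apply: le_trans (Hd h _) _.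
    rewrite (le_lt_trans (mx_norm_le_l1norm h))// dE ltcR (le_lt_trans hd)//.
    by rewrite ltr_pdivrMr// ltr_pMr// ltr1n.
  by rewrite ler_wpM2l ?(ltW e0')//; exact: mx_norm_le_l1norm.
move=> [L HL]; apply/differentiable_rVP; exists L => e e0.
have eE : e = ((Re e)%:C)%C by rewrite RRe_real// gtr0_real.
have Re0 : 0 < Re e by move: e0; rewrite eE ltcR.
(* Comparing the norms costs a factor [n]; [n.+1] is used instead so that the divisions also make
   sense for [n = 0]. *)
have n0 : 0 < (n.+1%:R : R) by rewrite ltr0n.
have [d d0 Hd] := HL (Re e / n.+1%:R) (divr_gt0 Re0 n0).
exists ((d / n.+1%:R)%:C)%C; first by rewrite ltcR divr_gt0.
move=> h hd.
have nh : l1norm h <= d.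
  rewrite -lecR (le_trans (l1norm_le_mx_norm h))//.
  apply: (@le_trans _ _ (n%:R * ((d / n.+1%:R)%:C)%C)).
    by rewrite ler_wpM2l// ltW.
  rewrite -(rmorph_nat (real_complex R)) -rmorphM lecR mulrCA ler_piMr ?ltW//.
  by rewrite ltr_pdivrMr// mul1r ltr_nat.
have := Hd _ nh; rewrite -lecR rmorphM/= => H'.
apply: (le_trans H').
apply: (@le_trans _ _ (((Re e / n.+1%:R)%:C)%C * (n%:R * mx_norm h))).
  by rewrite ler_wpM2l ?l1norm_le_mx_norm// ler0c divr_ge0// ltW.
rewrite mulrA ler_wpM2r//; first by rewrite mx_normE.
rewrite [leRHS]eE -(rmorph_nat (real_complex R)) -rmorphM lecR.
by rewrite -mulrA ler_piMr ?ltW// mulrC ltr_pdivrMr// mul1r ltr_nat.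
Qed.

End complex_differentiability.

(** * Closure properties of entire functions *)

Section entire_closure.
Context {R : realType} {n : nat}.
Local Notation C := R[i].
Local Notation Re := complex.Re.
Local Notation Im := complex.Im.
Implicit Types (F G : Cn R n -> C).

Lemma l1normZ (a : C) (h : Cn R n) : l1norm (a *: h) = normc a * l1norm h.
Proof. by rewrite /l1norm mulr_sumr; apply: eq_bigr => j _; rewrite mxE normcM. Qed.

Lemma l1norm_conj (h : Cn R n) : l1norm (Cn_conj h) = l1norm h.
Proof. by rewrite /l1norm; apply: eq_bigr => j _; rewrite mxE normc_conj. Qed.

Lemma Cn_conjD (z w : Cn R n) : Cn_conj (z + w) = Cn_conj z + Cn_conj w.
Proof. by apply/rowP => j; rewrite !mxE rmorphD. Qed.

Lemma Cn_conjN (z : Cn R n) : Cn_conj (- z) = - Cn_conj z.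
Proof. by apply/rowP => j; rewrite !mxE rmorphN. Qed.

Lemma Cn_conjB (z w : Cn R n) : Cn_conj (z - w) = Cn_conj z - Cn_conj w.
Proof. by rewrite Cn_conjD Cn_conjN. Qed.

Lemma Cn_conjZ (a : C) (z : Cn R n) : Cn_conj (a *: z) = (a^*)%C *: Cn_conj z.
Proof. by apply/rowP => j; rewrite !mxE rmorphM. Qed.

Lemma Cn_conjK : involutive (@Cn_conj R n).
Proof. by move=> z; apply/rowP => j; rewrite !mxE conjcK. Qed.

Lemma Cn_dot_conj (z w : Cn R n) :
  ((Cn_dot z w)^*)%C = Cn_dot (Cn_conj z) (Cn_conj w).
Proof. by rewrite /Cn_dot rmorph_sum; apply: eq_bigr => j _; rewrite !mxE rmorphM. Qed.

Lemma Cn_dot0r (z : Cn R n) : Cn_dot z 0 = 0.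
Proof. by rewrite /Cn_dot big1// => j _; rewrite mxE mulr0. Qed.

Lemma Cn_dot0l (z : Cn R n) : Cn_dot 0 z = 0.
Proof. by rewrite Cn_dotC Cn_dot0r. Qed.

Lemma entire_cst (a : C) : entire (fun _ : Cn R n => a).
Proof.
apply/entireP => z; exists 0 => e e0; exists 1 => // h _.
by rewrite subrr Cn_dot0l subrr normc0 mulr_ge0 ?l1norm_ge0// ltW.
Qed.

Lemma entireM F G : entire F -> entire G -> entire (fun z => F z * G z).
Proof. by move=> eF eG z; exact: (@differentiableM _ _ F G z (eF z) (eG z)). Qed.

Lemma entireD F G : entire F -> entire G -> entire (fun z => F z + G z).
Proof.
move=> /entireP eF /entireP eG; apply/entireP => z.
have [L HL] := eF z; have [L' HL'] := eG z; exists (L + L') => e e0.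
have e2 : 0 < e / 2 by rewrite divr_gt0.
have [d d0 Hd] := HL _ e2; have [d' d'0 Hd'] := HL' _ e2.
exists (Num.min d d'); first by rewrite lt_min d0.
move=> h; rewrite le_min => /andP[/Hd h1 /Hd' h2].
rewrite Cn_dotDl (_ : _ - _ - _ = (F (z + h) - F z - Cn_dot L h) +
  (G (z + h) - G z - Cn_dot L' h)); last by ring.
by rewrite (le_trans (le_normcD _ _))// [e]splitr mulrDl lerD.
Qed.

Lemma entireX F k : entire F -> entire (fun z => F z ^+ k).
Proof.
move=> eF; elim: k => [|k IH]; first exact: entire_cst.
by under eq_fun do rewrite exprS; exact: entireM.
Qed.

Lemma entire_dot (a : Cn R n) : entire (Cn_dot a).
Proof.
apply/entireP => z; exists a => e e0; exists 1 => // h _.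
by rewrite Cn_dotDr -addrA -opprD subrr normc0 mulr_ge0 ?l1norm_ge0// ltW.
Qed.

(** The Taylor remainder of order 2. The constant is [4 / 2!], where 4 is a crude bound of e:
    exp(-1/2) >= 1/2 gives exp(1/2) <= 2. *)
Lemma normc_cexpB1 (u : C) : normc u <= 1 -> normc (cexp u - 1 - u) <= 2 * normc u ^+ 2.
Proof.
move=> u1; have := normc_cexp_taylor 2 u.
rewrite /cexp_sum !big_ord_recl big_ord0 /= addr0 expr0 !divr1 expr1 opprD addrA.
have -> : 2`!%:R = 2 :> R by [].
have E4 : expR (normc u) <= 4.
  apply: (@le_trans _ _ (expR 1)); first by rewrite ler_expR.
  rewrite [X in expR X](_ : 1 = 2^-1 + 2^-1 :> R); last by lra.
  have h : expR (2^-1 : R) <= 2.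
    have := expR_ge1Dx (- 2^-1 : R); rewrite expRN.
    rewrite (_ : 1 + - 2^-1 = 2^-1 :> R); last by lra.
    by rewrite lef_pV2 ?posrE ?expR_gt0.
  have h0 := expR_ge0 (2^-1 : R).
  rewrite expRD (_ : 4 = 2 * 2 :> R); last by lra.
  exact: ler_pM.
have := ler_wpM2l (exprn_ge0 2 (normc_ge0 u)) E4.
by rewrite -[_ / 2 * _]mulrAC => h1 h2; lra.
Qed.

Lemma entire_cexp_dot (a : Cn R n) : entire (fun z => cexp (Cn_dot a z)).
Proof.
apply/entireP => z; exists (cexp (Cn_dot a z) *: a) => e e0.
pose K := normc (cexp (Cn_dot a z)) * 2 * (1 + l1norm a) ^+ 2 + 1.
have a0 : 0 < 1 + l1norm a by rewrite ltr_pwDl// l1norm_ge0.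
have K0 : 0 < K.
  by rewrite ltr_wpDl// !mulr_ge0 ?normc_ge0 ?addr_ge0 ?l1norm_ge0.
(* The first bound makes [|a . h| <= 1], as [normc_cexpB1] requires; the second makes the quadratic
   error, at most [K |h|^2], smaller than [e |h|]. *)
exists (Num.min (1 + l1norm a)^-1 (e / K)).
  by rewrite lt_min invr_gt0 a0 divr_gt0.
move=> h; rewrite le_min => /andP[h1 h2].
set u := Cn_dot a h.
have uh : normc u <= (1 + l1norm a) * l1norm h.
  rewrite (le_trans (normc_Cn_dot _ _))// ler_wpM2r ?l1norm_ge0//.
  by rewrite lerDr.
have u1 : normc u <= 1.
  by rewrite (le_trans uh)// -ler_pdivlMl// mulr1.
rewrite Cn_dotDr cexpD Cn_dotZl -/u.
rewrite (_ : _ - _ - _ = cexp (Cn_dot a z) * (cexp u - 1 - u)); last by ring.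
rewrite normcM; apply: (@le_trans _ _ (normc (cexp (Cn_dot a z)) * (2 * ((1 + l1norm a) * l1norm h) ^+ 2))).
  rewrite ler_wpM2l ?normc_ge0//; apply: (le_trans (normc_cexpB1 u1)).
  by rewrite ler_wpM2l// lerXn2r ?nnegrE ?normc_ge0// mulr_ge0 ?l1norm_ge0// ltW.
rewrite exprMn [l1norm h ^+ 2]expr2 !mulrA ler_wpM2r ?l1norm_ge0//.
apply: (@le_trans _ _ (K * l1norm h)).
  by rewrite ler_wpM2r ?l1norm_ge0// /K expr2 mulrA lerDl.
by rewrite mulrC -ler_pdivlMr.
Qed.

Lemma entire_shift F (a : Cn R n) : entire F -> entire (fun z => F (z + a)).
Proof.
move=> /entireP eF; apply/entireP => z; have [L HL] := eF (z + a).
exists L => e e0; have [d d0 Hd] := HL e e0; exists d => // h /Hd.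
by rewrite [z + a + h]addrAC.
Qed.

(** Conjugating both the argument and the value restores complex differentiability; the derivative
    is [- Cn_conj L]. *)
Lemma entire_conj_refl F : entire F -> entire (fun z => ((F (- Cn_conj z))^*)%C).
Proof.
move=> /entireP eF; apply/entireP => z; have [L HL] := eF (- Cn_conj z).
exists (- Cn_conj L) => e e0; have [d d0 Hd] := HL e e0; exists d => // h hd.
have := Hd (- Cn_conj h).
rewrite (_ : l1norm (- _) = l1norm h); last first.
  by rewrite -scaleN1r l1normZ normcN normc1 mul1r l1norm_conj.
move=> /(_ hd) => H; apply: le_trans H.
rewrite -[leRHS]normc_conj !rmorphB/= Cn_dot_conj Cn_conjN Cn_conjK.
by rewrite Cn_conjD opprD Cn_dotNl Cn_dotNr.
Qed.

Lemma entire_continuous F : entire F -> forall z (e : R), 0 < e ->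
  exists2 d : R, 0 < d & forall h, l1norm h <= d -> normc (F (z + h) - F z) <= e.
Proof.
move=> /entireP eF z e e0; have [L HL] := eF z.
have [d d0 Hd] := HL 1 ltr01.
pose K := 1 + l1norm L.
have K0 : 0 < K by rewrite ltr_pwDl// l1norm_ge0.
exists (Num.min d (e / K)); first by rewrite lt_min d0 divr_gt0.
move=> h; rewrite le_min => /andP[/Hd h1 h2].
rewrite -[F (z + h) - F z](subrK (Cn_dot L h)) (le_trans (le_normcD _ _))//.
apply: (@le_trans _ _ (K * l1norm h)).
  by rewrite /K mulrDl lerD//; exact: normc_Cn_dot.
by rewrite mulrC -ler_pdivlMr.
Qed.

Definition holomorphic1 (f : C -> C) := forall z, exists l : C, forall e : R, 0 < e ->
  exists2 d : R, 0 < d & forall h, normc h <= d -> normc (f (z + h) - f z - l * h) <= e * normc h.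

Lemma entire_line F (u : Cn R n) : entire F -> holomorphic1 (fun t => F (t *: u)).
Proof.
move=> /entireP eF t; have [L HL] := eF (t *: u); exists (Cn_dot L u) => e e0.
pose K := 1 + l1norm u.
have K0 : 0 < K by rewrite ltr_pwDl// l1norm_ge0.
have [d d0 Hd] := HL (e / K) (divr_gt0 e0 K0).
exists (d / K); first by rewrite divr_gt0.
move=> h hd; rewrite scalerDl mulrC -Cn_dotZr.
have hu : l1norm (h *: u) <= normc h * K.
  by rewrite l1normZ ler_wpM2l ?normc_ge0// lerDr.
apply: le_trans (Hd _ _) _.
  by rewrite (le_trans hu)// -ler_pdivlMr.
apply: (@le_trans _ _ (e / K * (normc h * K))).
  by rewrite ler_wpM2l// divr_ge0 ?ltW.
by rewrite mulrA mulrAC divfK ?gt_eqF.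
Qed.

End entire_closure.

(** * Goursat's theorem on rectangles and circle means *)

Section segment_integral.
Context {R : realType}.
Local Notation mu := (@lebesgue_measure R).
Implicit Types (f g : R -> R) (a b c : R).

Definition itg f a b : R := \int[mu]_(x in `[a, b]) f x.

Lemma continuous_integrable_itv f a b : continuous f ->
  mu.-integrable `[a, b] (EFin \o f).
Proof.
move=> cf; apply: continuous_compact_integrable; first exact: segment_compact.
exact: continuous_subspaceT.
Qed.

Lemma itgD f a b c : continuous f -> a <= b -> b <= c ->
  itg f a c = itg f a b + itg f b c.
Proof.
move=> cf ab bc; apply/eqP; rewrite addrC -subr_eq /itg.
rewrite (Rintegral_itvB (continuous_integrable_itv a c cf))//.
rewrite Rintegral_itv_obnd_cbnd//.
apply: integrableS (continuous_integrable_itv b c cf) => //.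
exact: subset_itv_oc_cc.
Qed.

Lemma itg_add f g a b : continuous f -> continuous g ->
  itg (fun x => f x + g x) a b = itg f a b + itg g a b.
Proof. by move=> cf cg; rewrite /itg RintegralD//; exact: continuous_integrable_itv. Qed.

Lemma itg_sub f g a b : continuous f -> continuous g ->
  itg (fun x => f x - g x) a b = itg f a b - itg g a b.
Proof. by move=> cf cg; rewrite /itg RintegralB//; exact: continuous_integrable_itv. Qed.

Lemma itg_cst c a b : a <= b -> itg (fun=> c) a b = c * (b - a).
Proof.
move=> ab; rewrite /itg Rintegral_cst//= lebesgue_measure_itv/= lte_fin.
by case: ltgtP ab => // -> _; rewrite subrr.
Qed.

Lemma itg_bound f a b (M : R) : continuous f -> a <= b ->
  (forall x, a <= x <= b -> `|f x| <= M) -> `|itg f a b| <= M * (b - a).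
Proof.
move=> cf ab fM; rewrite -itg_cst// /itg.
have cn : continuous (fun x => `|f x|).
  by move=> x; apply: continuous_comp; [exact: cf|exact: norm_continuous].
apply: (le_trans (le_normr_Rintegral _ _)) => //.
  exact: continuous_integrable_itv.
apply: le_Rintegral => //.
- exact: continuous_integrable_itv.
- by apply: continuous_integrable_itv => x; exact: cvg_cst.
Qed.

Lemma itg_affine (p q x0 a b : R) : a <= b ->
  itg (fun x => p + q * (x - x0)) a b = p * (b - a) + q * ((b - x0) ^+ 2 - (a - x0) ^+ 2) / 2.
Proof.
rewrite le_eqVlt => /predU1P[<-|ab].
  by rewrite !subrr /itg set_itv1 Rintegral_set1; lra.
pose F x : R := p * x + q * (x - x0) ^+ 2 / 2.
have dF (x : R) : is_derive x 1 F (p + q * (x - x0)).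
  rewrite (_ : F = fun x : R => (p - q * x0) * x ^+ 1 + q / 2 * x ^+ 2 + q * x0 ^+ 2 / 2); last first.
    by apply/funext => y; rewrite /F; lra.
  have h1 := is_derive_monom (p - q * x0) 0 x.
  have h2 := is_derive_monom (q / 2) 1 x.
  have h3 := is_derive_cst (q * x0 ^+ 2 / 2) x (1 : R).
  apply: (is_derive_eq (is_deriveD (is_deriveD h1 h2) h3)).
  by rewrite expr0 expr1; lra.
have cF : continuous F.
  move=> x; apply: differentiable_continuous; apply/derivable1_diffP.
  by case: (dF x).
rewrite /itg /Rintegral (@continuous_FTC2 _ _ F)//.
- by rewrite /F /=; field.
- apply: continuous_subspaceT => x.
  by apply: cvgD; [exact: cvg_cst|apply: cvgM; [exact: cvg_cst|apply: cvgB; [exact: cvg_id|exact: cvg_cst]]].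
- split.
  + by move=> x _; case: (dF x).
  + apply: cvg_at_right_filter; exact: cF.
  + apply: cvg_at_left_filter; exact: cF.
- by move=> x _; rewrite derive1E; case: (dF x).
Qed.

End segment_integral.

Section goursat.
Context {R : realType}.
Implicit Types (P Q : R -> R -> R).

Lemma continuous_eps (f : R -> R) :
  (forall x (e : R), 0 < e -> exists2 d : R, 0 < d &
     forall y, `|y - x| <= d -> `|f y - f x| <= e) -> continuous f.
Proof.
move=> H x; apply/cvgrPdist_le => e e0; have [d d0 Hd] := H x e e0.
near=> y; rewrite distrC; apply: Hd; rewrite distrC; near: y.
exact: cvgr_dist_le.
Unshelve. all: by end_near. Qed.

(* A real 1-form [P dx + Q dy] that is differentiable and closed at each
   point; the derivatives need not be continuous. *)
Definition closed_form P Q := forall x0 y0 : R, exists a b c : R,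
  forall e : R, 0 < e -> exists2 d : R, 0 < d &
  forall x y, `|x - x0| <= d -> `|y - y0| <= d ->
    `|P x y - P x0 y0 - a * (x - x0) - b * (y - y0)| <= e * (`|x - x0| + `|y - y0|) /\
    `|Q x y - Q x0 y0 - b * (x - x0) - c * (y - y0)| <= e * (`|x - x0| + `|y - y0|).

(** The circulation along the boundary of [[a, b] x [c, d]], counterclockwise: bottom and right
    sides, minus top and left sides. *)
Definition oint P Q (a b c d : R) : R :=
  itg (P ^~ c) a b + itg (Q b) c d - itg (P ^~ d) a b - itg (Q a) c d.

(** Separate continuity is enough, because one variable is fixed on each side of a rectangle. *)
Definition sep_continuous P := (forall c, continuous (P ^~ c)) /\ (forall c, continuous (P c)).

Lemma oint_splitx P Q a m b c d : sep_continuous P -> a <= m -> m <= b ->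
  oint P Q a b c d = oint P Q a m c d + oint P Q m b c d.
Proof.
move=> [cP _] am mb; rewrite /oint (itgD (cP c) am mb) (itgD (cP d) am mb).
move: (itg (P ^~ c) a m) (itg (P ^~ c) m b) (itg (P ^~ d) a m) (itg (P ^~ d) m b).
move: (itg (Q a) c d) (itg (Q b) c d) (itg (Q m) c d).
by move=> *; ring.
Qed.

Lemma oint_splity P Q a b c m d : sep_continuous Q -> c <= m -> m <= d ->
  oint P Q a b c d = oint P Q a b c m + oint P Q a b m d.
Proof.
move=> [_ cQ] am mb; rewrite /oint (itgD (cQ a) am mb) (itgD (cQ b) am mb).
move: (itg (Q a) c m) (itg (Q a) m d) (itg (Q b) c m) (itg (Q b) m d).
move: (itg (P ^~ c) a b) (itg (P ^~ d) a b) (itg (P ^~ m) a b).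
by move=> *; ring.
Qed.

Lemma oint_add P Q P' Q' a b c d : sep_continuous P -> sep_continuous Q ->
  sep_continuous P' -> sep_continuous Q' ->
  oint (fun x y => P x y + P' x y) (fun x y => Q x y + Q' x y) a b c d =
  oint P Q a b c d + oint P' Q' a b c d.
Proof.
move=> [? ?] [? ?] [? ?] [? ?]; rewrite /oint.
rewrite (itg_add (f := P ^~ c) (g := P' ^~ c))// (itg_add (f := P ^~ d) (g := P' ^~ d))//.
rewrite (itg_add (f := Q a) (g := Q' a))// (itg_add (f := Q b) (g := Q' b))//.
move: (itg (P ^~ c) a b) (itg (P' ^~ c) a b) (itg (P ^~ d) a b) (itg (P' ^~ d) a b).
move: (itg (Q a) c d) (itg (Q' a) c d) (itg (Q b) c d) (itg (Q' b) c d).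
by move=> *; ring.
Qed.

(** The form is exact: the coefficient [s] of [y] in the first component is also that of [x] in the
    second. *)
Lemma oint_affine (p q r s t x0 y0 a b c d : R) : a <= b -> c <= d ->
  oint (fun x y => p + r * (x - x0) + s * (y - y0))
       (fun x y => q + s * (x - x0) + t * (y - y0)) a b c d = 0.
Proof.
move=> ab cd; rewrite /oint.
have E y : (fun x : R => p + r * (x - x0) + s * (y - y0)) =
   (fun x => (p + s * (y - y0)) + r * (x - x0)).
  by apply/funext => x; rewrite addrAC.
by rewrite /= !E !itg_affine//; field.
Qed.

Lemma oint_bound P Q a b c d (M : R) : sep_continuous P -> sep_continuous Q ->
  a <= b -> c <= d ->
  (forall x y, a <= x <= b -> c <= y <= d -> `|P x y| <= M /\ `|Q x y| <= M) ->
  `|oint P Q a b c d| <= 2 * M * ((b - a) + (d - c)).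
Proof.
move=> [cP _] [_ cQ] ab cd H; rewrite /oint.
have b1 : `|itg (P ^~ c) a b| <= M * (b - a).
  by apply: itg_bound => // x xab; case: (H x c xab) => //; rewrite lexx cd.
have b2 : `|itg (P ^~ d) a b| <= M * (b - a).
  by apply: itg_bound => // x xab; case: (H x d xab) => //; rewrite lexx cd.
have b3 : `|itg (Q a) c d| <= M * (d - c).
  by apply: itg_bound => // y yab; case: (H a y _ yab) => //; rewrite lexx ab.
have b4 : `|itg (Q b) c d| <= M * (d - c).
  by apply: itg_bound => // y yab; case: (H b y _ yab) => //; rewrite lexx ab.
rewrite (le_trans (ler_normB _ _))// (le_trans (lerD (ler_normB _ _) (lexx _)))//.
rewrite (le_trans (lerD (lerD (ler_normD _ _) (lexx _)) (lexx _)))//.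
by move: `|_| `|_| `|_| `|_| b1 b2 b3 b4 => *; lra.
Qed.

Lemma affine_norm_bound (A a b X Y : R) : `|A - a * X - b * Y| <= 1 * (`|X| + `|Y|) ->
  `|A| <= (`|a| + `|b| + 1) * (`|X| + `|Y|).
Proof.
move=> H; rewrite (_ : A = (A - a * X - b * Y) + (a * X + b * Y)); last by ring.
rewrite (le_trans (ler_normD _ _))//.
have := ler_normD (a * X) (b * Y); rewrite !normrM.
have := mulr_ge0 (normr_ge0 a) (normr_ge0 Y).
have := mulr_ge0 (normr_ge0 b) (normr_ge0 X).
lra.
Qed.

Lemma closed_form_continuous P Q : closed_form P Q ->
  sep_continuous P /\ sep_continuous Q.
Proof.
move=> PQ.
have H (x0 y0 e : R) : 0 < e -> exists2 d : R, 0 < d &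
    forall x y, `|x - x0| <= d -> `|y - y0| <= d ->
    `|P x y - P x0 y0| <= e /\ `|Q x y - Q x0 y0| <= e.
  move=> e0; have [a [b [c /(_ 1 ltr01)[d d0 Hd]]]] := PQ x0 y0.
  pose K : R := `|a| + `|b| + `|c| + 1.
  have K0 : 0 < K by rewrite /K ltr_wpDl// !addr_ge0.
  exists (Num.min d (e / K / 2)).
    by rewrite lt_min d0 !divr_gt0.
  move=> x y; rewrite !le_min => /andP[x1 x2] /andP[y1 y2].
  have [/affine_norm_bound h1 /affine_norm_bound h2] := Hd x y x1 y1.
  have s2 : K * (`|x - x0| + `|y - y0|) <= e.
    rewrite mulrC -ler_pdivlMr// (le_trans (lerD x2 y2))//; lra.
  split.
    apply: (le_trans h1); apply: le_trans s2; rewrite ler_wpM2r ?addr_ge0//.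
    by rewrite /K; have := normr_ge0 c; lra.
  apply: (le_trans h2); apply: le_trans s2; rewrite ler_wpM2r ?addr_ge0//.
  by rewrite /K; have := normr_ge0 a; lra.
split; split=> c; apply: continuous_eps => x e e0.
- have [d d0 Hd] := H x c e e0; exists d => // y yx.
  have cc : `|c - c| <= d by rewrite subrr normr0 ltW.
  by case: (Hd y c yx cc).
- have [d d0 Hd] := H c x e e0; exists d => // y yx.
  have cc : `|c - c| <= d by rewrite subrr normr0 ltW.
  by case: (Hd c y cc yx).
- have [d d0 Hd] := H x c e e0; exists d => // y yx.
  have cc : `|c - c| <= d by rewrite subrr normr0 ltW.
  by case: (Hd y c yx cc).
- have [d d0 Hd] := H c x e e0; exists d => // y yx.
  have cc : `|c - c| <= d by rewrite subrr normr0 ltW.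
  by case: (Hd c y cc yx).
Qed.

(** The affine part of the form at the point has no circulation. On a rectangle of half-perimeter
    [l], the rest is at most [(e / 2) l] on a boundary of length [2 l], whence the quadratic bound
    [e l^2]. *)
Lemma closed_form_local P Q x0 y0 (e : R) : closed_form P Q -> 0 < e ->
  exists2 d : R, 0 < d & forall a b c d', a <= x0 <= b -> c <= y0 <= d' ->
    (b - a) + (d' - c) <= d ->
    `|oint P Q a b c d'| <= e * ((b - a) + (d' - c)) ^+ 2.
Proof.
move=> PQ e0; have [r [s [t H]]] := PQ x0 y0.
have e2 : 0 < e / 2 by rewrite divr_gt0.
have [d d0 Hd] := H _ e2; exists d => // a b c d' /andP[ax xb] /andP[cy yd] abd.
have [cP cQ] := closed_form_continuous PQ.
pose Pa x y := P x0 y0 + r * (x - x0) + s * (y - y0).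
pose Qa x y := Q x0 y0 + s * (x - x0) + t * (y - y0).
have caff p u v : sep_continuous (fun x y : R => p + u * (x - x0) + v * (y - y0)).
  split=> k x; apply: cvgD; try exact: cvg_cst; try apply: cvgD; try exact: cvg_cst;
  by apply: cvgM; [exact: cvg_cst|apply: cvgB; [exact: cvg_id|exact: cvg_cst]].
have cB (F G : R -> R -> R) : sep_continuous F -> sep_continuous G ->
    sep_continuous (fun x y => F x y - G x y).
  move=> [F1 F2] [G1 G2]; split=> k x; apply: cvgB.
  - exact: F1. - exact: G1. - exact: F2. - exact: G2.
have cPa : sep_continuous Pa by exact: caff.
have cQa : sep_continuous Qa by exact: caff.
have ab := le_trans ax xb; have cd := le_trans cy yd.
have -> : oint P Q a b c d' = oint (fun x y => P x y - Pa x y) (fun x y => Q x y - Qa x y) a b c d'.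
  have := oint_add a b c d' cPa cQa (cB _ _ cP cPa) (cB _ _ cQ cQa).
  rewrite oint_affine// add0r => <-.
  have E (F G : R -> R -> R) : (fun x y => G x y + (F x y - G x y)) = F.
    by apply/funext => x; apply/funext => y; rewrite addrC subrK.
  by rewrite !E.
have := @oint_bound _ _ a b c d' (e / 2 * ((b - a) + (d' - c))) (cB _ _ cP cPa) (cB _ _ cQ cQa) ab cd.
rewrite (_ : 2 * _ * _ = e * (b - a + (d' - c)) ^+ 2); last by field.
apply=> x y /andP[ax' xb'] /andP[cy' yd'].
have xd : `|x - x0| <= b - a by rewrite ler_norml; apply/andP; split; lra.
have yd2 : `|y - y0| <= d' - c by rewrite ler_norml; apply/andP; split; lra.
have xd2 : `|x - x0| <= d by apply: (le_trans xd); lra.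
have yd3 : `|y - y0| <= d by apply: (le_trans yd2); lra.
have [h1 h2] := Hd x y xd2 yd3.
have h3 : e / 2 * (`|x - x0| + `|y - y0|) <= e / 2 * (b - a + (d' - c)).
  by rewrite ler_wpM2l ?(ltW e2)// lerD.
split.
  by rewrite /Pa (le_trans _ h3)// !opprD !addrA.
by rewrite /Qa (le_trans _ h3)// !opprD !addrA.
Qed.

End goursat.

Section goursat2.
Context {R : realType}.
(* Goursat's quartering argument, for an additive function [J k] of the
   dyadic rectangles of generation [k]. *)
Lemma bisect2 (J : nat -> R * R -> R) (W H : R) (p0 : R * R) : 0 <= W -> 0 <= H ->
  (forall k p, J k p = J k.+1 p + J k.+1 (p.1 + W / 2 ^+ k.+1, p.2) +
    J k.+1 (p.1, p.2 + H / 2 ^+ k.+1) + J k.+1 (p.1 + W / 2 ^+ k.+1, p.2 + H / 2 ^+ k.+1)) ->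
  (forall (x y e : R), 0 < e -> exists k, forall p : R * R,
     p.1 <= x <= p.1 + W / 2 ^+ k -> p.2 <= y <= p.2 + H / 2 ^+ k ->
     `|J k p| <= e / 4 ^+ k) ->
  J 0%N p0 = 0.
Proof.
move=> W0 H0 JS Jloc; apply: contrapT => /eqP J0.
pose e0 := `|J 0%N p0|; have e0_gt0 : 0 < e0 by rewrite normr_gt0.
(* A good rectangle carries at least its share of the initial circulation; if its four quarters all
   carried less, so would their sum. *)
pose good k p := e0 / 4 ^+ k <= `|J k p|.
have step k p : good k p -> exists p', [/\ good k.+1 p',
    p.1 <= p'.1 <= p.1 + W / 2 ^+ k.+1 & p.2 <= p'.2 <= p.2 + H / 2 ^+ k.+1].
  rewrite /good JS => gp; apply: contrapT => /forallNP N.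
  have W1 : 0 <= W / 2 ^+ k.+1 by rewrite divr_ge0// exprn_ge0.
  have H1 : 0 <= H / 2 ^+ k.+1 by rewrite divr_ge0// exprn_ge0.
  have small q : p.1 <= q.1 <= p.1 + W / 2 ^+ k.+1 ->
      p.2 <= q.2 <= p.2 + H / 2 ^+ k.+1 -> `|J k.+1 q| < e0 / 4 ^+ k.+1.
    by move=> h1 h2; rewrite ltNge; apply/negP => h3; apply: (N q).
  have := small p; have := small (p.1 + W / 2 ^+ k.+1, p.2).
  have := small (p.1, p.2 + H / 2 ^+ k.+1).
  have := small (p.1 + W / 2 ^+ k.+1, p.2 + H / 2 ^+ k.+1).
  rewrite /= !lexx !lerDl W1 H1 => /(_ isT isT) s1 /(_ isT isT) s2 /(_ isT isT) s3 /(_ isT isT) s4.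
  have : e0 / 4 ^+ k < e0 / 4 ^+ k.+1 * 4.
    apply: (le_lt_trans gp).
    rewrite (le_lt_trans (ler_normD _ _))// (le_lt_trans (lerD (ler_normD _ _) (lexx _)))//.
    rewrite (le_lt_trans (lerD (lerD (ler_normD _ _) (lexx _)) (lexx _)))//; lra.
  by rewrite exprS invfM mulrA mulrAC mulfVK ?ltxx// pnatr_eq0.
have [nx nxP] : exists nx : nat -> R * R -> R * R, forall k p, good k p ->
   [/\ good k.+1 (nx k p), p.1 <= (nx k p).1 <= p.1 + W / 2 ^+ k.+1 &
      p.2 <= (nx k p).2 <= p.2 + H / 2 ^+ k.+1].
  have /choice[g gP] : forall kp : nat * (R * R), exists p', good kp.1 kp.2 ->
      [/\ good kp.1.+1 p', kp.2.1 <= p'.1 <= kp.2.1 + W / 2 ^+ kp.1.+1 &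
      kp.2.2 <= p'.2 <= kp.2.2 + H / 2 ^+ kp.1.+1].
    move=> [k p]; have [/step[p' Hp']|ng] := pselect (good k p); first by exists p'.
    by exists p => /=.
  by exists (fun k p => g (k, p)) => k p /(gP (k, p)).
pose fix u k := if k is k'.+1 then nx k' (u k') else p0.
have gu k : good k (u k).
  elim: k => [|k IH]; first by rewrite /good expr0 divr1.
  by have [] := nxP _ _ IH.
(* A lower coordinate increases with [k], while the same coordinate plus the side length decreases;
   the supremum of the former therefore lies in all the nested intervals. *)
have lim (pr : R * R -> R) (L : R) : 0 <= L ->
    (forall k, pr (u k) <= pr (u k.+1) <= pr (u k) + L / 2 ^+ k.+1) ->
    exists x, forall k, pr (u k) <= x <= pr (u k) + L / 2 ^+ k.
  move=> L0 Hu.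
  have mono k j : pr (u k) <= pr (u (k + j)%N).
    elim: j => [|j IH]; first by rewrite addn0.
    by rewrite addnS (le_trans IH)//; have /andP[] := Hu (k + j)%N.
  have up k j : pr (u (k + j)%N) + L / 2 ^+ (k + j) <= pr (u k) + L / 2 ^+ k.
    elim: j => [|j IH]; first by rewrite addn0.
    rewrite addnS (le_trans _ IH)//; have /andP[_ h] := Hu (k + j)%N.
    have -> : L / 2 ^+ (k + j) = L / 2 ^+ (k + j).+1 + L / 2 ^+ (k + j).+1.
      by rewrite exprS invfM; field; rewrite expf_neq0.
    lra.
  have ub k j : pr (u j) <= pr (u k) + L / 2 ^+ k.
    have [kj|jk] := leqP k j.
      have := up k (j - k)%N; rewrite subnKC// => h; apply: le_trans h.
      by rewrite lerDl divr_ge0// exprn_ge0.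
    have := mono j (k - j)%N; rewrite (subnKC (ltnW jk)) => /le_trans; apply.
    by rewrite lerDl divr_ge0// exprn_ge0.
  exists (sup (range (pr \o u))) => k; apply/andP; split.
    apply: ub_le_sup; last by exists k.
    by exists (pr (u 0%N) + L / 2 ^+ 0) => _ [j _ <-]; exact: (ub 0%N j).
  apply: ge_sup; first by exists (pr (u 0%N)); exists 0%N.
  by move=> _ [j _ <-]; exact: (ub k j).
have [x xP] := lim fst W W0 (fun k => let: And3 _ h _ := nxP _ _ (gu k) in h).
have [y yP] := lim snd H H0 (fun k => let: And3 _ _ h := nxP _ _ (gu k) in h).
(* Half of [e0] makes the local bound strictly smaller than the share carried by a good
   rectangle. *)
have e2 : 0 < e0 / 2 by rewrite divr_gt0.
have [k Hk] := Jloc x y (e0 / 2) e2.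
have := Hk (u k) (xP k) (yP k); rewrite leNgt => /negP; apply.
apply: lt_le_trans (gu k).
by rewrite ltr_pM2r ?invr_gt0 ?exprn_gt0// ltr_pdivrMr// ltr_pMr// ltr1n.
Qed.

Theorem goursat P Q (a b c d : R) : closed_form P Q -> a <= b -> c <= d ->
  oint P Q a b c d = 0.
Proof.
move=> PQ ab cd; have [cP cQ] := closed_form_continuous PQ.
pose W := b - a; pose H := d - c.
have W0 : 0 <= W by rewrite subr_ge0.
have H0 : 0 <= H by rewrite subr_ge0.
pose J k (p : R * R) := oint P Q p.1 (p.1 + W / 2 ^+ k) p.2 (p.2 + H / 2 ^+ k).
have <- : J 0%N (a, c) = oint P Q a b c d.
  by rewrite /J expr0 !divr1 /= /W /H ![_ + (_ - _)]addrC !subrK.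
apply: (bisect2 _ W0 H0) => [k p|x y e e0].
  have E (L : R) : L / 2 ^+ k = L / 2 ^+ k.+1 + L / 2 ^+ k.+1.
    by rewrite exprS invfM; field; rewrite expf_neq0.
  have W1 : 0 <= W / 2 ^+ k.+1 by rewrite divr_ge0// exprn_ge0.
  have H1 : 0 <= H / 2 ^+ k.+1 by rewrite divr_ge0// exprn_ge0.
  rewrite /J !E /=; move: (W / _) (H / _) W1 H1 => w h w0 h0; rewrite !addrA.
  have x1 : p.1 <= p.1 + w by rewrite lerDl.
  have x2 : p.1 + w <= p.1 + w + w by rewrite lerDl.
  have y1 : p.2 <= p.2 + h by rewrite lerDl.
  have y2 : p.2 + h <= p.2 + h + h by rewrite lerDl.
  rewrite (oint_splitx Q p.2 (p.2 + h + h) cP x1 x2).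
  rewrite (oint_splity P p.1 (p.1 + w) cQ y1 y2).
  rewrite (oint_splity P (p.1 + w) (p.1 + w + w) cQ y1 y2).
  by rewrite addrACA !addrA.
(* The added 1 keeps the quotient defined when the rectangle is reduced to a point. *)
have Q0 : 0 < (W + H) ^+ 2 + 1 by rewrite ltr_wpDl// sqr_ge0.
have e1 : 0 < e / ((W + H) ^+ 2 + 1) by rewrite divr_gt0.
have [r r0 Hr] := closed_form_local x y PQ e1.
have [k kr] : exists k : nat, (W + H) / 2 ^+ k <= r.
  have [k _ Hk] : \forall k \near \oo, (W + H) / 2 ^+ k <= r.
    have : (fun k : nat => (W + H) * 2^-1 ^+ k) @ \oo --> (W + H) * 0.
      apply: cvgM; first exact: cvg_cst.
      by apply: cvg_expr; rewrite ger0_norm// invf_lt1// ltr1n.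
    rewrite mulr0 => /cvgrPdist_le /(_ r r0); apply: filterS => k.
    by rewrite sub0r normrN exprVn; apply: le_trans; exact: ler_norm.
  by exists k; apply: Hk => /=.
exists k => p hx hy; rewrite /J.
have := Hr _ _ _ _ hx hy; rewrite ![_ + _ - _]addrAC !subrr !add0r -mulrDl => /(_ kr) h.
apply: (le_trans h).
rewrite exprMn exprVn -exprM mulnC exprM (_ : 2 ^+ 2 = 4 :> R); last by ring.
rewrite mulrA ler_wpM2r ?invr_ge0 ?exprn_ge0//.
by rewrite mulrAC ler_pdivrMr// ler_wpM2l ?(ltW e0)// lerDl.
Qed.

End goursat2.

(** * Means of holomorphic functions over circles *)

Section circle_mean.
Context {R : realType}.
Local Notation C := R[i].
Local Notation Re := complex.Re.
Local Notation Im := complex.Im.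
Implicit Types (f : C -> C).

Lemma holomorphic1_cexp f : holomorphic1 f -> holomorphic1 (fun z => f (cexp z)).
Proof.
move=> hf z; have [l Hl] := hf (cexp z); exists (l * cexp z) => e e0.
pose A := normc (cexp z); have A0 : 0 <= A := normc_ge0 _.
(* [K] dominates both [3 A], which bounds the increment of [cexp] relative to |h|, and [2 |l| A],
   which bounds its second-order error relative to |h|^2. *)
pose K : R := 2 * A + normc l * A * 2 + 3 * A + 1.
have l0 : 0 <= normc l * A by rewrite mulr_ge0 ?normc_ge0.
have K0 : 0 < K by rewrite /K; lra.
have e1 : 0 < e / 2 / K by rewrite !divr_gt0.
have [d d0 Hd] := Hl _ e1.
exists (Num.min 1 (Num.min (d / K) (e / 2 / K))).
  by rewrite !lt_min ltr01 e1 divr_gt0.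
move=> h; rewrite !le_min => /and3P[h1 h2 h3].
have B := normc_cexpB1 h1.
pose k := cexp z * (cexp h - 1).
have kE : cexp (z + h) = cexp z + k by rewrite cexpD /k; ring.
have nh0 := normc_ge0 h.
have kn : normc k <= 3 * A * normc h.
  rewrite /k normcM -/A -mulrA mulrCA ler_wpM2l//.
  rewrite (_ : cexp h - 1 = (cexp h - 1 - h) + h); last by ring.
  rewrite (le_trans (le_normcD _ _))//.
  have : normc h ^+ 2 <= normc h by rewrite expr2 ler_piMr.
  lra.
have kd : normc k <= d.
  rewrite (le_trans kn)//; apply: (@le_trans _ _ (K * normc h)).
    by rewrite ler_wpM2r// /K; lra.
  by rewrite mulrC -ler_pdivlMr.
have := Hd k kd; rewrite -kE => H.
rewrite (_ : _ - _ - _ = (f (cexp (z + h)) - f (cexp z) - l * k) +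
   l * cexp z * (cexp h - 1 - h)); last by rewrite /k; ring.
rewrite (le_trans (le_normcD _ _))// !normcM -/A.
have s1 : e / 2 / K * normc k <= e / 2 * normc h.
  apply: (@le_trans _ _ (e / 2 / K * (K * normc h))).
    rewrite ler_wpM2l ?(ltW e1)// (le_trans kn)// ler_wpM2r//.
    by rewrite /K; lra.
  by rewrite mulrA divfK ?gt_eqF.
have s2 : normc l * A * normc (cexp h - 1 - h) <= e / 2 * normc h.
  apply: (@le_trans _ _ (normc l * A * (2 * normc h ^+ 2))).
    by rewrite ler_wpM2l.
  rewrite expr2 !mulrA ler_wpM2r//.
  apply: (@le_trans _ _ (K * normc h)).
    by rewrite ler_wpM2r// /K; lra.
  by rewrite mulrC -ler_pdivlMr.
have := le_trans H s1; lra.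
Qed.

Lemma normc_complex_le (x y : R) : normc (x +i* y)%C <= `|x| + `|y|.
Proof. exact: normc_le_ReIm. Qed.

(** These are Im(h dz) and - Re(h dz); the symmetry of their coefficients is the Cauchy-Riemann
    equations. Their dy components are Re h and Im h, whose integrals over vertical segments are the
    circle means. *)
Lemma holomorphic1_closed_form (h : C -> C) : holomorphic1 h ->
  closed_form (fun s t : R => Im (h (s +i* t)%C)) (fun s t : R => Re (h (s +i* t)%C)) /\
  closed_form (fun s t : R => - Re (h (s +i* t)%C)) (fun s t : R => Im (h (s +i* t)%C)).
Proof.
move=> hh; split=> x0 y0; have [l Hl] := hh (x0 +i* y0)%C.
- exists (Im l), (Re l), (- Im l) => e e0.
  have [d d0 Hd] := Hl e e0; exists (d / 2); first by rewrite divr_gt0.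
  move=> x y xd yd.
  have E : (x +i* y)%C = (x0 +i* y0)%C + ((x - x0) +i* (y - y0))%C.
    by apply: complex_ext => /=; ring.
  have nd : normc ((x - x0) +i* (y - y0))%C <= d.
    by rewrite (le_trans (normc_complex_le _ _))//; lra.
  have := Hd _ nd; rewrite -E => H.
  have H2 : normc (h (x +i* y)%C - h (x0 +i* y0)%C - l * ((x - x0) +i* (y - y0))%C) <=
      e * (`|x - x0| + `|y - y0|).
    by rewrite (le_trans H)// ler_wpM2l ?(ltW e0)//; exact: normc_complex_le.
  split; rewrite (le_trans _ H2)//.
    apply: le_trans (Im_le_normc _); rewrite !(cImD, cImN, cImM)/=.
    by rewrite le_eqVlt; apply/orP; left; apply/eqP; congr `|_|; ring.
  apply: le_trans (Re_le_normc _); rewrite !(cReD, cReN, cReM)/=.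
  by rewrite le_eqVlt; apply/orP; left; apply/eqP; congr `|_|; ring.
- exists (- Re l), (Im l), (Re l) => e e0.
  have [d d0 Hd] := Hl e e0; exists (d / 2); first by rewrite divr_gt0.
  move=> x y xd yd.
  have E : (x +i* y)%C = (x0 +i* y0)%C + ((x - x0) +i* (y - y0))%C.
    by apply: complex_ext => /=; ring.
  have nd : normc ((x - x0) +i* (y - y0))%C <= d.
    by rewrite (le_trans (normc_complex_le _ _))//; lra.
  have := Hd _ nd; rewrite -E => H.
  have H2 : normc (h (x +i* y)%C - h (x0 +i* y0)%C - l * ((x - x0) +i* (y - y0))%C) <=
      e * (`|x - x0| + `|y - y0|).
    by rewrite (le_trans H)// ler_wpM2l ?(ltW e0)//; exact: normc_complex_le.
  split; rewrite (le_trans _ H2)//.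
    apply: le_trans (Re_le_normc _); rewrite !(cReD, cReN, cReM)/= -[leRHS]normrN.
    by rewrite le_eqVlt; apply/orP; left; apply/eqP; congr `|_|; ring.
  apply: le_trans (Im_le_normc _); rewrite !(cImD, cImN, cImM)/=.
  by rewrite le_eqVlt; apply/orP; left; apply/eqP; congr `|_|; ring.
Qed.

Lemma cexp_periodic (x : R) : cexp (x +i* pi)%C = cexp (x +i* (- pi))%C.
Proof. by rewrite /cexp cosN sinN sinpi oppr0. Qed.

(* The periodicity of [cexp] cancels the two horizontal sides of the
   rectangle [s, t] x [-pi, pi]. *)
Lemma closed_form_circle (P Q : R -> R -> R) (s t : R) : closed_form P Q ->
  (forall x, P x pi = P x (- pi)) -> s <= t ->
  itg (Q s) (- pi) pi = itg (Q t) (- pi) pi.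
Proof.
move=> PQ per st; have pp : - pi <= pi :> R by rewrite ge0_cp// pi_ge0.
have := goursat PQ st pp; rewrite /oint.
have -> : P ^~ pi = P ^~ (- pi) by apply/funext => x; exact: per.
move: (itg (P ^~ _) s t) (itg (Q s) _ _) (itg (Q t) _ _) => a b c.
by move=> h; lra.
Qed.

(** The integral over the circle of radius exp(s) does not depend on [s], and continuity at 0
    evaluates it as [s] decreases to minus infinity. *)
Lemma itg_circle_limit (G : C -> R) :
  (forall e : R, 0 < e -> exists2 d : R, 0 < d & forall z, normc z <= d -> `|G z - G 0| <= e) ->
  (forall s, continuous (fun t => G (cexp (s +i* t)%C))) ->
  (forall s t, s <= t -> itg (fun x => G (cexp (s +i* x)%C)) (- pi) pi =
     itg (fun x => G (cexp (t +i* x)%C)) (- pi) pi) ->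
  itg (fun x => G (cexp (0 +i* x)%C)) (- pi) pi = 2 * pi * G 0.
Proof.
move=> Glim Gc Gper; apply/eqP; rewrite -subr_eq0 -normr_eq0 eq_le normr_ge0 andbT.
have pp : - pi <= pi :> R by rewrite ge0_cp// pi_ge0.
apply/ler_addgt0Pr => e e0; rewrite add0r.
have p0 : 0 < 2 * pi :> R by rewrite mulr_gt0 ?pi_gt0.
have e1 : 0 < e / (2 * pi) by rewrite divr_gt0.
have [d d0 Hd] := Glim _ e1.
(* The radius exp(s) is then at most [d], and [s <= 0] allows the comparison with the unit
   circle. *)
pose s := Num.min 0 (ln d).
have s0 : s <= 0 by rewrite ge_min lexx.
have sd : expR s <= d.
  by rewrite -[leRHS](lnK d0) ler_expR ge_min lexx orbT.
rewrite -(Gper s 0 s0).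
have -> : 2 * pi * G 0 = itg (fun=> G 0) (- pi) pi :> R.
  by rewrite itg_cst// mulrC; congr (_ * _); ring.
have cc : continuous (fun _ : R => G 0) by move=> x; exact: cvg_cst.
rewrite -(itg_sub _ _ (Gc s) cc).
have -> : e = e / (2 * pi) * (pi - - pi).
  by rewrite opprK -[pi + pi]mulr2n -[pi *+ 2]mulr_natl divfK// gt_eqF.
apply: itg_bound => //.
  by move=> x; apply: cvgB; [exact: Gc|exact: cc].
by move=> x _; apply: Hd; rewrite normc_cexp.
Qed.

(** Composition with [cexp] turns concentric circles into vertical segments of length 2 pi and sends
    the centre to infinity, so Goursat's theorem on rectangles replaces Cauchy's formula. *)
Theorem circle_mean f : holomorphic1 f ->
  itg (fun x => Re (f (cexp (0 +i* x)%C))) (- pi) pi = 2 * pi * Re (f 0) /\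
  itg (fun x => Im (f (cexp (0 +i* x)%C))) (- pi) pi = 2 * pi * Im (f 0).
Proof.
move=> hf; have hh := holomorphic1_cexp hf.
have [F1 F2] := holomorphic1_closed_form hh.
have [[cI1 cI2] [cR1 cR2]] := closed_form_continuous F1.
have lim e : 0 < e -> exists2 d : R, 0 < d & forall z, normc z <= d -> normc (f z - f 0) <= e.
  move=> e0; have [l Hl] := hf 0; have [d d0 Hd] := Hl 1 ltr01.
  pose K := 1 + normc l.
  have K0 : 0 < K by rewrite ltr_pwDl// normc_ge0.
  exists (Num.min d (e / K)); first by rewrite lt_min d0 divr_gt0.
  move=> z; rewrite le_min => /andP[/Hd]; rewrite add0r mul1r => h1 h2.
  rewrite -[f z - f 0](subrK (l * z)) (le_trans (le_normcD _ _))// normcM.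
  apply: (@le_trans _ _ (K * normc z)); first by rewrite /K mulrDl mul1r lerD2r.
  by rewrite mulrC -ler_pdivlMr.
split.
- apply: (@itg_circle_limit (fun z => Re (f z))); [|exact: cR2|].
    move=> e /lim[d d0 Hd]; exists d => // z /Hd; apply: le_trans.
    by rewrite (le_trans _ (Re_le_normc _))// cReD cReN.
  move=> s t st; apply: (closed_form_circle F1 _ st) => x; congr (Im (f _)).
  exact: cexp_periodic.
- apply: (@itg_circle_limit (fun z => Im (f z))); [|exact: cI2|].
    move=> e /lim[d d0 Hd]; exists d => // z /Hd; apply: le_trans.
    by rewrite (le_trans _ (Im_le_normc _))// cImD cImN.
  move=> s t st; apply: (closed_form_circle F2 _ st) => x; congr (- Re (f _)).
  exact: cexp_periodic.
Qed.

End circle_mean.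

(** * Measurability and complex integrals *)

Section measurable_rV.
Context {R : realType} {n : nat} d (T : measurableType d).
Local Notation C := R[i].
Local Notation Re := complex.Re.
Local Notation Im := complex.Im.

Definition l1continuous (f : Cn R n -> R) := forall z (e : R), 0 < e ->
  exists2 d : R, 0 < d & forall h, l1norm h <= d -> `|f (z + h) - f z| <= e.

Definition round_down (k : nat) (x : R) : R := (Num.floor (x * k.+1%:R))%:~R / k.+1%:R.

Lemma round_downP k x : `|round_down k x - x| <= k.+1%:R^-1.
Proof.
have k0 : 0 < k.+1%:R :> R by rewrite ltr0n.
have /andP[h1 h2] := floor_itv (x * k.+1%:R).
rewrite -(ler_pM2r k0) mulVf ?gt_eqF// -[X in _ * X](gtr0_norm k0) -normrM mulrBl.
rewrite /round_down divfK ?gt_eqF// ler_norml.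
by move: h1 h2; rewrite intrD => h1 h2; apply/andP; split; lra.
Qed.

Lemma measurable_countable_factor (V : countType) (N : T -> V) (g : V -> R) :
  (forall v, measurable [set t | N t = v]) -> measurable_fun setT (g \o N).
Proof.
move=> mN _ Y mY; rewrite setTI.
rewrite (_ : _ @^-1` Y = \bigcup_i (if unpickle i is Some v then
   if g v \in Y then [set t | N t = v] else set0 else set0)).
  apply: bigcupT_measurable => i; case: unpickle => // v.
  by case: ifPn.
apply/seteqP; split => [t /= Yt|t [i _]].
  by exists (pickle (N t)) => //; rewrite pickleK mem_set.
by case: unpickle => // v; case: ifPn => // /set_mem gv /= ->.
Qed.

(** Measurability of [X] is given coordinatewise. Rounding the coordinates down to multiples of 1 /
    (k + 1) makes [f] of the result a function of countably many integer labels, and continuity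
    gives pointwise convergence to [f (X t)]. *)
Lemma l1continuous_measurable (f : Cn R n -> R) (X : T -> Cn R n) :
  l1continuous f ->
  (forall j, measurable_fun setT (fun t => Re (X t ord0 j))) ->
  (forall j, measurable_fun setT (fun t => Im (X t ord0 j))) ->
  measurable_fun setT (fun t => f (X t)).
Proof.
move=> fc mRe mIm.
pose Xk k t : Cn R n := \row_j (round_down k (Re (X t ord0 j)) +i*
  round_down k (Im (X t ord0 j)))%C.
have XkX k t : l1norm (Xk k t - X t) <= n%:R * (2 / k.+1%:R).
  rewrite /l1norm.
  apply: (@le_trans _ _ (\sum_(j < n) 2 / k.+1%:R)); last first.
    by rewrite sumr_const card_ord -[leLHS]mulr_natl.
  apply: ler_sum => j _; rewrite !mxE (le_trans (normc_le_ReIm _))//.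
  rewrite cReD cReN cImD cImN /= mulrDl mul1r lerD//; exact: round_downP.
apply: (@measurable_fun_cvg _ _ _ _ (fun k t => f (Xk k t))).
  move=> k.
  pose N t : {ffun 'I_n -> int * int} := [ffun j =>
    (Num.floor (Re (X t ord0 j) * k.+1%:R), Num.floor (Im (X t ord0 j) * k.+1%:R))].
  pose g (v : {ffun 'I_n -> int * int}) : R := f (\row_j ((v j).1%:~R / k.+1%:R +i*
    ((v j).2%:~R / k.+1%:R))%C).
  rewrite (_ : (fun t => f (Xk k t)) = g \o N); last first.
    apply/funext => t; rewrite /g /=; congr f; apply/rowP => j.
    by rewrite !mxE ffunE.
  apply: measurable_countable_factor => v.
  have mfl (a : T -> R) (m : int) : measurable_fun setT a ->
      measurable [set t | Num.floor (a t * k.+1%:R) = m].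
    move=> ma.
    rewrite (_ : [set t | _] = setT `&` (fun t => a t * k.+1%:R) @^-1` `[m%:~R, (m + 1)%:~R[%classic).
      have : measurable_fun setT (fun t => a t * k.+1%:R) by exact: measurable_funM.
      by apply.
    rewrite setTI; apply/seteqP; split => t /=; rewrite in_itv/=.
      by move=> <-; exact: floor_itv.
    by move=> h; exact: floor_def.
  rewrite (_ : [set t | N t = v] = \big[setI/setT]_(j < n)
     ([set t | Num.floor (Re (X t ord0 j) * k.+1%:R) = (v j).1] `&`
      [set t | Num.floor (Im (X t ord0 j) * k.+1%:R) = (v j).2])).
    by apply: bigsetI_measurable => j _; apply: measurableI; exact: mfl.
  rewrite -bigcap_seq.
  apply/seteqP; split => [t /= <- j _|t H]; first by rewrite /= ffunE.
  apply/ffunP => j; rewrite ffunE; have [/= -> ->] := H j (mem_index_enum j).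
  by case: (v j).
move=> t _; apply/cvgrPdist_le => e e0.
have [dl d0 Hd] := fc (X t) e e0.
have : (fun k : nat => n%:R * 2 * (k.+1%:R)^-1 : R) @ \oo --> (n%:R * 2 * 0 : R).
  by apply: cvgM; [exact: cvg_cst|exact: cvg_harmonic].
rewrite mulr0 => /cvgrPdist_le /(_ dl d0); apply: filterS => k.
rewrite sub0r normrN => h.
rewrite distrC (_ : Xk k t = X t + (Xk k t - X t)); last by rewrite addrC subrK.
apply: Hd.
by rewrite (le_trans (XkX k t))// mulrA (le_trans (ler_norm _)).
Qed.

Lemma entire_cmeasurable (F : Cn R n -> C) (X : T -> Cn R n) : entire F ->
  (forall j, measurable_fun setT (fun t => Re (X t ord0 j))) ->
  (forall j, measurable_fun setT (fun t => Im (X t ord0 j))) ->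
  cmeasurable (fun t => F (X t)).
Proof.
move=> /entire_continuous eF mR mI; split.
  apply: (@l1continuous_measurable (fun z => Re (F z))) => // z e e0.
  have [dl d0 Hd] := eF z e e0; exists dl => // h /Hd; apply: le_trans.
  by rewrite -cReN -cReD; exact: Re_le_normc.
apply: (@l1continuous_measurable (fun z => Im (F z))) => // z e e0.
have [dl d0 Hd] := eF z e e0; exists dl => // h /Hd; apply: le_trans.
by rewrite -cImN -cImD; exact: Im_le_normc.
Qed.

End measurable_rV.

(** * Integration of complex-valued functions *)

Section cintegral_theory.
Context d (T : measurableType d) (R : realType).
Local Notation C := R[i].
Local Notation Re := complex.Re.
Local Notation Im := complex.Im.
Implicit Types (f g : T -> C).

Lemma cmeasurable_cst (a : C) : cmeasurable (fun _ : T => a).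
Proof. by split; exact: measurable_cst. Qed.

Lemma cmeasurableD f g : cmeasurable f -> cmeasurable g -> cmeasurable (fun x => f x + g x).
Proof.
move=> [f1 f2] [g1 g2]; split.
  by under eq_fun do rewrite cReD; exact: measurable_funD.
by under eq_fun do rewrite cImD; exact: measurable_funD.
Qed.

Lemma cmeasurableM f g : cmeasurable f -> cmeasurable g -> cmeasurable (fun x => f x * g x).
Proof.
move=> [f1 f2] [g1 g2]; split.
  by under eq_fun do rewrite cReM; apply: measurable_funB; exact: measurable_funM.
by under eq_fun do rewrite cImM; apply: measurable_funD; exact: measurable_funM.
Qed.

Lemma cmeasurableJ f : cmeasurable f -> cmeasurable (fun x => ((f x)^*)%C).
Proof.
move=> [f1 f2]; split; first by under eq_fun do rewrite cReJ.
by under eq_fun do rewrite cImJ; exact: measurable_funN.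
Qed.

Lemma cmeasurable_real (h : T -> R) : measurable_fun setT h -> cmeasurable (fun x => ((h x)%:C)%C).
Proof. by move=> mh; split => //=; exact: measurable_cst. Qed.

Lemma measurable_normc f : cmeasurable f -> measurable_fun setT (fun x => normc (f x)).
Proof.
move=> [f1 f2]; under eq_fun do rewrite normc_ReIm.
apply: (measurableT_comp (continuous_measurable_fun (@sqrt_continuous R))).
by apply: measurable_funD; exact: measurable_funX.
Qed.

Lemma measurable_sqr_normc f : cmeasurable f ->
  measurable_fun setT (fun x => (normc (f x) ^+ 2)%:E).
Proof. by move=> mf; apply/measurable_EFinP/measurable_funX/measurable_normc. Qed.

Lemma emeasurable_normc f : cmeasurable f -> measurable_fun setT (fun x => (normc (f x))%:E).
Proof. by move=> mf; apply/measurable_EFinP/measurable_normc. Qed.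

Variable mu : {measure set T -> \bar R}.

Lemma cintegrable_cmeasurable f : cintegrable mu f -> cmeasurable f.
Proof.
by move=> [/measurable_int/measurable_EFinP ? /measurable_int/measurable_EFinP ?].
Qed.

Lemma cintegrable_bound f (g : T -> R) : cmeasurable f -> mu.-integrable setT (EFin \o g) ->
  (forall x, normc (f x) <= g x) -> cintegrable mu f.
Proof.
move=> [f1 f2] ig fg; split.
  apply: le_integrable ig => //; first exact/measurable_EFinP.
  move=> x _; rewrite /= lee_fin (le_trans (Re_le_normc _))//.
  by rewrite (le_trans (fg x))// ler_norm.
apply: le_integrable ig => //; first exact/measurable_EFinP.
move=> x _; rewrite /= lee_fin (le_trans (Im_le_normc _))//.
by rewrite (le_trans (fg x))// ler_norm.
Qed.

Lemma integrable_normc f : cintegrable mu f -> mu.-integrable setT (fun x => (normc (f x))%:E).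
Proof.
move=> fi; have mf := cintegrable_cmeasurable fi.
case: fi => /integrable_abse f1 /integrable_abse f2.
apply: le_integrable (integrableD measurableT f1 f2) => //.
  exact: emeasurable_normc.
move=> x _ /=; rewrite lee_fin ger0_norm ?normc_ge0// ger0_norm ?addr_ge0//.
exact: normc_le_ReIm.
Qed.

Lemma cintegrableP f : cintegrable mu f <->
  cmeasurable f /\ (\int[mu]_x (normc (f x))%:E < +oo)%E.
Proof.
split=> [fi|[mf fi]].
  split; first exact: cintegrable_cmeasurable.
  have /integrableP[_] := integrable_normc fi.
  by under eq_integral do rewrite /= ger0_norm ?normc_ge0//.
apply: (cintegrable_bound mf (g := fun x => normc (f x))) => //.
apply/integrableP; split; first exact: emeasurable_normc.
by under eq_integral do rewrite /= ger0_norm ?normc_ge0//.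
Qed.

Lemma cintegrableZ (a : C) f : cintegrable mu f -> cintegrable mu (fun x => a * f x).
Proof.
move=> fi; apply: (cintegrable_bound (g := fun x => normc a * normc (f x))).
- by apply: cmeasurableM (cmeasurable_cst _) _; exact: cintegrable_cmeasurable.
- under [X in _.-integrable _ X]eq_fun do rewrite /= EFinM.
  exact/integrableZl/integrable_normc.
- by move=> x; rewrite normcM.
Qed.

Lemma cintegrableJ f : cintegrable mu f -> cintegrable mu (fun x => ((f x)^*)%C).
Proof.
move=> [f1 f2]; split; first by under eq_fun do rewrite cReJ.
by under eq_fun do rewrite cImJ EFinN; exact: integrableN.
Qed.

Lemma cintegralD f g : cintegrable mu f -> cintegrable mu g ->
  cintegral mu (fun x => f x + g x) = cintegral mu f + cintegral mu g.
Proof.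
move=> [f1 f2] [g1 g2]; apply: complex_ext; rewrite ?cReD ?cImD /=.
  by rewrite -RintegralD//; apply: eq_Rintegral => x _; rewrite cReD.
by rewrite -RintegralD//; apply: eq_Rintegral => x _; rewrite cImD.
Qed.

Lemma cintegralZ (a : C) f : cintegrable mu f ->
  cintegral mu (fun x => a * f x) = a * cintegral mu f.
Proof.
move=> [f1 f2]; have iZ (k : R) h : mu.-integrable setT (EFin \o h) ->
    mu.-integrable setT (EFin \o (fun x => k * h x)).
  move=> ih; rewrite (_ : _ \o _ = fun x => (k%:E * (h x)%:E)%E); last exact/funext.
  exact: integrableZl.
apply: complex_ext; rewrite ?cReM ?cImM /=.
  rewrite -!RintegralZl// -RintegralB//; try exact: iZ.
  by apply: eq_Rintegral => x _; rewrite cReM.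
rewrite -!RintegralZl// -RintegralD//; try exact: iZ.
by apply: eq_Rintegral => x _; rewrite cImM.
Qed.

(* Valid without integrability, thanks to [fine] of an infinite integral being 0. *)
Lemma Rintegral_opp (f : T -> R) :
  \int[mu]_x - f x = - \int[mu]_x f x.
Proof.
rewrite /Rintegral; rewrite [in LHS]integralE [in RHS]integralE.
have -> : (fun x => (- f x)%:E)^\+%E = (fun x => (f x)%:E)^\-%E.
  exact: (funeposN (fun x => (f x)%:E)).
have -> : (fun x => (- f x)%:E)^\-%E = (fun x => (f x)%:E)^\+%E.
  exact: (funenegN (fun x => (f x)%:E)).
move: (integral _ _ (_^\+)%E) (integral _ _ (_^\-)%E) => [a| |] [b| |] //=; rewrite ?oppr0//.
by rewrite opprB.
Qed.

Lemma cintegralJ f :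
  cintegral mu (fun x => ((f x)^*)%C) = ((cintegral mu f)^*)%C.
Proof.
rewrite /cintegral /=; congr Complex.
  by apply: eq_Rintegral => x _; case: (f x).
by rewrite -Rintegral_opp; apply: eq_Rintegral => x _; case: (f x).
Qed.

Lemma eq_cintegral f g : f =1 g -> cintegral mu f = cintegral mu g.
Proof. by move=> /funext ->. Qed.

(** Multiplying [f] by the conjugate of its integral [a] makes the integral the real number |a|^2,
    while the real part of the integrand is at most |a| |f|. *)
Lemma normc_cintegral f : cintegrable mu f ->
  ((normc (cintegral mu f))%:E <= \int[mu]_x (normc (f x))%:E)%E.
Proof.
move=> fi; set a := cintegral mu f.
have inf := integrable_normc fi.
have fin := integrable_fin_num measurableT inf.
rewrite -[leRHS]fineK// lee_fin -/(Rintegral mu setT _).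
have [->|a0] := eqVneq (normc a) 0.
  by apply: Rintegral_ge0 => x _; exact: normc_ge0.
have agt : 0 < normc a by rewrite lt_neqAle eq_sym a0 normc_ge0.
rewrite -(ler_pM2l agt) -expr2.
have -> : normc a ^+ 2 = Re (cintegral mu (fun x => (a^*)%C * f x)).
  by rewrite cintegralZ// -/a mulrC mulcJ.
rewrite -RintegralZl//.
have [i1 _] := cintegrableZ (a^*)%C fi.
apply: le_Rintegral => //.
  rewrite (_ : _ \o _ = fun x => ((normc a)%:E * (normc (f x))%:E)%E); last exact/funext.
  exact: integrableZl.
move=> x _; rewrite (le_trans (ler_norm _))// (le_trans (Re_le_normc _))//.
by rewrite normcM normc_conj.
Qed.

End cintegral_theory.

Section cintegral_transfer.
Context d (T : measurableType d) (R : realType).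
Local Notation C := R[i].
Local Notation Re := complex.Re.
Local Notation Im := complex.Im.
Variable mu : {measure set T -> \bar R}.

(** The nonnegative weight commutes with positive and negative parts, which are transferred
    separately; this is why measurability of [f] suffices, the integral being possibly a junk
    value. *)
Lemma integral_weighted_transfer (tau : T -> T) (omega : T -> R) (f : T -> R) :
  measurable_fun setT tau -> (forall x, 0 <= omega x) ->
  (forall h : T -> \bar R, measurable_fun setT h -> (forall x, 0 <= h x)%E ->
    \int[mu]_x ((omega x)%:E * h (tau x))%E = \int[mu]_x h x)%E ->
  measurable_fun setT f ->
  (\int[mu]_x ((omega x * f (tau x))%:E) = \int[mu]_x (f x)%:E)%E.
Proof.
move=> mtau o0 H mf.
have mfE : measurable_fun setT (EFin \o f) by exact/measurable_EFinP.
rewrite [LHS]integralE [RHS]integralE; congr (_ - _)%E.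
  rewrite -[RHS]H; [|exact: measurable_funepos|by move=> x; exact: funepos_ge0].
  apply: eq_integral => x _.
  by rewrite !funeposE EFinM -[X in maxe _ X](mule0 (omega x)%:E) -maxe_pMr// lee_fin.
rewrite -[RHS]H; [|exact: measurable_funeneg|by move=> x; exact: funeneg_ge0].
apply: eq_integral => x _.
rewrite !funenegE EFinM -muleN -[X in maxe _ X](mule0 (omega x)%:E).
by rewrite -maxe_pMr// lee_fin.
Qed.

Lemma cintegral_weighted_transfer (tau : T -> T) (omega : T -> R) (g : T -> C) :
  measurable_fun setT tau -> (forall x, 0 <= omega x) ->
  (forall h : T -> \bar R, measurable_fun setT h -> (forall x, 0 <= h x)%E ->
    \int[mu]_x ((omega x)%:E * h (tau x))%E = \int[mu]_x h x)%E ->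
  cmeasurable g ->
  cintegral mu (fun x => ((omega x)%:C)%C * g (tau x)) = cintegral mu g.
Proof.
move=> mtau o0 H [mf1 mf2]; apply: complex_ext => /=; rewrite /Rintegral.
  rewrite -(integral_weighted_transfer mtau o0 H mf1); congr fine.
  by apply: eq_integral => x _; rewrite cReM/= mul0r subr0.
rewrite -(integral_weighted_transfer mtau o0 H mf2); congr fine.
by apply: eq_integral => x _; rewrite cImM/= mul0r addr0.
Qed.

End cintegral_transfer.

Section cintegral_fubini.
Context d1 d2 (T1 : measurableType d1) (T2 : measurableType d2) (R : realType).
Variable m1 : {sigma_finite_measure set T1 -> \bar R}.
Variable m2 : {sigma_finite_measure set T2 -> \bar R}.

(** Every section, and not almost every one, is assumed integrable, so that the inner real-valued
    integrals agree everywhere with the extended ones. *)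
Lemma Rintegral_fubini (f : T1 * T2 -> R) :
  measurable_fun setT f ->
  (forall x, m2.-integrable setT (fun y => (f (x, y))%:E)) ->
  (forall y, m1.-integrable setT (fun x => (f (x, y))%:E)) ->
  (\int[m1]_x \int[m2]_y (`|f (x, y)|)%:E < +oo)%E ->
  \int[m1]_x \int[m2]_y f (x, y) = \int[m2]_y \int[m1]_x f (x, y).
Proof.
move=> mf i2 i1 fin; rewrite /Rintegral.
have E1 : (\int[m1]_x (fine (\int[m2]_y (f (x, y))%:E))%:E =
    \int[m1]_x \int[m2]_y (f (x, y))%:E)%E.
  apply: eq_integral => x _; rewrite fineK//.
  exact: (integrable_fin_num measurableT (i2 x)).
have E2 : (\int[m2]_y (fine (\int[m1]_x (f (x, y))%:E))%:E =
    \int[m2]_y \int[m1]_x (f (x, y))%:E)%E.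
  apply: eq_integral => y _; rewrite fineK//.
  exact: (integrable_fin_num measurableT (i1 y)).
rewrite E1 E2; congr fine; apply: (@Fubini _ _ _ _ _ m1 m2 (EFin \o f)).
apply/integrable12ltyP; first exact/measurable_EFinP.
exact: fin.
Qed.

Lemma cintegral_fubini (f : T1 * T2 -> R[i]) :
  cmeasurable f ->
  (forall x, cintegrable m2 (fun y => f (x, y))) ->
  (forall y, cintegrable m1 (fun x => f (x, y))) ->
  (\int[m1]_x \int[m2]_y (normc (f (x, y)))%:E < +oo)%E ->
  cintegral m1 (fun x => cintegral m2 (fun y => f (x, y))) =
  cintegral m2 (fun y => cintegral m1 (fun x => f (x, y))).
Proof.
move=> mf i2 i1 fin; have [mf1 mf2] := mf.
have mn : measurable_fun setT (fun p => (normc (f p))%:E) by exact: emeasurable_normc.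
have aux (g : T1 * T2 -> R) : measurable_fun setT g -> (forall p, `|g p| <= normc (f p)) ->
    (\int[m1]_x \int[m2]_y (`|g (x, y)|)%:E < +oo)%E.
  move=> mg gf; apply: le_lt_trans fin.
  have mgE : measurable_fun setT (fun p => (`|g p|)%:E).
    by apply/measurable_EFinP/measurableT_comp.
  rewrite -(fubini_tonelli1 (m1 := m1) (m2 := m2) (fun p => (`|g p|)%:E))//.
  rewrite -(fubini_tonelli1 (m1 := m1) (m2 := m2) (fun p => (normc (f p))%:E))//; last first.
    by move=> p; rewrite lee_fin normc_ge0.
  by apply: ge0_le_integral => // p _; rewrite lee_fin ?normc_ge0.
apply: complex_ext => /=.
  apply: (@Rintegral_fubini (fun p => complex.Re (f p)) mf1).
  - by move=> x; case: (i2 x).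
  - by move=> y; case: (i1 y).
  - by apply: (aux (fun p => complex.Re (f p)) mf1) => p; exact: Re_le_normc.
apply: (@Rintegral_fubini (fun p => complex.Im (f p)) mf2).
- by move=> x; case: (i2 x).
- by move=> y; case: (i1 y).
- by apply: (aux (fun p => complex.Im (f p)) mf2) => p; exact: Im_le_normc.
Qed.

End cintegral_fubini.

(** * Integration against a density *)

Section density.
Context d (T : measurableType d) (R : realType).
Variables (mu nu : {measure set T -> \bar R}) (pdf : T -> R).
Hypotheses (mpdf : measurable_fun setT pdf) (pdf0 : forall x, 0 <= pdf x).
Hypothesis nuE : forall A, measurable A -> nu A = (\int[mu]_(x in A) (pdf x)%:E)%E.
Local Open Scope ereal_scope.
Import HBNNSimple.

(** The hypothesis [nuE] is the case of indicators; additivity gives simple functions, and monotone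
    convergence the general case. *)
Lemma ge0_integral_density (f : T -> \bar R) : measurable_fun setT f ->
  (forall x, 0 <= f x) -> \int[nu]_x f x = \int[mu]_x ((pdf x)%:E * f x).
Proof.
move=> mf f0; pose h := nnsfun_approx measurableT mf.
have hf x : (EFin \o h n) x @[n --> \oo] --> f x by exact: cvg_nnsfun_approx.
transitivity (limn (fun n => \int[nu]_x (h n x)%:E)).
  rewrite -monotone_convergence//.
  - by apply: eq_integral => x _; apply/esym/cvg_lim => //; exact: hf.
  - by move=> n; exact/measurable_EFinP/measurable_funP.
  - by move=> n x _; rewrite lee_fin.
  - by move=> x _ m n mn; rewrite lee_fin; exact/lefP/nd_nnsfun_approx.
transitivity (limn (fun n => \int[mu]_x ((pdf x)%:E * (h n x)%:E))); last first.
  rewrite -monotone_convergence//.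
  - apply: eq_integral => x _; apply/cvg_lim => //.
    by apply: cvgeZl => //; exact: hf.
  - move=> n; apply: emeasurable_funM; first exact/measurable_EFinP.
    exact/measurable_EFinP/measurable_funP.
  - by move=> n x _; rewrite mule_ge0 ?lee_fin.
  - move=> x _ m n mn; rewrite lee_wpmul2l ?lee_fin//; exact/lefP/nd_nnsfun_approx.
congr (limn _); apply/funext => n.
under eq_integral do rewrite fimfunE -fsumEFin//.
rewrite ge0_integral_fsum//; last 2 first.
  - by move=> y; exact/measurable_EFinP/measurable_funM.
  - by move=> y x _; rewrite nnfun_muleindic_ge0.
under [RHS]eq_integral => x _.
  rewrite fimfunE -fsumEFin// ge0_mule_fsumr; last first.
    by move=> y; rewrite nnfun_muleindic_ge0.
  over.
rewrite [RHS]ge0_integral_fsum//; last 2 first.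
  - move=> y; apply: emeasurable_funM; first exact/measurable_EFinP.
    exact/measurable_EFinP/measurable_funM.
  - by move=> y x _; apply: mule_ge0; [rewrite lee_fin|exact: nnfun_muleindic_ge0].
apply: eq_fsbigr => r _.
rewrite integralZl_indic_nnsfun// integral_indic//= setIT nuE//.
have mr : measurable (h n @^-1` [set r]) by exact: measurable_funPTI.
under [RHS]eq_integral do rewrite EFinM muleCA.
(* The approximations are nonnegative, so a level set at a negative [r] is empty. *)
have [r0|r0] := leP 0%R r; last first.
  rewrite preimage_nnfun0// integral_set0 mule0.
  by rewrite integral0_eq// => x _; rewrite indic0 mule0 mule0.
rewrite ge0_integralZl//; last 2 first.
  - by apply: emeasurable_funM; [exact/measurable_EFinP|exact/measurable_EFinP/measurable_indic].
  - by move=> x _; rewrite mule_ge0 ?lee_fin.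
by rewrite integral_mkcond; congr (_ * _); apply: eq_integral => x _;
  rewrite epatch_indic.
Qed.

End density.

(** * The Gaussian measure and the mean value property *)

Section gaussian_theory.
Context {R : realType} {n : nat}.
Local Notation C := R[i].
Local Notation Re := complex.Re.
Local Notation Im := complex.Im.
Local Notation RRn := (Rn R n * Rn R n)%type.
Local Notation gamma := (@gaussian R n).
Local Notation leb := (@lebesgueCn R n).
Implicit Types (p : RRn).

Lemma Re_toCn p j : Re (toCn p ord0 j) = tnth p.1 j.
Proof. by rewrite mxE. Qed.

Lemma Im_toCn p j : Im (toCn p ord0 j) = tnth p.2 j.
Proof. by rewrite mxE. Qed.

Lemma measurable_Re_toCn j : measurable_fun setT (fun p => Re (toCn p ord0 j)).
Proof.
under eq_fun do rewrite Re_toCn.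
exact: (measurableT_comp (measurable_tnth j) measurable_fst).
Qed.

Lemma measurable_Im_toCn j : measurable_fun setT (fun p => Im (toCn p ord0 j)).
Proof.
under eq_fun do rewrite Im_toCn.
exact: (measurableT_comp (measurable_tnth j) measurable_snd).
Qed.

Lemma Cn_sqnormE2 p : Cn_sqnorm (toCn p) = Rn_sqnorm p.1 + Rn_sqnorm p.2.
Proof. by rewrite Cn_sqnormE big_split. Qed.

Lemma measurable_Cn_sqnorm : measurable_fun setT (fun p => Cn_sqnorm (toCn p)).
Proof.
under eq_fun do rewrite Cn_sqnormE2.
apply: measurable_funD.
  exact: (measurableT_comp (@measurable_Rn_sqnorm R n) measurable_fst).
exact: (measurableT_comp (@measurable_Rn_sqnorm R n) measurable_snd).
Qed.

Lemma measurable_l1norm : measurable_fun setT (fun p => l1norm (toCn p)).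
Proof.
apply: measurable_sum => j; apply: measurable_normc; split.
  exact: measurable_Re_toCn.
exact: measurable_Im_toCn.
Qed.

Lemma entire_cmeasurable_toCn (F : Cn R n -> C) : entire F -> cmeasurable (fun p => F (toCn p)).
Proof.
move=> eF; apply: entire_cmeasurable => // j.
  exact: measurable_Re_toCn.
exact: measurable_Im_toCn.
Qed.

Lemma ge0_integral_gaussian (f : RRn -> \bar R) : measurable_fun setT f ->
  (forall p, 0 <= f p)%E ->
  (\int[gamma]_p f p = \int[leb]_p ((gaussian_pdf (toCn p))%:E * f p))%E.
Proof.
apply: ge0_integral_density.
- exact: measurable_gaussian_pdf.
- by move=> p; rewrite mulr_ge0 ?expR_ge0// invr_ge0 exprn_ge0 ?pi_ge0.
- by [].
Qed.

Lemma gaussian_pdf_gt0 (z : Cn R n) : 0 < gaussian_pdf z.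
Proof. by rewrite mulr_gt0 ?expR_gt0// invr_gt0 exprn_gt0 ?pi_gt0. Qed.

Lemma measurable_expR_Cn_sqnorm (c : R) :
  measurable_fun setT (fun p => expR (c * Cn_sqnorm (toCn p))).
Proof.
apply: (measurableT_comp (@measurable_expR R)).
by apply: measurable_funM => //; exact: measurable_Cn_sqnorm.
Qed.

(** The density leaves exp(-(1 - c)|z|^2), which factors over real and imaginary parts; 1 is thus
    the threshold of every growth estimate against [gamma]. *)
Lemma integral_gaussian_expR_lty (c : R) : c < 1 ->
  (\int[gamma]_p (expR (c * Cn_sqnorm (toCn p)))%:E < +oo)%E.
Proof.
move=> c1; rewrite ge0_integral_gaussian//; last first.
  by apply/measurable_EFinP; exact: measurable_expR_Cn_sqnorm.
have a0 : 0 < 1 - c by rewrite subr_gt0.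
pose E (x : Rn R n) := (expR (- ((1 - c) * Rn_sqnorm x)))%:E.
have mE : measurable_fun setT E.
  apply/measurable_EFinP; apply: (measurableT_comp (@measurable_expR R)).
  by apply: measurable_funN; apply: measurable_funM => //; exact: measurable_Rn_sqnorm.
have E0 x : (0 <= E x)%E by rewrite lee_fin expR_ge0.
have -> : (\int[leb]_p ((gaussian_pdf (toCn p))%:E * (expR (c * Cn_sqnorm (toCn p)))%:E) =
  \int[leb]_p ((pi ^- n)%:E * (E p.1 * E p.2)))%E.
  apply: eq_integral => p _; rewrite /gaussian_pdf /E -!EFinM; congr EFin.
  rewrite -mulrA -!expRD; congr (_ * expR _); rewrite Cn_sqnormE2; ring.
have mE1 : measurable_fun setT (fun p => E p.1) by exact: (measurableT_comp mE).
have mE2 : measurable_fun setT (fun p => E p.2) by exact: (measurableT_comp mE).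
have mEE : measurable_fun setT (fun p => E p.1 * E p.2)%E by exact: emeasurable_funM.
rewrite ge0_integralZl//; last 2 first.
- by move=> p _; rewrite mule_ge0.
- by rewrite lee_fin invr_ge0 exprn_ge0 ?pi_ge0.
have EE0 p : (0 <= E p.1 * E p.2)%E by rewrite mule_ge0.
rewrite (ge0_integral_lebesgueCn mEE EE0).1 /=.
have fE := integral_expR_Rn_sqnorm_lty n a0; rewrite -/E in fE.
under eq_integral do rewrite ge0_integralZl//.
have iE0 : (0 <= \int[lebesgueRn R n]_x E x)%E by exact: integral_ge0.
have iEfin : (\int[lebesgueRn R n]_x E x)%E \is a fin_num by rewrite ge0_fin_numE.
rewrite ge0_integralZr//.
by rewrite -(fineK iEfin) -!EFinM ltry.
Qed.

Lemma gaussian_fin : fin_num_fun gamma.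
Proof.
move=> A mA; rewrite ge0_fin_numE//.
apply: (@le_lt_trans _ _ (gamma setT)); first by apply: le_measure; rewrite ?inE.
have := integral_gaussian_expR_lty (@ltr01 R).
by under eq_integral do rewrite mul0r expR0; rewrite integral_cst// mul1e.
Qed.

HB.instance Definition _ := Measure_isFinite.Build _ _ _ gamma gaussian_fin.

(** Completing the square in each coordinate: a linear exponent costs an arbitrarily small part of
    the quadratic one, plus a constant. *)
Lemma l1norm_le_sqnorm (A e : R) (z : Cn R n) : 0 < e ->
  A * l1norm z <= n%:R * (A ^+ 2 / (4 * e)) + e * Cn_sqnorm z.
Proof.
move=> e0; rewrite /l1norm /Cn_sqnorm !mulr_sumr.
rewrite (_ : n%:R * _ = \sum_(j < n) A ^+ 2 / (4 * e)); last first.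
  by rewrite sumr_const card_ord mulr_natl.
rewrite -big_split/=; apply: ler_sum => j _; set t := normc _.
have : 0 <= (A / (2 * e) - t) ^+ 2 * e by rewrite mulr_ge0 ?sqr_ge0 ?ltW.
rewrite (_ : (A / (2 * e) - t) ^+ 2 * e = A ^+ 2 / (4 * e) + e * t ^+ 2 - A * t).
  by rewrite subr_ge0.
by field; rewrite gt_eqF.
Qed.

Lemma integrable_gaussian_exp (A c : R) : c < 1 ->
  gamma.-integrable setT (EFin \o (fun p => expR (A * l1norm (toCn p) + c * Cn_sqnorm (toCn p)))).
Proof.
move=> c1; have [e e0 ce] : exists2 e : R, 0 < e & c + e < 1 by exists ((1 - c) / 2); lra.
pose K := expR (n%:R * (A ^+ 2 / (4 * e))).
have mes : measurable_fun setT (fun p => expR (A * l1norm (toCn p) + c * Cn_sqnorm (toCn p))).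
  apply: (measurableT_comp (@measurable_expR R)); apply: measurable_funD.
    by apply: measurable_funM => //; exact: measurable_l1norm.
  by apply: measurable_funM => //; exact: measurable_Cn_sqnorm.
apply: (le_integrable measurableT (g := fun p => (K%:E * (expR ((c + e) * Cn_sqnorm (toCn p)))%:E)%E)).
- exact/measurable_EFinP.
- move=> p _ /=; rewrite lee_fin ger0_norm ?expR_ge0// ger0_norm ?mulr_ge0 ?expR_ge0//.
  by rewrite -expRD ler_expR; have := l1norm_le_sqnorm A (toCn p) e0; lra.
- apply: integrableZl => //; apply/integrableP; split.
    by apply/measurable_EFinP; exact: measurable_expR_Cn_sqnorm.
  under eq_integral do rewrite /= ger0_norm ?expR_ge0//.
  exact: integral_gaussian_expR_lty.
Qed.

End gaussian_theory.

(** * Changes of variables for the Gaussian measure *)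

Section gaussian_transform.
Context {R : realType} {n : nat}.
Local Notation C := R[i].
Local Notation Re := complex.Re.
Local Notation Im := complex.Im.
Local Notation RRn := (Rn R n * Rn R n)%type.
Local Notation gamma := (@gaussian R n).
Local Notation leb := (@lebesgueCn R n).
Implicit Types (p : RRn).

Definition leb_preserving (tau : RRn -> RRn) := measurable_fun setT tau /\
  forall h : RRn -> \bar R, measurable_fun setT h -> (forall p, 0 <= h p)%E ->
  (\int[leb]_p h (tau p) = \int[leb]_p h p)%E.

Lemma leb_preserving_comp sigma tau : leb_preserving sigma -> leb_preserving tau ->
  leb_preserving (sigma \o tau).
Proof.
move=> [ms Hs] [mt Ht]; split; first exact: measurableT_comp.
move=> h mh h0; rewrite -(Hs h)// -(Ht (h \o sigma))//.
  exact: measurableT_comp.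
by move=> p /=.
Qed.

Lemma leb_preserving_shear1 a c : leb_preserving (shear1 a c).
Proof. by split; [exact: measurable_shear1|move=> h mh h0; exact: ge0_integral_shear1]. Qed.

Lemma leb_preserving_shear2 a c : leb_preserving (shear2 a c).
Proof. by split; [exact: measurable_shear2|move=> h mh h0; exact: ge0_integral_shear2]. Qed.

Lemma leb_preserving_reflect1 : leb_preserving reflect1.
Proof. by split; [exact: measurable_reflect1|move=> h mh h0; exact: ge0_integral_reflect1]. Qed.

(* The density of the Gaussian measure transported by a Lebesgue-preserving map. *)
Definition gauss_weight (tau : RRn -> RRn) p : R :=
  expR (Cn_sqnorm (toCn p) - Cn_sqnorm (toCn (tau p))).

Lemma ge0_gaussian_cv tau (h : RRn -> \bar R) : leb_preserving tau ->
  measurable_fun setT h -> (forall p, 0 <= h p)%E ->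
  (\int[gamma]_p ((gauss_weight tau p)%:E * h (tau p)) = \int[gamma]_p h p)%E.
Proof.
move=> [mt Ht] mh h0; rewrite [RHS]ge0_integral_gaussian// ge0_integral_gaussian//; last 2 first.
- apply: emeasurable_funM; last exact: measurableT_comp.
  apply/measurable_EFinP; apply: (measurableT_comp (@measurable_expR R)).
  apply: measurable_funB; first exact: measurable_Cn_sqnorm.
  exact: (measurableT_comp measurable_Cn_sqnorm mt).
- by move=> p; rewrite mule_ge0// lee_fin expR_ge0.
rewrite -(Ht (fun p => (gaussian_pdf (toCn p))%:E * h p)%E); last 2 first.
- apply: emeasurable_funM => //; apply/measurable_EFinP.
  exact: measurable_gaussian_pdf.
- by move=> p; rewrite mule_ge0// lee_fin ltW// gaussian_pdf_gt0.
apply: eq_integral => p _; rewrite muleA -EFinM; congr (_%:E * _)%E.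
rewrite /gaussian_pdf /gauss_weight -mulrA -expRD; congr (_ * expR _); ring.
Qed.

Lemma cintegral_gaussian_cv tau (g : RRn -> C) : leb_preserving tau -> cmeasurable g ->
  cintegral gamma (fun p => ((gauss_weight tau p)%:C)%C * g (tau p)) = cintegral gamma g.
Proof.
move=> Ht mg; apply: cintegral_weighted_transfer => //.
- by case: Ht.
- by move=> p; rewrite expR_ge0.
- by move=> h mh h0; exact: ge0_gaussian_cv.
Qed.

Lemma cintegrable_gaussian_cv tau (g : RRn -> C) : leb_preserving tau -> cintegrable gamma g ->
  cintegrable gamma (fun p => ((gauss_weight tau p)%:C)%C * g (tau p)).
Proof.
move=> Ht /cintegrableP[mg fg]; have [mt _] := Ht; apply/cintegrableP; split.
  apply: cmeasurableM.
    apply: cmeasurable_real; apply: (measurableT_comp (@measurable_expR R)).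
    apply: measurable_funB; first exact: measurable_Cn_sqnorm.
    exact: (measurableT_comp measurable_Cn_sqnorm mt).
  by case: mg => m1 m2; split; [exact: (measurableT_comp m1 mt)|exact: (measurableT_comp m2 mt)].
apply: le_lt_trans fg.
rewrite -(ge0_gaussian_cv Ht (h := fun p => (normc (g p))%:E)); last 2 first.
- exact: emeasurable_normc.
- by move=> p; rewrite lee_fin normc_ge0.
rewrite le_eqVlt; apply/orP; left; apply/eqP; apply: eq_integral => p _.
by rewrite normcM normc_real ger0_norm ?expR_ge0// EFinM.
Qed.

Definition tup0 : Rn R n := [tuple 0 | j < n].
Lemma tup0E j : tnth tup0 j = 0. Proof. by rewrite tnth_mktuple. Qed.

Lemma toCn_shear1 a c p j : toCn (shear1 a c p) ord0 j =
  ((tnth p.1 j + (a * tnth p.2 j + tnth c j)) +i* tnth p.2 j)%C.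
Proof. by rewrite mxE /= !tup_addE tup_scaleE. Qed.

(** A rotation of angle t is a product of three shears, of slopes - tan(t/2), sin t and - tan(t/2),
    where [a] is - tan(t/2) written rationally. The half turn, where the tangent is infinite, is the
    square of a quarter turn. *)
Lemma rotation_preserving (c s : R) : c ^+ 2 + s ^+ 2 = 1 ->
  exists2 tau, leb_preserving tau & forall p, toCn (tau p) = (c +i* s)%C *: toCn p.
Proof.
have main (c' s' : R) : c' ^+ 2 + s' ^+ 2 = 1 -> c' != -1 ->
  exists2 tau, leb_preserving tau & forall p, toCn (tau p) = (c' +i* s')%C *: toCn p.
  move=> cs c1; have c1' : 1 + c' != 0 by rewrite addrC -subr_eq0 opprK in c1 *.
  pose a := - s' / (1 + c').
  exists (shear1 a tup0 \o (shear2 s' tup0 \o shear1 a tup0)).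
    apply: leb_preserving_comp; first exact: leb_preserving_shear1.
    by apply: leb_preserving_comp; [exact: leb_preserving_shear2|exact: leb_preserving_shear1].
  have h1 : 1 + a * s' = c'.
    by rewrite /a; apply: (mulfI c1'); rewrite mulrDr mulr1 mulrA [_ * (_ / _)]mulrC divfK//; nra.
  have h2 : a + a * c' = - s' by rewrite /a; field.
  move=> p; apply/rowP => j; rewrite [RHS]mxE toCn_shear1 /= !(tup_addE, tup_scaleE, tup0E) !addr0.
  have -> : toCn p ord0 j = (tnth p.1 j +i* tnth p.2 j)%C by rewrite mxE.
  move: (tnth p.1 j) (tnth p.2 j) => x y.
  apply: complex_ext; rewrite ?cReM ?cImM /=.
    transitivity ((1 + a * s') * x + (a + a * (1 + a * s')) * y); first by ring.
    by rewrite h1 h2 mulNr.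
  by transitivity ((1 + a * s') * y + s' * x); [ring|rewrite h1].
move=> cs; have [c1|] := eqVneq c (-1); last exact: main.
have s0 : s = 0 by apply/eqP; rewrite -sqrf_eq0; apply/eqP; move: cs; rewrite c1; nra.
have [tau Ht tauE] : exists2 tau, leb_preserving tau & forall p, toCn (tau p) = (0 +i* 1)%C *: toCn p.
  apply: main; first by rewrite expr0n expr1n add0r.
  by rewrite eq_sym oppr_eq0 oner_eq0.
exists (tau \o tau); first exact: leb_preserving_comp.
move=> p /=; rewrite !tauE scalerA; congr (_ *: _).
by apply: complex_ext; rewrite ?cReM ?cImM /= ?c1 ?s0; ring.
Qed.

Lemma translation_preserving (a : Cn R n) :
  exists2 tau, leb_preserving tau & forall p, toCn (tau p) = toCn p + a.
Proof.
exists (shear1 0 [tuple Re (a ord0 j) | j < n] \o shear2 0 [tuple Im (a ord0 j) | j < n]).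
  by apply: leb_preserving_comp; [exact: leb_preserving_shear1|exact: leb_preserving_shear2].
move=> p; apply/rowP => j; rewrite toCn_shear1 /= !tup_addE tup_scaleE !tnth_mktuple !mxE.
by apply: complex_ext; rewrite ?cReD ?cImD /=; ring.
Qed.

(** As [c] is real, z |-> c - conj z sends [x] to [c - x] and fixes [y]. *)
Lemma reflection_preserving (c : Rn R n) :
  exists2 tau, leb_preserving tau & forall p, toCn (tau p) = ofRn c - Cn_conj (toCn p).
Proof.
exists (shear1 0 c \o reflect1).
  by apply: leb_preserving_comp; [exact: leb_preserving_shear1|exact: leb_preserving_reflect1].
move=> p; apply/rowP => j; rewrite toCn_shear1 /= tup_oppE !mxE.
by apply: complex_ext; rewrite ?cReD ?cImD ?cReN ?cImN ?cReJ ?cImJ /=; ring.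
Qed.

End gaussian_transform.

Section gaussian_mass.
Context {R : realType}.

Lemma integral_expR_Rn_sqnorm n :
  (\int[lebesgueRn R n]_x (expR (- Rn_sqnorm x))%:E = (Num.sqrt pi ^+ n)%:E)%E.
Proof.
have me k : measurable_fun setT (fun x => (expR (- @Rn_sqnorm R k x))%:E).
  apply/measurable_EFinP; apply: (measurableT_comp (@measurable_expR R)).
  by apply: measurable_funN; exact: measurable_Rn_sqnorm.
have e0 k (x : Rn R k) : (0 <= (expR (- Rn_sqnorm x))%:E)%E by rewrite lee_fin expR_ge0.
elim: n => [|n IH].
  have -> : (\int[lebesgueRn R 0]_x (expR (- Rn_sqnorm x))%:E =
      \int[\d_([tuple] : Rn R 0)]_x (expR (- Rn_sqnorm x))%:E)%E by [].
  rewrite integral_dirac ?diracT ?mul1e//; last exact: me.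
  by rewrite /Rn_sqnorm big_ord0 oppr0 expR0 expr0.
rewrite ge0_integral_lebesgueRnS; [|exact: me|exact: e0].
rewrite (eq_integral (fun b : measurableTypeR R => ((gauss_fun b)%:E *
    \int[lebesgueRn R n]_x (expR (- Rn_sqnorm x))%:E)%E)); last first.
  move=> b _; rewrite -ge0_integralZl//; last 2 first.
  - exact: me.
  - by rewrite lee_fin gauss_fun_ge0.
  apply: eq_integral => t _.
  by rewrite Rn_sqnorm_cons opprD expRD EFinM.
rewrite IH ge0_integralZr//; last 2 first.
- by apply/measurable_EFinP; exact: measurable_gauss_fun.
- by move=> x _; rewrite lee_fin gauss_fun_ge0.
by rewrite integralT_gauss -EFinM exprS.
Qed.

Lemma gaussian_setT n : @gaussian R n setT = 1%E.
Proof.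
rewrite /gaussian.
pose E (x : Rn R n) := (expR (- Rn_sqnorm x))%:E.
have mE : measurable_fun setT E.
  apply/measurable_EFinP; apply: (measurableT_comp (@measurable_expR R)).
  by apply: measurable_funN; exact: measurable_Rn_sqnorm.
have E0 x : (0 <= E x)%E by rewrite lee_fin expR_ge0.
have -> : (\int[@lebesgueCn R n]_p (gaussian_pdf (toCn p))%:E =
  \int[@lebesgueCn R n]_p ((pi ^- n)%:E * (E p.1 * E p.2)))%E.
  apply: eq_integral => p _; rewrite /gaussian_pdf /E -!EFinM; congr EFin.
  by rewrite -!expRD Cn_sqnormE2 opprD.
have mE1 : measurable_fun setT (fun p : Rn R n * Rn R n => E p.1).
  exact: (measurableT_comp mE).
have mE2 : measurable_fun setT (fun p : Rn R n * Rn R n => E p.2).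
  exact: (measurableT_comp mE).
have mEE : measurable_fun setT (fun p : Rn R n * Rn R n => E p.1 * E p.2)%E by exact: emeasurable_funM.
have EE0 (p : Rn R n * Rn R n) : (0 <= E p.1 * E p.2)%E by rewrite mule_ge0.
rewrite ge0_integralZl//; last by rewrite lee_fin invr_ge0 exprn_ge0 ?pi_ge0.
rewrite (ge0_integral_lebesgueCn mEE EE0).1 /=.
have fE := integral_expR_Rn_sqnorm n; rewrite -/E in fE.
under eq_integral do rewrite ge0_integralZl// fE.
rewrite ge0_integralZr// fE -!EFinM -exprMn -expr2 sqr_sqrtr ?pi_ge0// mulVf//.
by rewrite expf_neq0// gt_eqF// pi_gt0.
Qed.

End gaussian_mass.

Section mean_value.
Context {R : realType} {n : nat}.
Local Notation C := R[i].
Local Notation Re := complex.Re.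
Local Notation Im := complex.Im.
Local Notation RRn := (Rn R n * Rn R n)%type.
Local Notation gamma := (@gaussian R n).
Implicit Types (p : RRn) (g : Cn R n -> C).

Lemma cintegral_cst (a : C) : cintegral gamma (fun=> a) = a.
Proof.
by apply: complex_ext; rewrite /= Rintegral_cst//= gaussian_setT /= mulr1.
Qed.

Lemma Cn_sqnormZ (a : C) (z : Cn R n) : Cn_sqnorm (a *: z) = normc a ^+ 2 * Cn_sqnorm z.
Proof.
by rewrite /Cn_sqnorm mulr_sumr; apply: eq_bigr => j _; rewrite mxE normcM exprMn.
Qed.

Definition unit_circle (t : R) : C := cexp (0 +i* t)%C.

Lemma unit_circleE t : unit_circle t = (cos t +i* sin t)%C.
Proof. by rewrite /unit_circle /cexp expR0 !mul1r. Qed.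

Lemma rotation_weight (t : R) : exists tau, [/\ leb_preserving tau,
  forall p, toCn (tau p) = unit_circle t *: toCn p & forall p, gauss_weight tau p = 1].
Proof.
have [tau Ht E] := @rotation_preserving R n (cos t) (sin t) (cos2Dsin2 t).
exists tau; split => // p; first by rewrite E unit_circleE.
by rewrite /gauss_weight E -unit_circleE Cn_sqnormZ normc_cexp /= expR0 expr1n mul1r subrr expR0.
Qed.

Lemma cintegrable_rotation g t : entire g -> cintegrable gamma (fun p => g (toCn p)) ->
  cintegrable gamma (fun p => g (unit_circle t *: toCn p)).
Proof.
move=> eg ig; have [tau [Ht E w]] := rotation_weight t.
have := cintegrable_gaussian_cv Ht ig.
by under eq_fun do rewrite w E mul1r.
Qed.

Lemma cintegral_rotation g t : entire g ->
  cintegral gamma (fun p => g (unit_circle t *: toCn p)) = gaussian_integral g.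
Proof.
move=> eg; have [tau [Ht E w]] := rotation_weight t.
rewrite /gaussian_integral -(cintegral_gaussian_cv Ht (entire_cmeasurable_toCn eg)).
by apply: eq_cintegral => p; rewrite w E mul1r.
Qed.

Lemma holomorphic1_circle_continuous (f : C -> C) : holomorphic1 f ->
  continuous (fun t => Re (f (unit_circle t))) /\ continuous (fun t => Im (f (unit_circle t))).
Proof.
move=> /holomorphic1_cexp/holomorphic1_closed_form[F1 _].
by have [[_ cI] [_ cR]] := closed_form_continuous F1; split; [exact: cR|exact: cI].
Qed.

Lemma measurable_unit_circle d (T : measurableType d) (h : T -> R) :
  measurable_fun setT h -> cmeasurable (fun t => unit_circle (h t)).
Proof.
move=> mh; split; under eq_fun do rewrite unit_circleE /=.
  exact: (measurableT_comp (continuous_measurable_fun (@continuous_cos R))).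
exact: (measurableT_comp (continuous_measurable_fun (@continuous_sin R))).
Qed.

(** The Gaussian integral is invariant under rotation by unit scalars, so it equals its own average
    over the circle. After Fubini, the inner integral is the circle mean of z |-> g(z p) at fixed
    [p], which is [g 0]. *)
Theorem gaussian_mean_value g : entire g -> gaussian_integrable g ->
  gaussian_integral g = g 0.
Proof.
move=> eg ig.
pose D : set (measurableTypeR R) := `[- pi, pi]%classic.
have mD : measurable D by exact: measurable_itv.
(* The indicator restricts the angle to [-pi, pi] while Fubini is applied to the Lebesgue measure of
   the whole line. *)
pose f (q : measurableTypeR R * RRn) : C :=
  ((\1_D q.1)%:C)%C * g (unit_circle q.1 *: toCn q.2).
have mind : cmeasurable (fun q : measurableTypeR R * RRn => ((\1_D q.1 : R)%:C)%C).
  by apply: cmeasurable_real; apply: (measurableT_comp (measurable_indic mD)).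
have mf : cmeasurable f.
  apply: cmeasurableM => //.
  have mX j : cmeasurable (fun q : measurableTypeR R * RRn => unit_circle q.1 * toCn q.2 ord0 j).
    apply: cmeasurableM; first exact: measurable_unit_circle.
    split; [exact: (measurableT_comp (measurable_Re_toCn j))|exact: (measurableT_comp (measurable_Im_toCn j))].
  apply: entire_cmeasurable => // j.
    by under eq_fun do rewrite mxE; case: (mX j).
  by under eq_fun do rewrite mxE; case: (mX j).
have i2 t : cintegrable gamma (fun p => f (t, p)).
  have h := cintegrableZ ((\1_D t : R)%:C)%C (cintegrable_rotation t eg ig).
  exact: h.
have hl p : holomorphic1 (fun z => g (z *: toCn p)) by exact: entire_line.
have indE (h : R -> R) t : (h \_ D) t = (\1_D t : R) * h t.
  by rewrite /patch indicE; case: (t \in D); rewrite ?mul1r ?mul0r.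
have imk (h : R -> R) : continuous h -> (lebesgue_measure).-integrable setT
    (fun t => ((\1_D t : R) * h t)%:E).
  move=> ch; have := continuous_integrable_itv (- pi) pi ch.
  rewrite -/D integrable_mkcond//.
  rewrite (_ : (EFin \o h) \_ D = fun t => ((\1_D t : R) * h t)%:E)//.
  by apply/funext => t; rewrite -indE /patch; case: ifP.
have i1 p : cintegrable (@lebesgue_measure R) (fun t => f (t, p)).
  have [cR cI] := holomorphic1_circle_continuous (hl p).
  split.
    by under eq_fun do rewrite cReM /= mul0r subr0; exact: imk.
  by under eq_fun do rewrite cImM /= mul0r addr0; exact: imk.
have A_fin : (\int[gamma]_p (normc (g (toCn p)))%:E < +oo)%E by have /cintegrableP[] := ig.
have p2 : pi - - pi = 2 * pi :> R by rewrite opprK -mulr2n mulr_natl.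
have pp : - pi <= pi :> R by rewrite ge0_cp// pi_ge0.
have lebD : lebesgue_measure D = (2 * pi)%:E.
  have p0 := pi_gt0 R; have pl : - pi < pi :> R by apply: (@lt_trans _ _ 0); rewrite ?oppr_lt0.
  by rewrite /D lebesgue_measure_itv/= lte_fin pl -EFinB p2.
have indint : (lebesgue_measure).-integrable setT (EFin \o (\1_D : measurableTypeR R -> R)).
  have c1 : continuous (fun _ : R => 1 : R) by move=> x; exact: cvg_cst.
  have := imk _ c1; rewrite (_ : (fun t => _) = EFin \o (\1_D : measurableTypeR R -> R))//.
  by apply/funext => t; rewrite /= mulr1.
have lebI : (\int[lebesgue_measure]_t (\1_D t : R)%:E = (2 * pi)%:E)%E.
  by rewrite integral_indic// setIT; exact: lebD.
have indR : \int[lebesgue_measure]_t (\1_D t : R) = 2 * pi.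
  by rewrite /Rintegral lebI.
(* By rotation invariance the inner integral is the same finite constant at every angle of [D], and
   [D] has finite length. *)
have fin : (\int[lebesgue_measure]_t \int[gamma]_p (normc (f (t, p)))%:E < +oo)%E.
  pose A := (\int[gamma]_p (normc (g (toCn p)))%:E)%E.
  rewrite (eq_integral (fun t : measurableTypeR R => ((\1_D t)%:E * A)%E)); last first.
    move=> t _; rewrite /A; have [tau [Ht E w]] := rotation_weight t.
    rewrite -(ge0_gaussian_cv Ht (h := fun p => (normc (g (toCn p)))%:E)); last 2 first.
    - by apply: emeasurable_normc; exact: entire_cmeasurable_toCn.
    - by move=> p; rewrite lee_fin normc_ge0.
    rewrite -ge0_integralZl//; last 2 first.
    - apply: emeasurable_funM.
        under eq_fun do rewrite w.
        exact: measurable_cst.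
      under eq_fun do rewrite E.
      apply: emeasurable_normc; exact: cintegrable_cmeasurable (cintegrable_rotation _ eg ig).
    - by move=> p _; rewrite mule_ge0 ?lee_fin ?normc_ge0 ?expR_ge0.
    apply: eq_integral => p _; rewrite /f /= normcM normc_real w E mul1e EFinM.
    by rewrite ger0_norm.
  have A0 : (0 <= A)%E by apply: integral_ge0 => p _; rewrite lee_fin normc_ge0.
  rewrite ge0_integralZr//; last by apply/measurable_EFinP; exact: measurable_indic.
  rewrite lebI.
  have Af : A \is a fin_num by rewrite ge0_fin_numE.
  by rewrite -(fineK Af) -EFinM ltry.
have := cintegral_fubini mf i2 i1 fin.
have -> : (fun t => cintegral gamma (fun p => f (t, p))) =
    (fun t => ((\1_D t : R)%:C)%C * gaussian_integral g).
  apply/funext => t; rewrite /f /=.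
  by rewrite (cintegralZ _ (cintegrable_rotation t eg ig)) cintegral_rotation.
have -> : (fun p => cintegral (@lebesgue_measure R) (fun t => f (t, p))) =
    (fun p => ((2 * pi)%:C)%C * g 0).
  apply/funext => p; have [cmR cmI] := circle_mean (hl p).
  rewrite scale0r in cmR cmI.
  apply: complex_ext; rewrite ?cReM ?cImM /= mul0r ?subr0 ?addr0.
    rewrite -cmR /itg [in RHS]Rintegral_mkcond; apply: eq_Rintegral => t _.
    by rewrite indE cReM /= mul0r subr0.
  rewrite -cmI /itg [in RHS]Rintegral_mkcond; apply: eq_Rintegral => t _.
  by rewrite indE cImM /= mul0r addr0.
rewrite cintegral_cst.
have -> : cintegral lebesgue_measure (fun t => ((\1_D t : R)%:C)%C * gaussian_integral g) =
    ((2 * pi)%:C)%C * gaussian_integral g.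
  apply: complex_ext; rewrite ?cReM ?cImM /= mul0r ?subr0 ?addr0.
    rewrite -indR -RintegralZr//; apply: eq_Rintegral => t _.
    by rewrite ?cReM /= ?mul0r subr0.
  rewrite -indR -RintegralZr//; apply: eq_Rintegral => t _.
  by rewrite ?cImM /= ?mul0r addr0.
apply: mulfI; rewrite eq_complex /= negb_and.
by rewrite mulf_neq0// gt_eqF// pi_gt0.
Qed.

End mean_value.

(** * Reproducing kernels of the Fock space *)

Section reproducing.
Context {R : realType} {n : nat}.
Local Notation C := R[i].
Local Notation Re := complex.Re.
Local Notation Im := complex.Im.
Local Notation RRn := (Rn R n * Rn R n)%type.
Local Notation gamma := (@gaussian R n).
Implicit Types (p : RRn) (F G f g : Cn R n -> C) (z w a : Cn R n).

Definition kern a w : C := cexp (Cn_dot w (Cn_conj a)).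

Lemma entire_kern a : entire (kern a).
Proof.
rewrite (_ : kern a = fun w => cexp (Cn_dot (Cn_conj a) w)); first exact: entire_cexp_dot.
by apply/funext => w; rewrite /kern Cn_dotC.
Qed.

Lemma Cn_sqnorm_dot z : ((Cn_sqnorm z)%:C)%C = Cn_dot z (Cn_conj z).
Proof.
rewrite /Cn_sqnorm /Cn_dot rmorph_sum; apply: eq_bigr => j _.
by rewrite mxE mulcJ.
Qed.

(** After translation by [a], the weight exp(|v|^2 - |v + a|^2) cancels the antiholomorphic factor
    of the conjugate kernel. The remaining [g] is entire with [g 0 = f a], and the mean value
    property applies. Only the product is assumed integrable, so that [f] may be a function not yet
    known to be square integrable. *)
Theorem gaussian_reproducing f a : entire f ->
  gaussian_integrable (fun w => f w * ((kern a w)^*)%C) ->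
  gaussian_integral (fun w => f w * ((kern a w)^*)%C) = f a.
Proof.
move=> ef ih; have [tau Ht E] := @translation_preserving R n a.
pose g v := f (v + a) * cexp (Cn_dot (- Cn_conj a) v).
have eg : entire g by apply: entireM; [exact: entire_shift|exact: entire_cexp_dot].
have gE p : ((gauss_weight tau p)%:C)%C * (f (toCn (tau p)) * ((kern a (toCn (tau p)))^*)%C) =
    g (toCn p).
  rewrite E /g mulrCA; congr (_ * _); rewrite /gauss_weight E -cexp_real /kern -cexpJ -cexpD.
  congr cexp; rewrite rmorphB/= !Cn_sqnorm_dot !Cn_conjD Cn_dot_conj Cn_conjD Cn_conjK.
  move: (toCn p) => v.
  rewrite !(Cn_dotDl, Cn_dotDr) Cn_dotNl (Cn_dotC (Cn_conj v) a) (Cn_dotC (Cn_conj a) a).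
  by rewrite (Cn_dotC (Cn_conj a) v); ring.
have mh : cmeasurable (fun p => f (toCn p) * ((kern a (toCn p))^*)%C).
  exact: cintegrable_cmeasurable ih.
have ig : gaussian_integrable g.
  have := cintegrable_gaussian_cv Ht ih.
  by under eq_fun do rewrite gE.
have := gaussian_mean_value eg ig.
rewrite /g add0r Cn_dot0r cexp0 mulr1 => <-.
rewrite /gaussian_integral -(cintegral_gaussian_cv Ht mh).
by apply: eq_cintegral => p; rewrite gE.
Qed.

(** The ambient L^2 space: truncations are measurable and square integrable, but not entire. *)
Definition memL2 F := cmeasurable (fun p => F (toCn p)) /\ (fock_sqnorm F < +oo)%E.

Lemma fock_memL2 F : fock F -> memL2 F.
Proof. by move=> [eF fF]; split=> //; exact: entire_cmeasurable_toCn. Qed.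

Lemma fock_sqnorm_ge0 F : (0 <= fock_sqnorm F)%E.
Proof. by apply: integral_ge0 => p _; rewrite lee_fin sqr_ge0. Qed.

Lemma fock_norm_ge0 F : 0 <= fock_norm F.
Proof. exact: sqrtr_ge0. Qed.

Lemma fock_norm_sqr F : memL2 F -> ((fock_norm F ^+ 2)%:E = fock_sqnorm F)%E.
Proof.
move=> [_ fF]; have f0 := fock_sqnorm_ge0 F.
have ff : fock_sqnorm F \is a fin_num by rewrite ge0_fin_numE.
by rewrite /fock_norm sqr_sqrtr ?fine_ge0// fineK.
Qed.

Lemma fock_norm_le F G (c : R) : memL2 F -> memL2 G -> 0 <= c ->
  (forall w, normc (F w) <= c * normc (G w)) -> fock_norm F <= c * fock_norm G.
Proof.
move=> mF mG c0 FG; rewrite -(@ler_pXn2r _ 2)// ?nnegrE ?mulr_ge0 ?fock_norm_ge0//.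
rewrite exprMn -lee_fin [X in (_ <= X)%E]EFinM !fock_norm_sqr// -ge0_integralZl//; last 3 first.
- by apply: measurable_sqr_normc; case: mG.
- by move=> p _; rewrite lee_fin sqr_ge0.
- by rewrite lee_fin sqr_ge0.
apply: ge0_le_integral => //.
- by move=> p _; rewrite lee_fin sqr_ge0.
- by apply: measurable_sqr_normc; case: mF.
- by apply: emeasurable_funM => //; apply: measurable_sqr_normc; case: mG.
- move=> p _; rewrite -EFinM lee_fin -exprMn lerXn2r ?nnegrE ?normc_ge0//.
  by rewrite mulr_ge0 ?normc_ge0.
Qed.

(* Optimizing [t] turns the AM-GM bound into Cauchy-Schwarz. *)
Lemma le_geom_mean (X a b : R) : 0 <= a -> 0 <= b ->
  (forall t, 0 < t -> X <= (t * a ^+ 2 + b ^+ 2 / t) / 2) -> X <= a * b.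
Proof.
move=> a0 b0 H; apply/ler_addgt0Pr => e e0.
pose d := e / (a + b + 1).
have ab0 : 0 < a + b + 1 by rewrite ltr_wpDl// addr_ge0.
have d0 : 0 < d by rewrite divr_gt0.
have ad : 0 < a + d by rewrite ltr_wpDl.
have bd : 0 < b + d by rewrite ltr_wpDl.
(* The optimal parameter is [b / a]; the perturbation [d] keeps it defined and positive when [a] or
   [b] is 0. *)
have t0 : 0 < (b + d) / (a + d) by rewrite divr_gt0.
apply: (le_trans (H _ t0)).
have h1 : (b + d) / (a + d) * a ^+ 2 <= (b + d) * a.
  rewrite mulrAC ler_pdivrMr//.
  by have := mulr_ge0 (ltW bd) (mulr_ge0 a0 (ltW d0)); lra.
have h2 : b ^+ 2 / ((b + d) / (a + d)) <= b * (a + d).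
  rewrite invf_div mulrA ler_pdivrMr//.
  by have := mulr_ge0 (ltW ad) (mulr_ge0 b0 (ltW d0)); lra.
have h3 : d * (a + b) <= e.
  rewrite /d mulrAC ler_pdivrMr// ler_wpM2l ?(ltW e0)//; lra.
have := mulr_ge0 (ltW d0) a0; have := mulr_ge0 (ltW d0) b0.
lra.
Qed.

Lemma fock_CauchySchwarz_abs F G : memL2 F -> memL2 G ->
  (\int[gamma]_p (normc (F (toCn p)) * normc (G (toCn p)))%:E
     <= (fock_norm F * fock_norm G)%:E)%E.
Proof.
move=> mF mG; set I := (X in (X <= _)%E).
have m1 := measurable_sqr_normc mF.1; have m2 := measurable_sqr_normc mG.1.
have mI : measurable_fun setT (fun p => (normc (F (toCn p)) * normc (G (toCn p)))%:E).
  apply/measurable_EFinP/measurable_funM; apply: measurable_normc.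
    by case: mF.
  by case: mG.
have H (t : R) : 0 < t ->
    (I <= ((t * fock_norm F ^+ 2 + fock_norm G ^+ 2 / t) / 2)%:E)%E.
  move=> t0.
  rewrite (_ : (t * _ + _ / t) / 2 = t / 2 * fock_norm F ^+ 2 + t^-1 / 2 * fock_norm G ^+ 2); last first.
    by rewrite mulrDl mulrAC [_ / t]mulrC [_^-1 * _ / 2]mulrAC.
  rewrite EFinD (EFinM (t / 2)) (EFinM (t^-1 / 2)) !fock_norm_sqr// /fock_sqnorm.
  have c1 : (0 <= (t / 2)%:E)%E by rewrite lee_fin divr_ge0 ?ltW.
  have c2 : (0 <= (t^-1 / 2)%:E)%E by rewrite lee_fin divr_ge0 ?invr_ge0 ?ltW.
  rewrite -!ge0_integralZl//; try by move=> p _; rewrite lee_fin sqr_ge0.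
  rewrite -ge0_integralD//; try by [exact: measurable_funeM|move=> p _; rewrite mule_ge0// lee_fin sqr_ge0].
  apply: ge0_le_integral => //.
  - by move=> p _; rewrite lee_fin mulr_ge0 ?normc_ge0.
  - by apply: emeasurable_funD; exact: measurable_funeM.
  move=> p _; rewrite -!EFinM -EFinD lee_fin.
  move: (normc (F (toCn p))) (normc (G (toCn p))) => x y.
  have : 0 <= (t * x - y) ^+ 2 / (2 * t) by rewrite divr_ge0 ?sqr_ge0// mulr_ge0// ltW.
  rewrite (_ : _ / (2 * t) = t / 2 * x ^+ 2 + t^-1 / 2 * y ^+ 2 - x * y); last first.
    by field; rewrite gt_eqF.
  by rewrite subr_ge0.
have I0 : (0 <= I)%E by apply: integral_ge0 => p _; rewrite lee_fin mulr_ge0 ?normc_ge0.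
have If : I \is a fin_num.
  by rewrite ge0_fin_numE// (le_lt_trans (H 1 ltr01))// ltry.
rewrite -(fineK If) lee_fin; apply: le_geom_mean; rewrite ?fock_norm_ge0// => t /H.
by rewrite -{1}(fineK If) lee_fin.
Qed.

Lemma inner_integrable F G : memL2 F -> memL2 G ->
  gaussian_integrable (fun w => F w * ((G w)^*)%C).
Proof.
move=> mF mG; apply/cintegrableP; split.
  by apply: cmeasurableM; [case: mF|apply: cmeasurableJ; case: mG].
under eq_integral do rewrite normcM normc_conj.
by apply: le_lt_trans (fock_CauchySchwarz_abs mF mG) _; rewrite ltry.
Qed.

Lemma fock_CauchySchwarz F G : memL2 F -> memL2 G ->
  normc (fock_inner F G) <= fock_norm F * fock_norm G.
Proof.
move=> mF mG; rewrite -lee_fin.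
apply: (le_trans (normc_cintegral (inner_integrable mF mG))).
by under eq_integral do rewrite normcM normc_conj; exact: fock_CauchySchwarz_abs.
Qed.

Lemma fock_innerJ F G : memL2 F -> memL2 G ->
  fock_inner G F = ((fock_inner F G)^*)%C.
Proof.
move=> mF mG; rewrite /fock_inner /gaussian_integral -cintegralJ.
by apply: eq_cintegral => p; rewrite rmorphM/= conjcK mulrC.
Qed.

Lemma fock_innerDl F G H : memL2 F -> memL2 G -> memL2 H ->
  fock_inner (fun w => F w + G w) H = fock_inner F H + fock_inner G H.
Proof.
move=> mF mG mH; rewrite /fock_inner /gaussian_integral -cintegralD; last 2 first.
- exact: inner_integrable.
- exact: inner_integrable.
by apply: eq_cintegral => p; rewrite mulrDl.
Qed.

Lemma fock_innerZl (c : C) F H : memL2 F -> memL2 H ->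
  fock_inner (fun w => c * F w) H = c * fock_inner F H.
Proof.
move=> mF mH; rewrite /fock_inner /gaussian_integral -cintegralZ; last exact: inner_integrable.
by apply: eq_cintegral => p; rewrite mulrA.
Qed.

Lemma fock_inner_norm F : memL2 F -> fock_inner F F = ((fock_norm F ^+ 2)%:C)%C.
Proof.
move=> mF; apply: complex_ext => /=.
  rewrite /Rintegral -[RHS]/(fine (fock_norm F ^+ 2)%:E) fock_norm_sqr//; congr fine.
  by apply: eq_integral => p _; rewrite mulcJ.
rewrite /Rintegral (_ : (fun p => _) = cst 0%E); first by rewrite integral0.
by apply/funext => p; rewrite mulcJ.
Qed.

Lemma memL2D F G : memL2 F -> memL2 G -> memL2 (fun w => F w + G w).
Proof.
move=> mF mG; split; first by apply: cmeasurableD; [case: mF|case: mG].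
apply: (@le_lt_trans _ _ (2%:E * fock_sqnorm F + 2%:E * fock_sqnorm G)%E); last first.
  by rewrite -!fock_norm_sqr// -!EFinM -EFinD ltry.
have m1 := measurable_sqr_normc mF.1; have m2 := measurable_sqr_normc mG.1.
rewrite /fock_sqnorm -!ge0_integralZl//; try by move=> p _; rewrite lee_fin sqr_ge0.
rewrite -ge0_integralD//; try by [exact: measurable_funeM|move=> p _; rewrite mule_ge0// lee_fin sqr_ge0].
apply: ge0_le_integral => //.
- by move=> p _; rewrite lee_fin sqr_ge0.
- by apply: measurable_sqr_normc; apply: cmeasurableD; [case: mF|case: mG].
- by apply: emeasurable_funD; exact: measurable_funeM.
move=> p _; rewrite -!EFinM -EFinD lee_fin.
have h : normc (F (toCn p) + G (toCn p)) ^+ 2 <= (normc (F (toCn p)) + normc (G (toCn p))) ^+ 2.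
  by rewrite lerXn2r ?nnegrE ?addr_ge0 ?normc_ge0// le_normcD.
apply: (le_trans h); move: (normc (F (toCn p))) (normc (G (toCn p))) => x y.
have := sqr_ge0 (x - y); rewrite !sqrrD sqrrN; lra.
Qed.

Lemma memL2Z (c : C) F : memL2 F -> memL2 (fun w => c * F w).
Proof.
move=> mF; split; first by apply: cmeasurableM; [exact: cmeasurable_cst|case: mF].
rewrite /fock_sqnorm (eq_integral (fun p => (normc c ^+ 2)%:E * (normc (F (toCn p)) ^+ 2)%:E)%E); last first.
  by move=> p _; rewrite normcM exprMn EFinM.
rewrite ge0_integralZl//; last 3 first.
- by apply: measurable_sqr_normc; case: mF.
- by move=> p _; rewrite lee_fin sqr_ge0.
- by rewrite lee_fin sqr_ge0.
by rewrite -/(fock_sqnorm F) -fock_norm_sqr// -EFinM ltry.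
Qed.

End reproducing.

(** * Kernel functions and their Taylor expansion *)

Section kernels.
Context {R : realType} {n : nat}.
Local Notation C := R[i].
Local Notation Re := complex.Re.
Local Notation Im := complex.Im.
Local Notation RRn := (Rn R n * Rn R n)%type.
Local Notation gamma := (@gaussian R n).
Implicit Types (p : RRn) (F G f g : Cn R n -> C) (z w a h : Cn R n).

Lemma monom_fact_le_expR (x : R) k : 0 <= x -> x ^+ k / k`!%:R <= expR x.
Proof.
move=> x0; case: k => [|k]; first by rewrite expr0 divr1 (le_trans _ (expR_ge1Dx x))// lerDl.
by rewrite (le_trans _ (expR_ge1Dxn k x0))// lerDr.
Qed.

Lemma integrable_exp_bound (f : RRn -> C) (B A c : R) : cmeasurable f -> c < 1 ->
  (forall p, normc (f p) <= B * expR (A * l1norm (toCn p) + c * Cn_sqnorm (toCn p))) ->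
  cintegrable gamma f.
Proof.
move=> mf c1 fB.
apply: (cintegrable_bound mf _ fB).
exact: integrableZl (integrable_gaussian_exp A c1).
Qed.

(** Squaring doubles the exponent, so the threshold 1 for integrability becomes 1/2. *)
Lemma memL2_exp_bound F (B A c : R) : cmeasurable (fun p => F (toCn p)) -> c < 2^-1 ->
  (forall w, normc (F w) <= B * expR (A * l1norm w + c * Cn_sqnorm w)) -> memL2 F.
Proof.
move=> mF c1 fB; split=> //.
have c2 : 2 * c < 1 by rewrite -ltr_pdivlMl// mulr1.
have : cintegrable gamma (fun p => F (toCn p) * F (toCn p)).
  apply: (@integrable_exp_bound _ (B ^+ 2) (2 * A) (2 * c)) => //.
    exact: cmeasurableM.
  move=> p; rewrite normcM.
  rewrite (_ : _ + _ = (A * l1norm (toCn p) + c * Cn_sqnorm (toCn p)) +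
     (A * l1norm (toCn p) + c * Cn_sqnorm (toCn p))); last by ring.
  by rewrite expRD expr2 mulrACA ler_pM// normc_ge0.
move=> /cintegrableP[_]; rewrite /fock_sqnorm.
by under eq_integral do rewrite normcM -expr2.
Qed.

Lemma fock_exp_bound F (B A c : R) : entire F -> c < 2^-1 ->
  (forall w, normc (F w) <= B * expR (A * l1norm w + c * Cn_sqnorm w)) -> fock F.
Proof.
move=> eF c1 fB; split=> //.
by have [] := memL2_exp_bound (entire_cmeasurable_toCn eF) c1 fB.
Qed.

Lemma normc_kern_le a w : normc (kern a w) <= expR (l1norm a * l1norm w).
Proof.
rewrite normc_cexp ler_expR (le_trans (ler_norm _))// (le_trans (Re_le_normc _))//.
by rewrite (le_trans (normc_Cn_dot _ _))// l1norm_conj mulrC.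
Qed.

Lemma fockD F G : fock F -> fock G -> fock (fun w => F w + G w).
Proof.
move=> fF fG; have [eF _] := fF; have [eG _] := fG; split; first exact: entireD.
by have [] := memL2D (fock_memL2 fF) (fock_memL2 fG).
Qed.

Lemma fockZ (c : C) F : fock F -> fock (fun w => c * F w).
Proof.
move=> fF; have [eF _] := fF; split; first by apply: entireM => //; exact: entire_cst.
by have [] := memL2Z c (fock_memL2 fF).
Qed.

Lemma fock0 : fock (fun _ : Cn R n => 0 : C).
Proof.
apply: (@fock_exp_bound _ 0 0 0).
- exact: entire_cst.
- by rewrite invr_gt0.
- by move=> w; rewrite normc0 mul0r.
Qed.

Lemma fock_sum I (r : seq I) (F : I -> Cn R n -> C) :
  (forall i, fock (F i)) -> fock (fun w => \sum_(i <- r) F i w).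
Proof.
move=> fF; elim: r => [|i r IH].
  by under eq_fun do rewrite big_nil; exact: fock0.
by under eq_fun do rewrite big_cons; exact: fockD.
Qed.

(** These are the Taylor coefficients, up to factorials, of the kernel in its parameter. The
    inequality [t^k <= k! exp t] absorbs the power into the exponential. *)
Lemma fock_dotX_kern (y : Cn R n) k a : fock (fun w => Cn_dot w y ^+ k * kern a w).
Proof.
apply: (@fock_exp_bound _ (k`!%:R) (l1norm y + l1norm a) 0); rewrite ?invr_gt0//.
  apply: entireM; last exact: entire_kern.
  apply: entireX; rewrite (_ : (fun w => _) = Cn_dot y); first exact: entire_dot.
  by apply/funext => w; rewrite Cn_dotC.
move=> w; rewrite mul0r addr0 normcM normcX mulrDl expRD mulrA.
apply: ler_pM; rewrite ?exprn_ge0 ?normc_ge0 ?normc_kern_le//.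
apply: (@le_trans _ _ ((l1norm y * l1norm w) ^+ k)).
  by rewrite lerXn2r ?nnegrE ?normc_ge0 ?mulr_ge0 ?l1norm_ge0// mulrC normc_Cn_dot.
rewrite -ler_pdivrMl ?ltr0n ?fact_gt0// mulrC.
by apply: monom_fact_le_expR; rewrite mulr_ge0 ?l1norm_ge0.
Qed.

Lemma fock_kern a : fock (kern a).
Proof.
have := fock_dotX_kern 0 0 a.
by under eq_fun do rewrite expr0 mul1r.
Qed.

Lemma fock_reproducing F a : fock F -> fock_inner F (kern a) = F a.
Proof.
move=> fF; apply: gaussian_reproducing; first by case: fF.
by apply: inner_integrable; apply: fock_memL2 => //; exact: fock_kern.
Qed.

(** The reproducing property at the point [a] itself: the squared norm is [kern a a]. *)
Lemma fock_norm_kern a : fock_norm (kern a) = expR (Cn_sqnorm a / 2).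
Proof.
apply/eqP; rewrite -(@eqrXn2 _ 2)// ?fock_norm_ge0 ?expR_ge0//; apply/eqP.
have := fock_inner_norm (fock_memL2 (fock_kern a)).
rewrite (fock_reproducing a (fock_kern a)) {1}/kern -Cn_sqnorm_dot cexp_real => -[<-].
by rewrite -expRM_natl mulr_natl -mulr_natr divfK.
Qed.

Lemma fock_point F a : fock F -> normc (F a) <= fock_norm F * expR (Cn_sqnorm a / 2).
Proof.
move=> fF; rewrite -(fock_reproducing a fF) -fock_norm_kern.
exact: (fock_CauchySchwarz (fock_memL2 fF) (fock_memL2 (fock_kern a))).
Qed.

(** A square integrable majorant of the Taylor remainders of the kernels, uniform in the increment
    and in the order. *)
Definition expl1 (A : R) w : C := ((expR (A * l1norm w))%:C)%C.

Lemma memL2_expl1 A : memL2 (expl1 A).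
Proof.
apply: (@memL2_exp_bound _ 1 A 0); rewrite ?invr_gt0//; last first.
  by move=> w; rewrite mul0r addr0 mul1r normc_real ger0_norm ?expR_ge0.
apply: cmeasurable_real; apply: measurableT_comp => //.
by apply: measurable_funM => //; exact: measurable_l1norm.
Qed.

Definition kern_taylor (N : nat) z h w : C :=
  \sum_(j < N) (j`!%:R^-1 * (Cn_dot w (Cn_conj h) ^+ j * kern z w)).

Lemma fock_kern_taylor N z h : fock (kern_taylor N z h).
Proof. by apply: fock_sum => j; apply: fockZ; exact: fock_dotX_kern. Qed.

(** Write |h| |w| as (|h| / 2S) (2S |w|). Then [t^N / N! <= exp t] with t = 2S |w| trades the
    factorial for a geometric factor of ratio at most 1/2. The exponent [3 S] is this [2 S] plus the
    [S] coming from exp(|h| |w|). *)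
Lemma kern_taylor_remainder N z h (S : R) : 0 < S -> l1norm h <= S ->
  fock_norm (fun w => kern (z + h) w - kern_taylor N z h w) <=
    (l1norm h / (2 * S)) ^+ N * fock_norm (expl1 (3 * S + l1norm z)).
Proof.
move=> S0 hS.
have hS0 : 0 <= l1norm h / (2 * S) by rewrite divr_ge0 ?l1norm_ge0// mulr_ge0// ltW.
apply: fock_norm_le; rewrite ?exprn_ge0//; last 1 first.
- move=> w; rewrite normc_real ger0_norm ?expR_ge0//.
  set u := Cn_dot w (Cn_conj h).
  have -> : kern (z + h) w - kern_taylor N z h w = (cexp u - cexp_sum N u) * kern z w.
    rewrite /kern Cn_conjD Cn_dotDr cexpD mulrC mulrBl; congr (_ - _).
    rewrite /kern_taylor /cexp_sum mulr_suml; apply: eq_bigr => j _.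
    by rewrite mulrA [_^-1 * _]mulrC.
  have uh : normc u <= l1norm h * l1norm w.
    by rewrite (le_trans (normc_Cn_dot _ _))// l1norm_conj mulrC.
  rewrite normcM (mulrDl (3 * S)) expRD mulrA; apply: ler_pM; rewrite ?normc_ge0 ?normc_kern_le//.
  apply: (le_trans (normc_cexp_taylor _ _)).
  have h2 : normc u <= S * l1norm w.
    by rewrite (le_trans uh)// ler_wpM2r ?l1norm_ge0.
  rewrite (_ : 3 * S * _ = 2 * S * l1norm w + S * l1norm w); last by ring.
  rewrite expRD mulrA; apply: ler_pM; rewrite ?expR_ge0 ?ler_expR//.
    by rewrite divr_ge0 ?exprn_ge0 ?normc_ge0.
  apply: (@le_trans _ _ ((l1norm h / (2 * S)) ^+ N * ((2 * S * l1norm w) ^+ N / N`!%:R))).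
    rewrite mulrA -exprMn (_ : _ / _ * _ = l1norm h * l1norm w); last first.
      by field; rewrite gt_eqF.
    rewrite ler_wpM2r ?invr_ge0// lerXn2r ?nnegrE ?normc_ge0//.
    by rewrite mulr_ge0 ?l1norm_ge0.
  rewrite ler_wpM2l ?exprn_ge0//.
  by apply: monom_fact_le_expR; rewrite !mulr_ge0 ?l1norm_ge0// ltW.
- rewrite (_ : (fun _ => _) = fun w => kern (z + h) w + -1 * kern_taylor N z h w); last first.
    by apply/funext => w; rewrite mulN1r.
  apply: fock_memL2; apply: fockD; first exact: fock_kern.
  by apply: fockZ; exact: fock_kern_taylor.
- exact: memL2_expl1.
Qed.

End kernels.

(** * Analyticity of bounded antilinear functionals along the kernels *)

Section analytic_functional.
Context {R : realType} {n : nat}.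
Local Notation C := R[i].
Local Notation Re := complex.Re.
Local Notation Im := complex.Im.
Implicit Types (F G : Cn R n -> C) (z w h : Cn R n) (L : (Cn R n -> C) -> C)
  (T : (Cn R n -> C) -> Cn R n -> C).

Lemma fock_innerDr F G H : memL2 F -> memL2 G -> memL2 H ->
  fock_inner H (fun w => F w + G w) = fock_inner H F + fock_inner H G.
Proof.
move=> mF mG mH; rewrite (fock_innerJ (memL2D mF mG) mH) fock_innerDl//.
by rewrite (fock_innerJ mF mH) (fock_innerJ mG mH); exact: rmorphD.
Qed.

Lemma fock_innerZr (c : C) F H : memL2 F -> memL2 H ->
  fock_inner H (fun w => c * F w) = ((c^*)%C) * fock_inner H F.
Proof.
move=> mF mH; rewrite (fock_innerJ (memL2Z c mF) mH) fock_innerZl//.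
by rewrite (fock_innerJ mF mH); exact: rmorphM.
Qed.

(** Bounded antilinear functionals. The kernel is antiholomorphic in its parameter, so a second
    conjugation makes [L (kern z)] holomorphic in [z]. *)
Definition conj_functional L :=
  (forall (a : C) F G, fock F -> fock G ->
     L (fun z => a * F z + G z) = (a^*)%C * L F + L G) /\
  exists2 M : R, 0 <= M & forall F, fock F -> normc (L F) <= M * fock_norm F.

Lemma fock_bounded_ge0 T : fock_bounded T ->
  exists2 M : R, 0 <= M & forall F, fock F -> fock_norm (T F) <= M * fock_norm F.
Proof.
move=> [_ _ [M HM]]; exists `|M| => // F fF; apply: (le_trans (HM F fF)).
by rewrite ler_wpM2r ?fock_norm_ge0// ler_norm.
Qed.

Lemma conj_functional_inner T G : fock_bounded T -> memL2 G ->
  conj_functional (fun F => fock_inner G (T F)).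
Proof.
move=> bT mG; have [M M0 HM] := fock_bounded_ge0 bT; have [T1 T2 _] := bT.
split=> [a F1 F2 f1 f2|].
  have m1 := fock_memL2 (T1 _ f1); have m2 := fock_memL2 (T1 _ f2).
  by rewrite T2// (fock_innerDr (memL2Z a m1) m2 mG) fock_innerZr.
exists (fock_norm G * M); first by rewrite mulr_ge0 ?fock_norm_ge0.
move=> F fF; apply: (le_trans (fock_CauchySchwarz mG (fock_memL2 (T1 _ fF)))).
by rewrite -mulrA ler_wpM2l ?fock_norm_ge0// HM.
Qed.

Lemma fock_bounded_id : fock_bounded (fun F : Cn R n -> C => F).
Proof. by split=> //; exists 1 => F _; rewrite mul1r. Qed.

Section theory.
Variable L : (Cn R n -> C) -> C.
Hypothesis HL : conj_functional L.

Lemma conj_functionalD F G : fock F -> fock G -> L (fun z => F z + G z) = L F + L G.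
Proof.
move=> fF fG; have := HL.1 1 F G fF fG; rewrite conjc1 mul1r => <-.
by congr L; apply/funext => z; rewrite mul1r.
Qed.

Lemma conj_functional0 : L (fun=> 0) = 0.
Proof.
apply: (@addIr _ (L (fun=> 0))); rewrite add0r -conj_functionalD; [|exact: fock0|exact: fock0].
by congr L; apply/funext => z; rewrite addr0.
Qed.

Lemma conj_functionalZ (a : C) F : fock F -> L (fun z => a * F z) = (a^*)%C * L F.
Proof.
move=> fF; have := HL.1 a F _ fF fock0; rewrite conj_functional0 addr0 => <-.
by congr L; apply/funext => z; rewrite addr0.
Qed.

Lemma conj_functionalB F G : fock F -> fock G -> L (fun z => F z - G z) = L F - L G.
Proof.
move=> fF fG; rewrite (_ : (fun z => _) = fun z => F z + -1 * G z); last first.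
  by apply/funext => z; rewrite mulN1r.
by rewrite (conj_functionalD fF (fockZ (-1) fG)) (conj_functionalZ _ fG) rmorphN rmorph1 mulN1r.
Qed.

Lemma conj_functional_sum I (r : seq I) (F : I -> Cn R n -> C) :
  (forall i, fock (F i)) -> L (fun w => \sum_(i <- r) F i w) = \sum_(i <- r) L (F i).
Proof.
move=> fF; elim: r => [|i r IH].
  by rewrite big_nil -[RHS]conj_functional0; congr L; apply/funext => w; rewrite big_nil.
rewrite big_cons -IH -conj_functionalD//; last exact: fock_sum.
by congr L; apply/funext => w; rewrite big_cons.
Qed.

Lemma conj_functional_taylor z (S : R) : 0 < S -> exists2 B : R, 0 <= B &
  forall N h, l1norm h <= S ->
  normc (L (kern (z + h)) -
    \sum_(j < N) j`!%:R^-1 * L (fun w => Cn_dot w (Cn_conj h) ^+ j * kern z w)) <=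
  (l1norm h / (2 * S)) ^+ N * B.
Proof.
move=> S0; have [M M0 HM] := HL.2.
exists (M * fock_norm (@expl1 R n (3 * S + l1norm z))); first by rewrite mulr_ge0 ?fock_norm_ge0.
move=> N h hS.
have fT := fock_kern_taylor N z h; have fK := fock_kern (z + h).
have -> : \sum_(j < N) j`!%:R^-1 * L (fun w => Cn_dot w (Cn_conj h) ^+ j * kern z w) =
    L (kern_taylor N z h).
  rewrite conj_functional_sum; last by move=> j; apply: fockZ; exact: fock_dotX_kern.
  apply: eq_bigr => j _; rewrite conj_functionalZ; last exact: fock_dotX_kern.
  by rewrite fmorphV/= rmorph_nat.
rewrite -conj_functionalB//.
have fB : fock (fun w => kern (z + h) w - kern_taylor N z h w).
  rewrite (_ : (fun _ => _) = fun w => kern (z + h) w + -1 * kern_taylor N z h w).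
    exact: (fockD fK (fockZ (-1) fT)).
  by apply/funext => w; rewrite mulN1r.
apply: (le_trans (HM _ fB)); rewrite mulrCA ler_wpM2l//.
exact: kern_taylor_remainder.
Qed.

(** The expansion of order 2 with [S = 1]: its linear term is the derivative, whose coordinates are
    the values of [L] at [w_j * kern z w]. *)
Theorem conj_functional_entire : entire (fun z => L (kern z)).
Proof.
apply/entireP => z.
pose e_ j w : C := w ord0 j * kern z w.
have fe j : fock (e_ j).
  have := fock_dotX_kern (delta_mx ord0 j) 1 z.
  rewrite (_ : (fun w => _) = e_ j)//; apply/funext => w; rewrite /e_ expr1; congr (_ * _).
  rewrite /Cn_dot (bigD1 j)//= big1 ?addr0; first by rewrite mxE !eqxx mulr1.
  by move=> k kj; rewrite mxE (negbTE kj) andbF mulr0.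
exists (\row_j L (e_ j)) => e e0.
have [B B0 HB] := conj_functional_taylor z ltr01.
(* The remainder is (|h| / 2)^2 B, whence the 4; the added 1 covers [B = 0]. *)
exists (Num.min 1 (4 * e / (B + 1))).
  by rewrite lt_min ltr01 divr_gt0// ?mulr_gt0// ltr_wpDl.
move=> h; rewrite le_min => /andP[h1 h2].
have := HB 2%N h h1; rewrite !big_ord_recl big_ord0 /= addr0.
rewrite invr1 !mul1r opprD addrA.
have -> : (fun w => Cn_dot w (Cn_conj h) ^+ 0 * kern z w) = kern z.
  by apply/funext => w; rewrite expr0 mul1r.
have -> : L (fun w => Cn_dot w (Cn_conj h) ^+ bump 0 0 * kern z w) = Cn_dot (\row_j L (e_ j)) h.
  rewrite (_ : (fun w => _) = fun w => \sum_j (((h ord0 j)^*)%C * e_ j w)); last first.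
    apply/funext => w; rewrite expr1 mulr_suml; apply: eq_bigr => j _.
    by rewrite /e_ mxE mulrCA mulrA.
  rewrite conj_functional_sum; last by move=> j; exact: fockZ.
  by apply: eq_bigr => j _; rewrite conj_functionalZ// conjcK mxE mulrC.
move=> H; apply: (le_trans H).
rewrite mulr1 exprMn expr2 -!mulrA [leRHS]mulrC ler_wpM2l ?l1norm_ge0//.
have B1 : 0 < B + 1 by rewrite ltr_wpDl.
have h3 : l1norm h * (B + 1) <= 4 * e by rewrite -ler_pdivlMr.
have := l1norm_ge0 h.
nra.
Qed.

End theory.

(* Vanishing on ]0, 1] kills all coefficients, and the remainder at ['i] tends to 0. *)
Lemma power_series_real_zero (f : C -> C) (c : nat -> C) (B : R) : 0 <= B ->
  (forall N (s : C), normc s <= 1 ->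
     normc (f s - \sum_(j < N) c j * s ^+ j) <= (normc s / 2) ^+ N * B) ->
  (forall t : R, 0 < t <= 1 -> f (t%:C)%C = 0) -> f ('i)%C = 0.
Proof.
move=> B0 H f0.
have c0 k : c k = 0.
  elim/ltn_ind: k => k IH.
  apply: eq0_normc; apply/eqP; rewrite eq_le normc_ge0 andbT.
  apply/ler_addgt0Pr => e e0; rewrite add0r.
  (* The lower coefficients being 0, the estimate of order [k + 1] reads |c_k| t^k <= (t / 2)^(k+1)
     B, so that |c_k| <= t (B + 1) <= e. *)
  pose t := Num.min 1 (e / (B + 1)).
  have B1 : 0 < B + 1 by rewrite ltr_wpDl.
  have t0 : 0 < t by rewrite lt_min ltr01 divr_gt0.
  have t1 : t <= 1 by rewrite ge_min lexx.
  have te : t * (B + 1) <= e by rewrite -ler_pdivlMr// ge_min lexx orbT.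
  have nt : normc ((t%:C)%C) = t by rewrite normc_real ger0_norm// ltW.
  have := H k.+1 (t%:C)%C; rewrite nt => /(_ t1).
  rewrite f0 ?t0// sub0r normcN big_ord_recr /= big1 ?add0r; last first.
    by move=> j _; rewrite IH// mul0r.
  rewrite normcM normcX nt => h.
  have tk : 0 < t ^+ k by rewrite exprn_gt0.
  rewrite -(ler_pM2r tk) (le_trans h)// exprMn exprS -!mulrA.
  rewrite [e * _]mulrC [t * _]mulrCA ler_wpM2l ?(ltW tk)//.
  have p1 : (2^-1 : R) ^+ k.+1 * B <= B + 1.
    apply: (@le_trans _ _ B); last by rewrite lerDl.
    by rewrite -[leRHS]mul1r ler_wpM2r// exprn_ile1// ?invr_ge0// invf_le1// ler1n.
  apply: le_trans te; by rewrite ler_wpM2l// ltW.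
apply: eq0_normc; apply/eqP; rewrite eq_le normc_ge0 andbT.
have ni : normc ('i%C : C) = 1 by rewrite /normc expr0n add0r expr1n sqrtr1.
have h N : normc (f ('i)%C) <= 2^-1 ^+ N * B.
  have := H N ('i)%C; rewrite ni lexx => /(_ isT).
  by rewrite big1 ?subr0 ?mul1r// => j _; rewrite c0 mul0r.
have cv : (fun N : nat => 2^-1 ^+ N * B) @ \oo --> (0 * B : R).
  apply: cvgM; last exact: cvg_cst.
  by apply: cvg_expr; rewrite ger0_norm ?invr_ge0// invf_lt1// ltr1n.
rewrite mul0r in cv.
rewrite -[leRHS](cvg_lim _ cv)//; apply: limr_ge; first by apply/cvg_ex; exists 0.
exact: nearW.
Qed.

(* Applied on the line [x + s y] through [z = x + 'i y], with [x] and [y] real. *)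
Theorem conj_functional_real_zero L : conj_functional L ->
  (forall x : Rn R n, L (kern (ofRn x)) = 0) -> forall z, L (kern z) = 0.
Proof.
move=> HL L0 z.
pose x : Rn R n := [tuple Re (z ord0 j) | j < n].
pose y : Rn R n := [tuple Im (z ord0 j) | j < n].
have zE : z = ofRn x + ('i)%C *: ofRn y.
  apply/rowP => j; rewrite !mxE !tnth_mktuple; case: (z ord0 j) => a b.
  by apply: complex_ext => /=; ring.
(* [S] exceeds the length of [s y] whenever |s| <= 1, and is positive even if [y = 0]. *)
pose S : R := l1norm (ofRn y) + 1.
have S0 : 0 < S by rewrite ltr_wpDl ?l1norm_ge0.
have [B B0 HB] := conj_functional_taylor HL (ofRn x) S0.
rewrite {1}zE.
apply: (@power_series_real_zero (fun s => L (kern (ofRn x + s *: ofRn y)))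
  (fun j => j`!%:R^-1 * L (fun w => Cn_dot w (Cn_conj (ofRn y)) ^+ j * kern (ofRn x) w)) B) => //.
- move=> N s s1.
  have hy : l1norm (s *: ofRn y) <= normc s * S.
    by rewrite l1normZ ler_wpM2l ?normc_ge0// lerDl.
  have hS : l1norm (s *: ofRn y) <= S.
    by rewrite (le_trans hy)// -[leRHS]mul1r ler_wpM2r// ltW.
  have := HB N _ hS.
  rewrite (eq_bigr (fun j : 'I_N => j`!%:R^-1 * L (fun w => Cn_dot w (Cn_conj (ofRn y)) ^+ j *
      kern (ofRn x) w) * s ^+ j)); last first.
    move=> j _; rewrite -mulrA; congr (_ * _).
    rewrite (_ : (fun w => _) = fun w => ((s ^+ j)^*)%C * (Cn_dot w (Cn_conj (ofRn y)) ^+ j *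
      kern (ofRn x) w)); last first.
      by apply/funext => w; rewrite Cn_conjZ Cn_dotZr exprMn rmorphXn mulrA.
    rewrite (conj_functionalZ HL); last exact: fock_dotX_kern.
    by rewrite conjcK mulrC.
  move=> h; apply: (le_trans h); rewrite ler_wpM2r//.
  rewrite lerXn2r ?nnegrE ?divr_ge0 ?normc_ge0 ?l1norm_ge0 ?mulr_ge0 ?(ltW S0)//.
  by rewrite ler_pdivrMr ?mulr_gt0// mulrA divfK.
- move=> t _.
  rewrite (_ : _ + _ = ofRn [tuple tnth x j + t * tnth y j | j < n]); first exact: L0.
  by apply/rowP => j; rewrite !mxE !tnth_mktuple; apply: complex_ext => /=; ring.
Qed.

End analytic_functional.

(** * The kernel of S_phi and its adjoint *)

Section fkernel.
Context {R : realType} {n : nat}.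
Local Notation C := R[i].
Local Notation Re := complex.Re.
Local Notation Im := complex.Im.
Local Notation RRn := (Rn R n * Rn R n)%type.
Local Notation gamma := (@gaussian R n).
Implicit Types (phi F G : Cn R n -> C) (z w h : Cn R n).

Definition fkernel phi z w : C := cexp (Cn_dot z (Cn_conj w)) * phi (z - Cn_conj w).

Definition conj_refl phi z : C := ((phi (- Cn_conj z))^*)%C.

Lemma conjc_mul (a b : C) : ((a * b)^*)%C = (a^*)%C * (b^*)%C.
Proof. exact: rmorphM. Qed.

Lemma fkernel_conj_refl phi z w : fkernel (conj_refl phi) z w = ((fkernel phi w z)^*)%C.
Proof.
rewrite /fkernel conjc_mul -cexpJ Cn_dot_conj Cn_conjK Cn_dotC; congr (_ * _).
by rewrite /conj_refl Cn_conjB Cn_conjK opprB.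
Qed.

Lemma S_integrandE phi F z w : S_integrand phi F z w = F w * fkernel phi z w.
Proof. by rewrite /S_integrand mulrA. Qed.

Lemma fkernel1 z w : fkernel (fun=> 1) z w = kern w z.
Proof. by rewrite /fkernel mulr1. Qed.

Lemma entire_fkernel phi w : entire phi -> entire (fun z => fkernel phi z w).
Proof.
by move=> ephi; apply: entireM; [exact: entire_kern|exact: entire_shift].
Qed.

Lemma entire_fkernel_conj phi z : entire phi -> entire (fun w => ((fkernel phi z w)^*)%C).
Proof.
move=> ephi; under eq_fun do rewrite -fkernel_conj_refl.
exact/entire_fkernel/entire_conj_refl.
Qed.

Lemma Cn_sqnorm_subconj z w :
  Cn_sqnorm (z - Cn_conj w) <= Cn_sqnorm z + 2 * (l1norm z * l1norm w) + Cn_sqnorm w.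
Proof.
apply: (@le_trans _ _ (\sum_j (normc (z ord0 j) ^+ 2 +
    2 * (normc (z ord0 j) * l1norm w) + normc (w ord0 j) ^+ 2))).
  apply: ler_sum => j _.
  apply: (@le_trans _ _ ((normc (z ord0 j) + normc (w ord0 j)) ^+ 2)).
    rewrite lerXn2r ?nnegrE ?addr_ge0 ?normc_ge0// !mxE.
    by rewrite (le_trans (normcB_le _ _))// normc_conj.
  rewrite sqrrD lerD2r lerD2l -mulr_natl ler_wpM2l// ler_wpM2l ?normc_ge0//.
  exact: normc_le_l1norm.
by rewrite !big_split/= -mulr_sumr -mulr_suml.
Qed.

(** Point evaluation controls [phi] at [z - conj w]. The coefficient 2 of the mixed term collects 1
    from the exponential factor and 1 from half the mixed term of |z - conj w|^2. *)
Lemma fkernel_bound phi z w : fock phi ->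
  normc (fkernel phi z w) <= fock_norm phi *
    expR (2 * l1norm z * l1norm w + Cn_sqnorm z / 2 + Cn_sqnorm w / 2).
Proof.
move=> fphi; rewrite normcM.
apply: (le_trans (ler_pM (normc_ge0 _) (normc_ge0 _) (normc_kern_le w z)
  (fock_point (z - Cn_conj w) fphi))).
rewrite mulrCA -expRD ler_wpM2l ?fock_norm_ge0// ler_expR.
by have := Cn_sqnorm_subconj z w; lra.
Qed.

Lemma cmeasurable_cexp d (T : measurableType d) (f : T -> C) :
  cmeasurable f -> cmeasurable (fun t => cexp (f t)).
Proof.
move=> [fr fi]; under eq_fun do rewrite cexpE.
split => /=; apply: measurable_funM; try exact: measurableT_comp.
- exact: (measurableT_comp (continuous_measurable_fun (@continuous_cos R))).
- exact: (measurableT_comp (continuous_measurable_fun (@continuous_sin R))).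
Qed.

Definition measurable_Cn d (T : measurableType d) (X : T -> Cn R n) :=
  forall j, cmeasurable (fun t => X t ord0 j).

Lemma measurable_Cn_fkernel d (T : measurableType d) (X Y : T -> Cn R n) phi :
  entire phi -> measurable_Cn X -> measurable_Cn Y ->
  cmeasurable (fun t => fkernel phi (X t) (Y t)).
Proof.
move=> ephi mX mY; apply: cmeasurableM.
  apply: cmeasurable_cexp; split.
    under eq_fun do rewrite /Cn_dot cRe_sum.
    apply: measurable_sum => j; apply: (cmeasurableM (mX j) _).1.
    by under eq_fun do rewrite mxE; exact: cmeasurableJ.
  under eq_fun do rewrite /Cn_dot cIm_sum.
  apply: measurable_sum => j; apply: (cmeasurableM (mX j) _).2.
  by under eq_fun do rewrite mxE; exact: cmeasurableJ.
have mXY : measurable_Cn (fun t => X t - Cn_conj (Y t)).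
  move=> j; under eq_fun do rewrite !mxE -mulN1r.
  apply: cmeasurableD => //; apply: cmeasurableM; first exact: cmeasurable_cst.
  exact: cmeasurableJ.
by apply: (entire_cmeasurable ephi) => j; have [] := mXY j.
Qed.

Lemma measurable_Cn_fst : measurable_Cn (fun x : RRn * RRn => toCn x.1).
Proof.
move=> j; split.
  exact: (measurableT_comp (measurable_Re_toCn j) measurable_fst).
exact: (measurableT_comp (measurable_Im_toCn j) measurable_fst).
Qed.

Lemma measurable_Cn_snd : measurable_Cn (fun x : RRn * RRn => toCn x.2).
Proof.
move=> j; split.
  exact: (measurableT_comp (measurable_Re_toCn j) measurable_snd).
exact: (measurableT_comp (measurable_Im_toCn j) measurable_snd).
Qed.

Lemma cmeasurable_fst (f : RRn -> C) : cmeasurable f -> cmeasurable (fun x : RRn * RRn => f x.1).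
Proof.
by move=> [f1 f2]; split; [exact: (measurableT_comp f1)|exact: (measurableT_comp f2)].
Qed.

Lemma cmeasurable_snd (f : RRn -> C) : cmeasurable f -> cmeasurable (fun x : RRn * RRn => f x.2).
Proof.
by move=> [f1 f2]; split; [exact: (measurableT_comp f1)|exact: (measurableT_comp f2)].
Qed.

End fkernel.

(** * Projections of bounded functions, and the kernel as an image of [kern] *)

Section projection.
Context {R : realType} {n : nat}.
Local Notation C := R[i].
Local Notation RRn := (Rn R n * Rn R n)%type.
Local Notation gamma := (@gaussian R n).
Implicit Types (phi F G : Cn R n -> C) (z w : Cn R n).

Lemma kernJ a w : ((kern a w)^*)%C = @kern R n w a.
Proof. by rewrite /kern -cexpJ Cn_dot_conj Cn_conjK Cn_dotC. Qed.

(* [kern w] is the square of [kern (w / 2)], whose norm is known. *)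
Lemma integral_normc_kern w :
  (\int[gamma]_p (normc (kern w (toCn p)))%:E = (expR (Cn_sqnorm w / 4))%:E)%E.
Proof.
pose v : Cn R n := ((2^-1 : R)%:C)%C *: w.
transitivity (fock_sqnorm (kern v)).
  apply: eq_integral => p _; congr EFin; rewrite -normcX expr2 /kern -cexpD; congr (normc (cexp _)).
  rewrite /v Cn_conjZ Cn_dotZr -mulrDl.
  rewrite (_ : _ + _ = 1) ?mul1r//; apply: complex_ext => /=; first by lra.
  by rewrite oppr0 addr0.
rewrite -(fock_norm_sqr (fock_memL2 (fock_kern v))) fock_norm_kern; congr EFin.
rewrite -expRM_natl; congr expR; rewrite /v Cn_sqnormZ.
rewrite normc_real ger0_norm ?invr_ge0//; by field.
Qed.

Lemma integral_exp_lty (B A c : R) : 0 <= B -> c < 1 ->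
  (\int[gamma]_p (B * expR (A * l1norm (toCn p) + c * Cn_sqnorm (toCn p)))%:E < +oo)%E.
Proof.
move=> B0 c1; have /integrableP[m h] := @integrable_gaussian_exp R n A c c1.
under eq_integral do rewrite EFinM.
rewrite ge0_integralZl//.
rewrite lte_mul_pinfty//.
rewrite [ltLHS](_ : _ = \int[gamma]_p `|(expR (A * l1norm (toCn p) + c * Cn_sqnorm (toCn p)))%:E|)%E//.
by apply: eq_integral => p _; rewrite gee0_abs// lee_fin expR_ge0.
Qed.

Section bounded_function.
Variables (G : Cn R n -> C) (r : R).
Hypotheses (mG : cmeasurable (fun p => G (toCn p))) (Gr : forall w, normc (G w) <= r).

Lemma memL2_bounded : memL2 G.
Proof.
have h0 : (0 : R) < 2^-1 by rewrite invr_gt0.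
apply: (@memL2_exp_bound _ _ _ r 0 0 mG h0) => w.
by rewrite !mul0r addr0 expR0 mulr1.
Qed.

Definition fock_proj w : C := fock_inner G (kern w).

(** Bounding [G] by [r] leaves the integral of |kern w|, of exponent 1/4. Cauchy-Schwarz would only
    give 1/2, and this gain is what makes the exchange of integrals possible. *)
Lemma fock_proj_bound w : normc (fock_proj w) <= r * expR (Cn_sqnorm w / 4).
Proof.
have r0 : 0 <= r by apply: le_trans (Gr 0); exact: normc_ge0.
rewrite -lee_fin.
apply: (le_trans (normc_cintegral (inner_integrable memL2_bounded (fock_memL2 (fock_kern w))))).
rewrite EFinM -integral_normc_kern -ge0_integralZl//; last first.
- by move=> p _; rewrite lee_fin normc_ge0.
- by apply: emeasurable_normc; exact: (entire_cmeasurable_toCn (entire_kern w)).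
apply: ge0_le_integral => //.
- by move=> p _; rewrite lee_fin normc_ge0.
- apply: emeasurable_normc; apply: cmeasurableM => //; apply: cmeasurableJ.
  exact: (entire_cmeasurable_toCn (entire_kern w)).
- apply: measurable_funeM; apply: emeasurable_normc.
  exact: (entire_cmeasurable_toCn (entire_kern w)).
- move=> p _; rewrite -EFinM lee_fin normcM normc_conj ler_wpM2r ?normc_ge0//.
Qed.

Lemma fock_fock_proj : fock fock_proj.
Proof.
apply: (@fock_exp_bound _ _ _ r 0 4^-1).
- exact: conj_functional_entire (conj_functional_inner fock_bounded_id memL2_bounded).
- by rewrite ltf_pV2 ?posrE// ltr_nat.
- by move=> w; rewrite mul0r add0r [4^-1 * _]mulrC; exact: fock_proj_bound.
Qed.

End bounded_function.

Section adjoint_kernel.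
Variable phi : Cn R n -> C.
Hypotheses (fphi : fock phi) (Sphi : S_bounded phi).
Let ephi : entire phi := fphi.1.

(** The kernel is antiholomorphic in its second variable, so the conjugate integrand is an entire
    function times the conjugate of [kern a]. Its integrability is the convergence clause of
    [S_bounded]. *)
Lemma S_op_kern a : S_op phi (kern a) = fun z => fkernel phi z a.
Proof.
apply/funext => z.
have ih := Sphi.1 (kern a) z (fock_kern a).
pose f w := ((fkernel phi z w)^*)%C.
have E : S_integrand phi (kern a) z = fun w => ((f w * ((kern a w)^*)%C)^*)%C.
  by apply/funext => w; rewrite conjc_mul /f !conjcK S_integrandE mulrC.
have ih' : gaussian_integrable (fun w => f w * ((kern a w)^*)%C).
  have := cintegrableJ ih; rewrite E.
  by under eq_fun do rewrite conjcK.
rewrite /S_op E /gaussian_integral cintegralJ.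
have := gaussian_reproducing (entire_fkernel_conj z ephi) ih'.
by rewrite /gaussian_integral => ->; rewrite /f conjcK.
Qed.

Lemma fock_fkernel a : fock (fun z => fkernel phi z a).
Proof. by rewrite -S_op_kern; have [_ [h _ _]] := Sphi; apply: h; exact: fock_kern. Qed.

Lemma S_op_conj_refl F z : S_op (conj_refl phi) F z = fock_inner F (S_op phi (kern z)).
Proof.
rewrite S_op_kern; apply: eq_cintegral => p.
by rewrite S_integrandE fkernel_conj_refl.
Qed.

Lemma S_integrable_conj_refl F z : fock F ->
  gaussian_integrable (S_integrand (conj_refl phi) F z).
Proof.
move=> fF; have := inner_integrable (fock_memL2 fF) (fock_memL2 (fock_fkernel z)).
by under eq_fun do rewrite -fkernel_conj_refl -S_integrandE.
Qed.

Lemma entire_S_op_conj_refl F : fock F -> entire (S_op (conj_refl phi) F).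
Proof.
move=> fF; rewrite (_ : S_op _ F = fun z => fock_inner F (S_op phi (kern z))).
  exact: (conj_functional_entire (conj_functional_inner Sphi.2 (fock_memL2 fF))).
by apply/funext => z; exact: S_op_conj_refl.
Qed.

End adjoint_kernel.

End projection.

Section projection_fubini.
Context {R : realType} {n : nat}.
Local Notation C := R[i].
Local Notation RRn := (Rn R n * Rn R n)%type.
Local Notation gamma := (@gaussian R n).
Implicit Types (F : Cn R n -> C) (z w a : Cn R n).

Lemma cmeasurable_kern a : cmeasurable (fun p : RRn => kern a (toCn p)).
Proof. exact: entire_cmeasurable_toCn (entire_kern a). Qed.

Lemma cmeasurable_kernl a : cmeasurable (fun p : RRn => kern (toCn p) a).
Proof.
have := cmeasurableJ (cmeasurable_kern a).
by under eq_fun do rewrite kernJ.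
Qed.

Variable phi : Cn R n -> C.
Hypotheses (fphi : fock phi) (Sphi : S_bounded phi).
Let ephi : entire phi := fphi.1.

Lemma cmeasurable_fkernel z : cmeasurable (fun p : RRn => fkernel phi z (toCn p)).
Proof.
have := cmeasurableJ (entire_cmeasurable_toCn (entire_fkernel_conj z ephi)).
by under eq_fun do rewrite conjcK.
Qed.

Variables (G : Cn R n -> C) (r : R).
Hypotheses (mG : cmeasurable (fun p => G (toCn p))) (Gr : forall w, normc (G w) <= r).

Let r0 : 0 <= r. Proof. by apply: le_trans (Gr 0); exact: normc_ge0. Qed.

(** The exponent 1/2 is the growth of [fkernel phi z], and 1/4 that of the integral of |kern| left
    by the bounded [G]. *)
Let three_quarters_lt1 : 2^-1 + 4^-1 < 1 :> R. Proof. lra. Qed.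
Let half_lt1 : 2^-1 < 1 :> R. Proof. lra. Qed.

Let f z (x : RRn * RRn) : C := G (toCn x.2) * kern (toCn x.2) (toCn x.1) * fkernel phi z (toCn x.1).
Local Notation B z := (fock_norm phi * expR (Cn_sqnorm z / 2)).

Let B0 z : 0 <= B z.
Proof. by rewrite mulr_ge0 ?fock_norm_ge0 ?expR_ge0. Qed.

Let normc_f z x : normc (f z x) = normc (G (toCn x.2)) *
  normc (kern (toCn x.2) (toCn x.1)) * normc (fkernel phi z (toCn x.1)).
Proof. by rewrite /f 2!normcM. Qed.

Lemma fkernel_le z w : normc (fkernel phi z w) <= B z * expR (2 * l1norm z * l1norm w + 2^-1 * Cn_sqnorm w).
Proof.
apply: (le_trans (fkernel_bound z w fphi)).
rewrite -[leRHS]mulrA -expRD ler_wpM2l ?fock_norm_ge0// ler_expR.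
by rewrite le_eqVlt; apply/orP; left; apply/eqP; ring.
Qed.

Let mf z : cmeasurable (f z).
Proof.
have mz : measurable_Cn (fun _ : RRn * RRn => z) by move=> j; exact: cmeasurable_cst.
have mK := measurable_Cn_fkernel ephi mz (@measurable_Cn_fst R n).
have mk := measurable_Cn_fkernel (entire_cst 1) (@measurable_Cn_fst R n) (@measurable_Cn_snd R n).
have := cmeasurableM (cmeasurableM (cmeasurable_snd mG) mk) mK.
by under eq_fun do rewrite fkernel1.
Qed.

Let f_int1 z x : cintegrable gamma (fun y => f z (x, y)).
Proof.
have m1 := cmeasurableM (cmeasurableM mG (cmeasurable_kernl (toCn x)))
  (cmeasurable_cst _ (fkernel phi z (toCn x))).
apply: (@integrable_exp_bound _ _ _ (r * normc (fkernel phi z (toCn x)))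
     (l1norm (toCn x)) 0 m1 ltr01) => p.
rewrite mul0r addr0 (normc_f z (x, p)) /= [leRHS]mulrAC.
have := normc_kern_le (toCn p) (toCn x); rewrite (mulrC (l1norm (toCn p))).
have := Gr (toCn p); have := normc_ge0 (G (toCn p)).
have := normc_ge0 (kern (toCn p) (toCn x)); have := normc_ge0 (fkernel phi z (toCn x)).
move: (normc (G _)) (normc (kern _ _)) (normc (fkernel _ _ _)) (expR _).
by move=> g k K e K0 k0 g0 gr ke; rewrite ler_wpM2r// ler_pM.
Qed.

Let f_int2 z y : cintegrable gamma (fun x => f z (x, y)).
Proof.
have m1 := cmeasurableM (cmeasurableM (cmeasurable_cst _ (G (toCn y))) (cmeasurable_kern (toCn y)))
  (cmeasurable_fkernel z).
apply: (@integrable_exp_bound _ _ _ (r * B z)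
     (l1norm (toCn y) + 2 * l1norm z) 2^-1 m1 half_lt1) => p.
rewrite (normc_f z (p, y)) /= (mulrDl (l1norm (toCn y))) -(addrA (l1norm (toCn y) * _)).
rewrite expRD [leRHS]mulrACA.
have := normc_kern_le (toCn y) (toCn p).
have := Gr (toCn y); have := normc_ge0 (G (toCn y)); have := fkernel_le z (toCn p).
have := normc_ge0 (kern (toCn y) (toCn p)); have := normc_ge0 (fkernel phi z (toCn p)).
move: (normc (G _)) (normc (kern _ _)) (normc (fkernel _ _ _)) (expR _) (expR _).
move=> g k K e e' K0 k0 Ke g0 gr ke.
by rewrite ler_pM ?mulr_ge0// ler_pM.
Qed.

Let f_fin z : (\int[gamma]_x \int[gamma]_y (normc (f z (x, y)))%:E < +oo)%E.
Proof.
apply: (@le_lt_trans _ _ (\int[gamma]_x (r * B z * expR (2 * l1norm z * l1norm (toCn x) +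
     (2^-1 + 4^-1) * Cn_sqnorm (toCn x)))%:E)%E); last first.
  by apply: integral_exp_lty three_quarters_lt1; rewrite mulr_ge0.
apply: ge0_le_integral => //.
- by move=> x _; apply: integral_ge0 => y _; rewrite lee_fin normc_ge0.
- apply: (@measurable_fun_fubini_tonelli_F _ _ _ _ R gamma (fun x => (normc (f z x))%:E)).
    exact: (emeasurable_normc (mf z)).
  by move=> x; rewrite lee_fin normc_ge0.
- have [mi _] := integrableP _ _ _ (@integrable_gaussian_exp R n (2 * l1norm z) _ three_quarters_lt1).
  by apply/measurable_EFinP; apply: measurable_funM => //; apply/measurable_EFinP.
move=> x _.
apply: (@le_trans _ _ (\int[gamma]_y ((r * normc (fkernel phi z (toCn x)))%:E *
    (normc (kern (toCn x) (toCn y)))%:E))%E).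
  apply: ge0_le_integral => //.
  - by move=> y _; rewrite lee_fin normc_ge0.
  - exact: (emeasurable_normc (cintegrable_cmeasurable (f_int1 z x))).
  - exact: (measurable_funeM _ (emeasurable_normc (cmeasurable_kern (toCn x)))).
  move=> y _; rewrite -EFinM lee_fin (normc_f z (x, y)) /= -kernJ normc_conj mulrAC.
  by rewrite ler_wpM2r ?normc_ge0// ler_wpM2r ?normc_ge0.
rewrite ge0_integralZl//; last 3 first.
- exact: (emeasurable_normc (cmeasurable_kern (toCn x))).
- by move=> y _; rewrite lee_fin normc_ge0.
- by rewrite lee_fin mulr_ge0 ?normc_ge0.
rewrite integral_normc_kern -EFinM lee_fin -[leLHS]mulrA -[leRHS]mulrA ler_wpM2l//.
apply: (le_trans (ler_wpM2r (expR_ge0 _) (fkernel_le z (toCn x)))).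
rewrite -[leLHS]mulrA -expRD ler_wpM2l// ler_expR.
by rewrite le_eqVlt; apply/orP; left; apply/eqP; ring.
Qed.

(** Exchanging the integrals leaves [S_op phi (kern u)] inside, which is the kernel at [u]. Hence
    the integral operator takes the same value on [G] as on its projection. *)
Lemma S_op_fock_proj z :
  S_op phi (fock_proj G) z = gaussian_integral (fun u => G u * fkernel phi z u).
Proof.
have fub := cintegral_fubini (mf z) (f_int1 z) (f_int2 z) (f_fin z).
transitivity (cintegral gamma (fun x => cintegral gamma (fun y => f z (x, y)))).
  apply: eq_cintegral => p; rewrite S_integrandE mulrC.
  have ip : cintegrable gamma (fun y => G (toCn y) * ((kern (toCn p) (toCn y))^*)%C).
    exact: (inner_integrable (memL2_bounded mG Gr) (fock_memL2 (fock_kern (toCn p)))).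
  rewrite -[fock_proj G _]/(cintegral gamma (fun y => G (toCn y) * ((kern (toCn p) (toCn y))^*)%C)).
  rewrite -(cintegralZ _ ip); apply: eq_cintegral => y; rewrite /f /= kernJ.
  by rewrite mulrC.
rewrite fub; apply: eq_cintegral => u.
have := congr1 (fun g => g z) (S_op_kern fphi Sphi (toCn u)) => /= <-.
rewrite -cintegralZ; last exact: (Sphi.1 _ z (fock_kern (toCn u))).
by apply: eq_cintegral => p; rewrite S_integrandE /f /= mulrA.
Qed.

End projection_fubini.

(** * Exchange of integrals in the pairing with a bounded function *)

Section adjoint_fubini.
Context {R : realType} {n : nat}.
Local Notation C := R[i].
Local Notation RRn := (Rn R n * Rn R n)%type.
Local Notation gamma := (@gaussian R n).
Implicit Types (z w a : Cn R n).

Variable phi : Cn R n -> C.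
Hypotheses (fphi : fock phi) (Sphi : S_bounded phi).
Let ephi : entire phi := fphi.1.
Variables (G : Cn R n -> C) (r : R).
Hypotheses (mG : cmeasurable (fun p => G (toCn p))) (Gr : forall w, normc (G w) <= r).
Variable F : Cn R n -> C.
Hypothesis fF : fock F.

Let r0 : 0 <= r. Proof. by apply: le_trans (Gr 0); exact: normc_ge0. Qed.
Let half_lt1 : 2^-1 < 1 :> R. Proof. lra. Qed.

Let g (x : RRn * RRn) : C :=
  F (toCn x.2) * ((fkernel phi (toCn x.2) (toCn x.1))^*)%C * ((G (toCn x.1))^*)%C.

Let normc_g x : normc (g x) = normc (F (toCn x.2)) *
  normc (fkernel phi (toCn x.2) (toCn x.1)) * normc (G (toCn x.1)).
Proof. by rewrite /g 2!normcM 2!normc_conj. Qed.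

Let mF : cmeasurable (fun p : RRn => F (toCn p)) := (fock_memL2 fF).1.

Let mg : cmeasurable g.
Proof.
have mK := measurable_Cn_fkernel ephi (@measurable_Cn_snd R n) (@measurable_Cn_fst R n).
exact: (cmeasurableM (cmeasurableM (cmeasurable_snd mF) (cmeasurableJ mK))
  (cmeasurableJ (cmeasurable_fst mG))).
Qed.

Let g_int1 x : cintegrable gamma (fun y => g (x, y)).
Proof.
have := cintegrableZ ((G (toCn x))^*)%C
  (inner_integrable (fock_memL2 fF) (fock_memL2 (fock_fkernel fphi Sphi (toCn x)))).
by under eq_fun do rewrite mulrC.
Qed.

Let g_int2 y : cintegrable gamma (fun x => g (x, y)).
Proof.
have m1 := cmeasurableM (cmeasurableM (cmeasurable_cst _ (F (toCn y)))
  (cmeasurableJ (cmeasurable_fkernel fphi (toCn y)))) (cmeasurableJ mG).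
apply: (@integrable_exp_bound _ _ _
  (normc (F (toCn y)) * (fock_norm phi * expR (Cn_sqnorm (toCn y) / 2)) * r)
  (2 * l1norm (toCn y)) 2^-1 m1 half_lt1) => p.
rewrite (normc_g (p, y)) /= [leRHS]mulrAC -[in leRHS]mulrA.
have := Gr (toCn p); have := normc_ge0 (G (toCn p)).
have := fkernel_le fphi (toCn y) (toCn p).
have := normc_ge0 (F (toCn y)); have := normc_ge0 (fkernel phi (toCn y) (toCn p)).
move: (normc (F _)) (normc (G _)) (normc (fkernel _ _ _)) (expR (2 * _ * _ + _)) (fock_norm phi * _).
move=> a b K e c K0 a0 Ke b0 br.
rewrite (_ : a * c * (e * r) = a * (c * e) * r); last by ring.
by rewrite ler_pM ?mulr_ge0// ler_wpM2l.
Qed.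

(** Cauchy-Schwarz in the variable of [F] gives the norm of [S_op phi (kern x)], at most
    [M exp(|x|^2 / 2)] by boundedness. As [G] is bounded, the outer integral keeps the exponent
    1/2. *)
Let g_fin : (\int[gamma]_x \int[gamma]_y (normc (g (x, y)))%:E < +oo)%E.
Proof.
have [M M0 HM] := fock_bounded_ge0 Sphi.2.
have c0 : 0 <= r * (fock_norm F * M) by rewrite !mulr_ge0 ?fock_norm_ge0.
have := @integral_exp_lty R n (r * (fock_norm F * M)) 0 2^-1 c0 half_lt1.
apply: le_lt_trans; apply: ge0_le_integral => //.
- by move=> x _; apply: integral_ge0 => y _; rewrite lee_fin normc_ge0.
- apply: (@measurable_fun_fubini_tonelli_F _ _ _ _ R gamma (fun x => (normc (g x))%:E)).
    exact: (emeasurable_normc mg).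
  by move=> x; rewrite lee_fin normc_ge0.
- have [mi _] := integrableP _ _ _ (@integrable_gaussian_exp R n 0 _ half_lt1).
  by apply/measurable_EFinP; apply: measurable_funM => //; apply/measurable_EFinP.
move=> x _; rewrite mul0r add0r.
have mK : memL2 (fun z => fkernel phi z (toCn x)) := fock_memL2 (fock_fkernel fphi Sphi (toCn x)).
have h1 := fock_CauchySchwarz_abs (fock_memL2 fF) mK.
have h2 : fock_norm (fun z => fkernel phi z (toCn x)) <= M * expR (2^-1 * Cn_sqnorm (toCn x)).
  rewrite -(S_op_kern fphi Sphi (toCn x)) [2^-1 * _]mulrC -fock_norm_kern.
  exact: HM _ (fock_kern _).
apply: (@le_trans _ _ (\int[gamma]_y (r%:E *
    (normc (F (toCn y)) * normc (fkernel phi (toCn y) (toCn x)))%:E))%E).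
  apply: ge0_le_integral => //.
  - by move=> y _; rewrite lee_fin normc_ge0.
  - exact: (emeasurable_normc (cintegrable_cmeasurable (g_int1 x))).
  - apply: measurable_funeM; apply/measurable_EFinP; apply: measurable_funM.
      exact: (measurable_normc mF).
    exact: (measurable_normc mK.1).
  move=> y _; rewrite -EFinM lee_fin (normc_g (x, y)) /= [leRHS]mulrC.
  by rewrite ler_wpM2l// mulr_ge0 ?normc_ge0.
rewrite ge0_integralZl//; last 2 first.
- apply/measurable_EFinP; apply: measurable_funM; first exact: (measurable_normc mF).
  exact: (measurable_normc mK.1).
- by move=> y _; rewrite lee_fin mulr_ge0 ?normc_ge0.
rewrite -[in leRHS]mulrA EFinM; apply: lee_wpmul2l; first by rewrite lee_fin.
apply: (le_trans h1); rewrite lee_fin -mulrA ler_wpM2l ?fock_norm_ge0//.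
Qed.

Lemma fock_inner_fock_proj :
  fock_inner (S_op (conj_refl phi) F) G = fock_inner F (S_op phi (fock_proj G)).
Proof.
have fub := cintegral_fubini mg g_int1 g_int2 g_fin.
transitivity (cintegral gamma (fun x => cintegral gamma (fun y => g (x, y)))).
  apply: eq_cintegral => x; rewrite /S_op mulrC.
  have ip := S_integrable_conj_refl fphi Sphi (toCn x) fF.
  rewrite -(cintegralZ _ ip); apply: eq_cintegral => y.
  by rewrite S_integrandE fkernel_conj_refl mulrC.
rewrite fub; apply: eq_cintegral => y.
rewrite (S_op_fock_proj fphi Sphi mG Gr).
have ip : cintegrable gamma (fun x => G (toCn x) * fkernel phi (toCn y) (toCn x)).
  apply: (@integrable_exp_bound _ _ _ (r * (fock_norm phi * expR (Cn_sqnorm (toCn y) / 2)))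
    (2 * l1norm (toCn y)) 2^-1 _ half_lt1).
    exact: (cmeasurableM mG (cmeasurable_fkernel fphi (toCn y))).
  move=> p; rewrite (normcM (G (toCn p)) (fkernel phi (toCn y) (toCn p))).
  have := fkernel_le fphi (toCn y) (toCn p); have := Gr (toCn p).
  have := normc_ge0 (G (toCn p)); have := normc_ge0 (fkernel phi (toCn y) (toCn p)).
  move: (normc (G _)) (normc (fkernel _ _ _)) (expR (2 * _ * _ + _)) (fock_norm phi * _).
  by move=> a K e c K0 a0 ar Ke; rewrite -mulrA ler_pM.
rewrite /gaussian_integral -cintegralJ -(cintegralZ _ (cintegrableJ ip)).
apply: eq_cintegral => x; rewrite /g /=.
move: (F (toCn y)) (fkernel phi (toCn y) (toCn x)) (G (toCn x)) => a b c.
by rewrite conjc_mul -mulrA [_ * (c^*)%C]mulrC.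
Qed.

End adjoint_fubini.

(** * Approximation by truncation *)

Section truncation.
Context {R : realType} {n : nat}.
Local Notation C := R[i].
Local Notation RRn := (Rn R n * Rn R n)%type.
Local Notation gamma := (@gaussian R n).
Implicit Types (F G : Cn R n -> C) (z w a : Cn R n) (k : nat).

Lemma memL2B F G : memL2 F -> memL2 G -> memL2 (fun w => F w - G w).
Proof.
move=> mF mG; have := memL2D mF (memL2Z (-1) mG).
by under eq_fun do rewrite mulN1r.
Qed.

Lemma fock_innerBr F G H : memL2 F -> memL2 G -> memL2 H ->
  fock_inner H (fun w => F w - G w) = fock_inner H F - fock_inner H G.
Proof.
move=> mF mG mH; have := fock_innerDr mF (memL2Z (-1) mG) mH.
have -> : fock_inner H (fun w => -1 * G w) = - fock_inner H G.
  by rewrite (fock_innerZr (-1) mG mH) -[RHS]mulN1r; congr (_ * _); rewrite rmorphN rmorph1.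
by under eq_fun do rewrite mulN1r.
Qed.

(** Large values become 0 instead of being clipped: [trunc k F] and [F - trunc k F] have disjoint
    supports, which gives Pythagoras' identity and makes the inner product of [F] with its
    truncation the squared norm of the latter. *)
Definition trunc k F w : C := if normc (F w) <= k%:R then F w else 0.

Lemma normc_trunc k F w : normc (trunc k F w) <= k%:R.
Proof. by rewrite /trunc; case: ifPn => // _; rewrite normc0. Qed.

Lemma cmeasurable_trunc k F : cmeasurable (fun p : RRn => F (toCn p)) ->
  cmeasurable (fun p : RRn => trunc k F (toCn p)).
Proof.
move=> mF; have mb : measurable_fun setT (fun p : RRn => normc (F (toCn p)) <= k%:R).
  by apply: measurable_fun_ler; [exact: measurable_normc|exact: measurable_cst].
have [mr mi] := mF; split.
  rewrite (_ : (fun p => _) = fun p => if normc (F (toCn p)) <= k%:R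
    then complex.Re (F (toCn p)) else 0); first exact: measurable_fun_ifT.
  by apply/funext => p; rewrite /trunc; case: ifPn.
rewrite (_ : (fun p => _) = fun p => if normc (F (toCn p)) <= k%:R
  then complex.Im (F (toCn p)) else 0); first exact: measurable_fun_ifT.
by apply/funext => p; rewrite /trunc; case: ifPn.
Qed.

Lemma memL2_trunc k F : cmeasurable (fun p : RRn => F (toCn p)) -> memL2 (trunc k F).
Proof.
by move=> mF; apply: (memL2_bounded (cmeasurable_trunc k mF)); exact: normc_trunc.
Qed.

Lemma fock_sqnorm_trunc_cvg F : cmeasurable (fun p : RRn => F (toCn p)) ->
  fock_sqnorm (trunc k F) @[k --> \oo] --> fock_sqnorm F.
Proof.
move=> mF.
have mg k : measurable_fun setT (fun p : RRn => (normc (trunc k F (toCn p)) ^+ 2)%:E).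
  by apply: measurable_sqr_normc; exact: cmeasurable_trunc.
have g0 k (p : RRn) : setT p -> (0 <= (normc (trunc k F (toCn p)) ^+ 2)%:E)%E.
  by move=> _; rewrite lee_fin sqr_ge0.
have gle (p : RRn) : setT p ->
    {homo (fun k => (normc (trunc k F (toCn p)) ^+ 2)%:E) : i j / (i <= j)%N >-> (i <= j)%E}.
  move=> _ i j ij; rewrite lee_fin lerXn2r ?nnegrE ?normc_ge0//.
  rewrite {1}/trunc; case: ifPn => [Fi|_]; last by rewrite normc0 normc_ge0.
  by rewrite /trunc (le_trans Fi) ?ler_nat.
have := cvg_monotone_convergence (mu := gamma) measurableT mg g0 gle.
rewrite [X in _ --> X](_ : _ = fock_sqnorm F)//.
apply: eq_integral => p _; apply/cvg_lim => //.
have [k kF] : exists k, normc (F (toCn p)) <= k%:R.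
  by exists (Num.truncn (normc (F (toCn p)))).+1; rewrite ltW// truncnS_gt.
apply: cvg_near_cst; exists k => // j /= kj.
by rewrite /trunc (le_trans kF) ?ler_nat.
Qed.

(** Square integrability is a conclusion: by monotone convergence the squared norms of the
    truncations tend to that of [F], even if it is infinite. This serves for images under the
    reflected operator, known at first only to be entire. *)
Lemma memL2_trunc_bound F (c : R) : cmeasurable (fun p : RRn => F (toCn p)) ->
  (forall k, fock_norm (trunc k F) <= c) -> memL2 F /\ fock_norm F <= c.
Proof.
move=> mF Fc; have c0 : 0 <= c := le_trans (fock_norm_ge0 _) (Fc 0%N).
have h : (fock_sqnorm F <= (c ^+ 2)%:E)%E.
  have cv := fock_sqnorm_trunc_cvg mF.
  rewrite -(cvg_lim _ cv)//; apply: lime_le; first by apply/cvg_ex; exists (fock_sqnorm F).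
  apply: nearW => k; rewrite -fock_norm_sqr; last exact: memL2_trunc.
  by rewrite lee_fin lerXn2r ?nnegrE ?fock_norm_ge0.
have m2 : memL2 F by split=> //; rewrite (le_lt_trans h)// ltry.
split=> //; rewrite -(@ler_pXn2r _ 2)// ?nnegrE ?fock_norm_ge0//.
by rewrite -lee_fin fock_norm_sqr.
Qed.

Lemma fock_sqnorm_truncB k F : memL2 F ->
  fock_norm (fun w => F w - trunc k F w) ^+ 2 = fock_norm F ^+ 2 - fock_norm (trunc k F) ^+ 2.
Proof.
move=> mF; have mT := memL2_trunc k mF.1; have mB := memL2B mF mT.
apply/eqP; rewrite eq_sym subr_eq -eqe EFinD !fock_norm_sqr// /fock_sqnorm.
have m1 := measurable_sqr_normc mB.1; have m2 := measurable_sqr_normc mT.1.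
rewrite -ge0_integralD//; try by [move=> p _; rewrite lee_fin sqr_ge0].
apply/eqP; apply: eq_integral => p _; rewrite -EFinD; congr EFin.
by rewrite /trunc; case: ifPn => _; rewrite ?subrr ?subr0 normc0 expr0n ?add0r ?addr0.
Qed.

Lemma trunc_approx F (e : R) : memL2 F -> 0 < e ->
  exists k, fock_norm (fun w => F w - trunc k F w) <= e.
Proof.
move=> mF e0; have cv := fock_sqnorm_trunc_cvg mF.1.
have e2 : 0 < e ^+ 2 by rewrite exprn_gt0.
have cvR : (fun k => fock_norm (trunc k F) ^+ 2) @ \oo --> fock_norm F ^+ 2.
  have -> : (fun k => fock_norm (trunc k F) ^+ 2) = fine \o (fun k => fock_sqnorm (trunc k F)).
    by apply/funext => k; rewrite /= -fock_norm_sqr//; exact: memL2_trunc mF.1.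
  by apply: fine_cvg; rewrite fock_norm_sqr.
have /cvgrPdist_le /(_ _ e2) [k _ /(_ k (leqnn k)) h] := cvR.
exists k; rewrite -(@ler_pXn2r _ 2)// ?nnegrE ?fock_norm_ge0 ?(ltW e0)//.
by rewrite fock_sqnorm_truncB// (le_trans (ler_norm _)).
Qed.

End truncation.

(** * Boundedness of the reflected operator and the adjoint identity *)

Section adjoint.
Context {R : realType} {n : nat}.
Local Notation C := R[i].
Local Notation RRn := (Rn R n * Rn R n)%type.
Local Notation gamma := (@gaussian R n).
Implicit Types (phi F G : Cn R n -> C) (z w a : Cn R n) (k : nat).

Lemma fock_bounded_fock (T : (Cn R n -> C) -> Cn R n -> C) F :
  fock_bounded T -> fock F -> fock (T F).
Proof. by move=> [fT _ _]; exact: fT. Qed.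

Lemma fock1 : fock (fun _ : Cn R n => 1 : C).
Proof.
have := fock_kern (0 : Cn R n).
rewrite (_ : kern 0 = fun=> 1)//; apply/funext => w.
by rewrite /kern (_ : Cn_conj 0 = 0) ?Cn_dot0r ?cexp0//; apply/rowP => j; rewrite !mxE conjc0.
Qed.

Lemma S_op1 F : fock F -> S_op (fun=> 1) F = F.
Proof.
move=> fF; apply/funext => z; rewrite -[RHS](fock_reproducing z fF).
by apply: eq_cintegral => p; rewrite S_integrandE fkernel1 kernJ.
Qed.

Lemma S_bounded1 : S_bounded (fun _ : Cn R n => 1 : C).
Proof.
split.
  move=> F z fF; have := inner_integrable (fock_memL2 fF) (fock_memL2 (fock_kern z)).
  by under eq_fun do rewrite kernJ -fkernel1 -S_integrandE.
split=> [F fF|a F G fF fG|]; first by rewrite S_op1.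
  by rewrite (S_op1 fF) (S_op1 fG) (S_op1 (fockD (fockZ a fF) fG)).
by exists 1 => F fF; rewrite S_op1// mul1r.
Qed.

(** For the symbol 1 the operator is the identity on the Fock space, by the reproducing property,
    and 1 is its own reflection. The pairing identity for this symbol is the self-adjointness of the
    projection. *)
Lemma fock_inner_proj F G (r : R) : fock F -> cmeasurable (fun p : RRn => G (toCn p)) ->
  (forall w, normc (G w) <= r) -> fock_inner F (fock_proj G) = fock_inner F G.
Proof.
move=> fF mG Gr; have := fock_inner_fock_proj fock1 S_bounded1 mG Gr fF.
have -> : conj_refl (fun _ : Cn R n => 1 : C) = fun=> 1.
  by apply/funext => z; rewrite /conj_refl conjc1.
by rewrite (S_op1 fF) (S_op1 (fock_fock_proj mG Gr)).
Qed.

(** The difference H = P G - F is in the Fock space, so its squared norm is the inner product of H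
    with G - F; Cauchy-Schwarz then divides out one norm of H. *)
Lemma fock_norm_proj_le F G (r : R) : fock F -> cmeasurable (fun p : RRn => G (toCn p)) ->
  (forall w, normc (G w) <= r) ->
  fock_norm (fun w => fock_proj G w - F w) <= fock_norm (fun w => G w - F w).
Proof.
move=> fF mG Gr; have fP := fock_fock_proj mG Gr.
have mL := memL2_bounded mG Gr.
pose H w := fock_proj G w - F w.
have fH : fock H.
  by have := fockD fP (fockZ (-1) fF); under eq_fun do rewrite mulN1r.
have m1 := fock_memL2 fF; have m2 := fock_memL2 fP; have m3 := fock_memL2 fH.
have E : fock_inner H H = fock_inner H (fun w => G w - F w).
  by rewrite {2}/H !(fock_innerBr _ m1 m3)// (fock_inner_proj fH mG Gr).
have := fock_CauchySchwarz m3 (memL2B mL m1); rewrite -E (fock_inner_norm m3) normc_real.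
rewrite -/H ger0_norm ?sqr_ge0// expr2.
have := fock_norm_ge0 H; rewrite le_eqVlt => /orP[/eqP <- _|h0]; first exact: fock_norm_ge0.
by rewrite ler_pM2l.
Qed.

Lemma fock_norm_proj G (r : R) : cmeasurable (fun p : RRn => G (toCn p)) ->
  (forall w, normc (G w) <= r) -> fock_norm (fock_proj G) <= fock_norm G.
Proof.
move=> mG Gr; have := fock_norm_proj_le fock0 mG Gr.
have E (H : Cn R n -> C) : (fun w => H w - 0) = H by apply/funext => w; rewrite subr0.
by rewrite !E.
Qed.

Section adjoint_operator.
Variable phi : Cn R n -> C.
Hypotheses (fphi : fock phi) (Sphi : S_bounded phi).

(* Testing against truncations of [S_op (conj_refl phi) F] itself bounds its norm. *)
Lemma fock_S_op_conj_refl_norm : exists2 M : R, 0 <= M & forall F, fock F ->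
  fock (S_op (conj_refl phi) F) /\
  fock_norm (S_op (conj_refl phi) F) <= M * fock_norm F.
Proof.
have [M M0 HM] := fock_bounded_ge0 Sphi.2; exists M => // F fF.
set H := S_op (conj_refl phi) F.
have eH : entire H := entire_S_op_conj_refl fphi Sphi fF.
have mH : cmeasurable (fun p : RRn => H (toCn p)) := entire_cmeasurable_toCn eH.
have [mL Hle] : memL2 H /\ fock_norm H <= M * fock_norm F.
  apply: (memL2_trunc_bound mH) => k.
  have mT := cmeasurable_trunc k mH; have bT := @normc_trunc R n k H.
  have mLT := memL2_trunc k mH; have fP := fock_fock_proj mT bT.
  have fSP := fock_bounded_fock Sphi.2 fP.
  have E : fock_inner H (trunc k H) = fock_inner (trunc k H) (trunc k H).
    apply: eq_cintegral => p; rewrite /trunc; case: ifPn => // _.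
    by rewrite conjc0 !mulr0.
  have := fock_CauchySchwarz (fock_memL2 fF) (fock_memL2 fSP).
  rewrite -(fock_inner_fock_proj fphi Sphi mT bT fF) -/H E (fock_inner_norm mLT).
  rewrite normc_real ger0_norm ?sqr_ge0// expr2 => h.
  have h2 : fock_norm (trunc k H) * fock_norm (trunc k H) <=
      fock_norm (trunc k H) * (M * fock_norm F).
    apply: (le_trans h); rewrite [leRHS]mulrC -[leRHS]mulrA [leRHS]mulrCA ler_wpM2l ?fock_norm_ge0//.
    apply: (le_trans (HM _ fP)); rewrite ler_wpM2l//; exact: fock_norm_proj mT bT.
  move: h2; have := fock_norm_ge0 (trunc k H).
  rewrite le_eqVlt => /orP[/eqP <- _|h0]; first by rewrite mulr_ge0 ?fock_norm_ge0.
  by rewrite ler_pM2l.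
by split=> //; split=> //; case: mL.
Qed.

Theorem S_bounded_conj_refl : S_bounded (conj_refl phi).
Proof.
have [M M0 HM] := fock_S_op_conj_refl_norm; split.
  by move=> F z fF; exact: S_integrable_conj_refl.
split=> [F /HM[]//|a F G fF fG|]; last by exists M => F /HM[].
apply/funext => z; rewrite !(S_op_conj_refl fphi Sphi).
have mK := fock_memL2 (fock_bounded_fock Sphi.2 (fock_kern z)).
rewrite (fock_innerDl (memL2Z a (fock_memL2 fF)) (fock_memL2 fG) mK).
by rewrite (fock_innerZl a (fock_memL2 fF) mK).
Qed.

(** The identity is known when [G] is a bounded function, with its projection on the right.
    Truncations of [G] approximate it in norm, their projections approximate it no worse than twice
    removed by the contraction property, and boundedness of both operators passes to the limit. *)
Theorem fock_inner_S_op_conj_refl F G : fock F -> fock G ->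
  fock_inner (S_op (conj_refl phi) F) G = fock_inner F (S_op phi G).
Proof.
move=> fF fG; have [M M0 HM] := fock_bounded_ge0 Sphi.2.
set H := S_op (conj_refl phi) F.
have fH : fock H := fock_bounded_fock S_bounded_conj_refl.2 fF.
have fSG := fock_bounded_fock Sphi.2 fG.
have mG := fock_memL2 fG; have mF := fock_memL2 fF; have mH := fock_memL2 fH.
pose A := fock_norm H + fock_norm F * M.
have A0 : 0 <= A by rewrite addr_ge0 ?mulr_ge0 ?fock_norm_ge0.
apply/eqP; rewrite -subr_eq0; apply/eqP/eq0_normc/eqP.
rewrite eq_le normc_ge0 andbT; apply/ler_addgt0Pr => e e0; rewrite add0r.
have A1 : 0 < A + 1 by rewrite ltr_wpDl.
have [k hk] := trunc_approx mG (divr_gt0 e0 A1).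
have mT := cmeasurable_trunc k mG.1; have bT := @normc_trunc R n k G.
have mLT := memL2_trunc k mG.1; have fP := fock_fock_proj mT bT.
have fSP := fock_bounded_fock Sphi.2 fP.
set P := fock_proj (trunc k G).
have fD : fock (fun w => P w - G w).
  by have := fockD fP (fockZ (-1) fG); under eq_fun do rewrite mulN1r.
have SD : S_op phi (fun w => P w - G w) = fun w => S_op phi P w - S_op phi G w.
  have [_ lin _] := Sphi.2; have := lin (-1) G P fG fP.
  rewrite (_ : (fun z => -1 * G z + P z) = fun w => P w - G w); last first.
    by apply/funext => w; rewrite mulN1r addrC.
  by move=> ->; apply/funext => w; rewrite mulN1r addrC.
(* The known identity for the truncation and its projection [P] has been inserted: the two terms it
   equates cancel. *)
have -> : fock_inner H G - fock_inner F (S_op phi G) =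
    fock_inner H (fun w => G w - trunc k G w) + fock_inner F (S_op phi (fun w => P w - G w)).
  rewrite SD (fock_innerBr mG mLT mH) (fock_innerBr (fock_memL2 fSP) (fock_memL2 fSG) mF).
  by rewrite /H (fock_inner_fock_proj fphi Sphi mT bT fF) -/H -/P addrA subrK.
have nD : fock_norm (fun w => P w - G w) <= fock_norm (fun w => G w - trunc k G w).
  apply: (le_trans (fock_norm_proj_le fG mT bT)).
  rewrite -[leRHS]mul1r; apply: fock_norm_le => //; [exact: memL2B|exact: memL2B|].
  by move=> w; rewrite mul1r normcB_sym.
apply: (le_trans (le_normcD _ _)).
apply: (@le_trans _ _ (A * fock_norm (fun w => G w - trunc k G w))).
  rewrite mulrDl lerD//; first by apply: fock_CauchySchwarz => //; exact: memL2B.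
  apply: (le_trans (fock_CauchySchwarz mF (fock_memL2 (fock_bounded_fock Sphi.2 fD)))).
  rewrite -mulrA ler_wpM2l ?fock_norm_ge0// (le_trans (HM _ fD))//.
  by rewrite ler_wpM2l.
apply: (@le_trans _ _ ((A + 1) * (e / (A + 1)))).
  by rewrite ler_pM ?fock_norm_ge0// lerDl.
by rewrite mulrC divfK ?gt_eqF.
Qed.

End adjoint_operator.

Lemma S_op_conj_refl_kern phi a : fock phi -> S_bounded phi ->
  S_op (conj_refl phi) (kern a) = fun z => fkernel (conj_refl phi) z a.
Proof.
move=> fphi Sphi; apply/funext => z; rewrite (S_op_conj_refl fphi Sphi) (S_op_kern fphi Sphi).
have fK := fock_fkernel fphi Sphi z.
rewrite (fock_innerJ (fock_memL2 fK) (fock_memL2 (fock_kern a))).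
by rewrite (fock_reproducing a fK) fkernel_conj_refl.
Qed.

Theorem fock_adjoint_S_op phi : fock phi -> S_bounded phi ->
  fock_adjoint (S_op phi) (S_op (conj_refl phi)).
Proof.
move=> fphi Sphi; split; first by case: (S_bounded_conj_refl fphi Sphi).
move=> F G fF fG.
have m1 := fock_memL2 (fock_bounded_fock Sphi.2 fF).
have m2 := fock_memL2 (fock_bounded_fock (S_bounded_conj_refl fphi Sphi).2 fG).
rewrite (fock_innerJ m2 (fock_memL2 fF)) (fock_inner_S_op_conj_refl fphi Sphi fG fF).
by rewrite (fock_innerJ (fock_memL2 fG) m1) //.
Qed.

End adjoint.

(** * Normality *)

Section normality.
Context {R : realType} {n : nat}.
Local Notation C := R[i].
Local Notation RRn := (Rn R n * Rn R n)%type.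
Local Notation gamma := (@gaussian R n).
Implicit Types (phi F G : Cn R n -> C) (z w a : Cn R n) (s t : Rn R n).

Lemma Cn_conj_ofRn s : Cn_conj (ofRn s) = ofRn s.
Proof. by apply/rowP => j; rewrite !mxE conjc_real. Qed.

(* The exponents agree after the substitution [z = a + b - conj w] of
   [fock_inner_fkernel_real], whose Gaussian weight is the first factor. *)
Lemma fkernel_swap phi a b w : Cn_conj a = a -> Cn_conj b = b ->
  ((expR (Cn_sqnorm w - Cn_sqnorm (a + b - Cn_conj w)))%:C)%C *
    (fkernel phi (a + b - Cn_conj w) a * ((fkernel phi (a + b - Cn_conj w) b)^*)%C) =
  ((fkernel phi a w)^*)%C * fkernel phi b w.
Proof.
move=> ra rb; rewrite /fkernel ra rb.
rewrite (_ : a + b - Cn_conj w - a = b - Cn_conj w); last by rewrite addrAC [a + b]addrC addrK.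
rewrite (_ : a + b - Cn_conj w - b = a - Cn_conj w); last by rewrite addrAC addrK.
move: (phi (b - _)) (phi (a - _)) => P Q.
have realB (x y : R) : ((x - y)%:C)%C = (x%:C)%C - (y%:C)%C by exact: rmorphB.
rewrite !conjc_mul -!cexpJ !Cn_dot_conj -cexp_real realB !Cn_sqnorm_dot.
rewrite !Cn_conjB !Cn_conjD !Cn_conjK ra rb.
have rearrange (W X Y U V : C) : W * X * Y = U * V ->
  W * ((X * P) * (Y * (Q^*)%C)) = (U * (Q^*)%C) * (V * P).
  by move=> e; transitivity (W * X * Y * (P * (Q^*)%C)); [ring|rewrite e; ring].
apply: rearrange; rewrite -!cexpD; congr cexp.
rewrite !(Cn_dotDl, Cn_dotDr, Cn_dotNl, Cn_dotNr).
rewrite (Cn_dotC b a) (Cn_dotC (Cn_conj w) a) (Cn_dotC (Cn_conj w) b) (Cn_dotC (Cn_conj w) w).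
rewrite (Cn_dotC w b).
move: (Cn_dot a a) (Cn_dot a b) (Cn_dot b b) (Cn_dot a w) (Cn_dot b w) (Cn_dot a (Cn_conj w))
  (Cn_dot b (Cn_conj w)) (Cn_dot w (Cn_conj w)) => aa ab bb aw bw aw' bw' ww.
by ring.
Qed.

Lemma fock_inner_fkernel_real phi s t : entire phi ->
  fock_inner (fun z => fkernel phi z (ofRn s)) (fun z => fkernel phi z (ofRn t)) =
  fock_inner (fun z => fkernel (conj_refl phi) z (ofRn s))
             (fun z => fkernel (conj_refl phi) z (ofRn t)).
Proof.
move=> ephi; pose c : Rn R n := [tuple tnth s j + tnth t j | j < n].
have cE : ofRn c = ofRn s + ofRn t.
  by apply/rowP => j; rewrite !mxE tnth_mktuple rmorphD.
have [tau Ht E] := reflection_preserving c.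
have mK u : cmeasurable (fun p : RRn => fkernel phi (toCn p) (ofRn u)).
  exact: entire_cmeasurable_toCn (entire_fkernel (ofRn u) ephi).
rewrite [LHS]/fock_inner /gaussian_integral.
rewrite -(cintegral_gaussian_cv Ht (cmeasurableM (mK s) (cmeasurableJ (mK t)))).
apply: eq_cintegral => p; rewrite /gauss_weight E cE.
rewrite (fkernel_swap phi (toCn p) (Cn_conj_ofRn s) (Cn_conj_ofRn t)).
by rewrite !fkernel_conj_refl conjcK.
Qed.

Lemma conj_functional_sub (L1 L2 : (Cn R n -> C) -> C) :
  conj_functional L1 -> conj_functional L2 -> conj_functional (fun F => L1 F - L2 F).
Proof.
move=> [l1 [M1 M10 H1]] [l2 [M2 M20 H2]]; split=> [a F G fF fG|].
  by rewrite l1// l2//; ring.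
exists (M1 + M2) => [|F fF]; first exact: addr_ge0.
by rewrite (le_trans (normcB_le _ _))// mulrDl lerD ?H1 ?H2.
Qed.

Section normal.
Variable phi : Cn R n -> C.
Hypotheses (fphi : fock phi) (Sphi : S_bounded phi).
Let S := S_op phi.
Let S' := S_op (conj_refl phi).
Let bS : fock_bounded S := Sphi.2.
Let bS' : fock_bounded S' := (S_bounded_conj_refl fphi Sphi).2.

Let defect F G : C := fock_inner (S F) (S G) - fock_inner (S' F) (S' G).

Let conj_functional_defect F : fock F -> conj_functional (defect F).
Proof.
move=> fF; apply: conj_functional_sub.
  exact: (conj_functional_inner bS (fock_memL2 (fock_bounded_fock bS fF))).
exact: (conj_functional_inner bS' (fock_memL2 (fock_bounded_fock bS' fF))).
Qed.

Let defectJ F G : fock F -> fock G -> defect G F = ((defect F G)^*)%C.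
Proof.
move=> fF fG.
have m1 := fock_memL2 (fock_bounded_fock bS fF).
have m2 := fock_memL2 (fock_bounded_fock bS fG).
have m3 := fock_memL2 (fock_bounded_fock bS' fF).
have m4 := fock_memL2 (fock_bounded_fock bS' fG).
rewrite /defect (fock_innerJ m1 m2) (fock_innerJ m3 m4).
by move: (fock_inner _ _) (fock_inner _ _) => u v; rewrite -[LHS]rmorphB.
Qed.

(** With the first argument at a real point, vanishing at real second arguments extends to all of
    them. Hermitian symmetry exchanges the arguments, and the same extension then frees the first
    one. *)
Let defect_kern z w : defect (kern z) (kern w) = 0.
Proof.
have real s w' : defect (kern (ofRn s)) (kern w') = 0.
  apply: (conj_functional_real_zero (conj_functional_defect (fock_kern (ofRn s)))) => t.
  rewrite /defect /S /S' !(S_op_kern fphi Sphi) !(S_op_conj_refl_kern _ fphi Sphi).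
  by rewrite fock_inner_fkernel_real ?subrr//; case: fphi.
apply: (conj_functional_real_zero (conj_functional_defect (fock_kern z))) => t.
by rewrite defectJ ?real ?conjc0//; exact: fock_kern.
Qed.

Let adj F G : fock F -> fock G -> fock_inner (S F) G = fock_inner F (S' G).
Proof. exact: (fock_adjoint_S_op fphi Sphi).2. Qed.

Let adj' F G : fock F -> fock G -> fock_inner (S' F) G = fock_inner F (S G).
Proof. exact: fock_inner_S_op_conj_refl. Qed.

(** On kernels, the values at [w] of the two products are the two inner products compared by
    [defect]. For general [F], moving both operators across the pairing with [kern z] reduces the
    claim to that case. *)
Lemma S_op_conj_refl_commute F : fock F -> S (S' F) = S' (S F).
Proof.
move=> fF.
have fS G : fock G -> fock (S G) := fock_bounded_fock bS (F := G).
have fS' G : fock G -> fock (S' G) := fock_bounded_fock bS' (F := G).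
have commute_kern z : S (S' (kern z)) = S' (S (kern z)).
  apply/funext => w; have fz := fock_kern z; have fw := fock_kern w.
  rewrite -(fock_reproducing w (fS _ (fS' _ fz))) -(fock_reproducing w (fS' _ (fS _ fz))).
  rewrite (adj (fS' _ fz) fw) (adj' (fS _ fz) fw).
  by have /eqP := defect_kern z w; rewrite subr_eq0 => /eqP ->.
apply/funext => z; have fz := fock_kern z.
rewrite -(fock_reproducing z (fS _ (fS' _ fF))) -(fock_reproducing z (fS' _ (fS _ fF))).
rewrite (adj (fS' _ fF) fz) (adj' fF (fS' _ fz)) (adj' (fS _ fF) fz) (adj fF (fS _ fz)).
by rewrite commute_kern.
Qed.

End normal.

(** For real [x], replacing [z] by [- conj z] in x - (i/2) z and then conjugating restores it: the
    sign of the reflection cancels that of conj i. Only [m] remains conjugated. *)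
Lemma symbol_conj (m : Rn R n -> C) :
  symbol (fun x => ((m x)^*)%C) = conj_refl (symbol m).
Proof.
apply/funext => z; rewrite /symbol /conj_refl conjc_mul conjc_real -cintegralJ.
congr (_ * _); apply: eq_cintegral => x; rewrite /symbol_integrand conjc_mul -cexpJ.
congr (_ * cexp _); rewrite conjc_mul Cn_dot_conj; congr (_ * _).
  by rewrite rmorphN rmorph_nat.
have -> : Cn_conj (ofRn x - ('i / 2)%C *: - Cn_conj z) = ofRn x - ('i / 2)%C *: z.
  rewrite scalerN opprK Cn_conjD Cn_conj_ofRn Cn_conjZ Cn_conjK -scaleNr; congr (_ + _ *: _).
  by apply: complex_ext => /=; ring.
by [].
Qed.

End normality.

Theorem theorem1p2 (R : realType) (n : nat) (n_ge1 : (1 <= n)%N)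
    (phi : Cn R n -> R[i]) (phi_fock : fock phi) (S_phi_bounded : S_bounded phi)
    (m : Rn R n -> R[i]) (m_Linfty : mem_Linfty (lebesgueRn R n) m)
    (phiE : forall z : Cn R n, phi z = symbol m z) :
  let phi' : Cn R n -> R[i] := symbol (fun x => ((m x)^*)%C) in
  [/\ S_bounded phi', fock_adjoint (S_op phi) (S_op phi')
    & fock_normal (S_op phi)].
Proof.
move=> phi'; have -> : phi' = conj_refl phi.
  by rewrite /phi' symbol_conj; congr conj_refl; apply/funext => z; rewrite phiE.
have adj := fock_adjoint_S_op phi_fock S_phi_bounded.
split; [exact: (S_bounded_conj_refl phi_fock S_phi_bounded)|exact: adj|].
split; first exact: S_phi_bounded.2.
exists (S_op (conj_refl phi)); first exact: adj.
exact: (S_op_conj_refl_commute phi_fock S_phi_bounded).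
Qed.
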